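(* Let $w_0\in\mathbb{C}$ with $\operatorname{Im} w_0\ge 0$ and $w_0\neq 0$, and let $\tau:\Pi^+\to\Pi^+$, $\tau(w)=w+w_0$ (a parabolic self-map of $\Pi^+$). Let $\mathcal{H}$ be either the Hardy space $H^2(\Pi^+)$ or a weighted Bergman space $\mathcal{A}^2_\alpha(\Pi^+)$ with $\alpha>-1$. Then the spectrum of the bounded composition operator $C_\tau:\mathcal{H}\to\mathcal{H}$, $C_\tau F=F\circ\tau$, is $$\sigma(C_\tau;\mathcal{H})=\overline{\{e^{iw_0t}:t\in[0,\infty)\}}=\begin{cases}\mathbb{T}, & \text{if } w_0\in\mathbb{R},\\ \{e^{iw_0t}:t\in[0,\infty)\}\cup\{0\}, & \text{if } w_0\in\Pi^+.\end{cases}$$ Moreover, in both cases the essential spectrum coincides with the spectrum: $\sigma_{ess}(C_\tau;\mathcal{H})=\sigma(C_\tau;\mathcal{H})$.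
   Context: $\Pi^+=\{w\in\mathbb{C}:\operatorname{Im} w>0\}$ is the upper half-plane and $\mathbb{T}=\{z\in\mathbb{C}:|z|=1\}$. The Hardy space $H^2(\Pi^+)$ consists of the analytic $F:\Pi^+\to\mathbb{C}$ with $$\|F\|_{H^2(\Pi^+)}=\sup_{y>0}\Big(\int_{-\infty}^\infty|F(x+iy)|^2\,dx\Big)^{1/2}<\infty.$$ For $\alpha>-1$ the weighted Bergman space $\mathcal{A}^2_\alpha(\Pi^+)$ consists of the analytic $F:\Pi^+\to\mathbb{C}$ with $$\|F\|_{\mathcal{A}^2_\alpha(\Pi^+)}=\Big(\int_{\Pi^+}|F(x+iy)|^2\,y^\alpha\,dx\,dy\Big)^{1/2}<\infty.$$ These are complex Hilbert spaces, and $C_\tau$ is a bounded linear operator on each of them for the maps $\tau$ considered. For a bounded linear operator $T$ on a Hilbert space $\mathcal{H}$: $\sigma(T;\mathcal{H})=\{\lambda\in\mathbb{C}: T-\lambda \text{ is not invertible on }\mathcal{H}\}$, and $\sigma_{ess}(T;\mathcal{H})=\{\lambda\in\mathbb{C}: T-\lambda\text{ is not a Fredholm operator on }\mathcal{H}\}$. *)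

(* Defs.v *)
From HB Require Import structures.
From mathcomp Require Import all_boot all_order all_algebra.
From mathcomp Require Import complex.
From mathcomp Require Import all_classical all_reals all_analysis measurable_realfun.
From mathcomp Require Import lra.

(* The complex numbers are R[i] for R : realType; R[i]^o is R[i] seen as a
   normed module over itself. *)

Set Implicit Arguments.
Unset Strict Implicit.
Unset Printing Implicit Defensive.

Import Order.TTheory GRing.Theory Num.Theory.
Import numFieldNormedType.Exports.
Import Normc.
Local Open Scope classical_set_scope.
Local Open Scope ring_scope.
Local Open Scope complex_scope.

(* The library has no complex exponential: e^(a+ib) = e^a (cos b + i sin b). *)
Definition cexp (R : realType) (z : R[i]) : R[i] :=
  (expR (complex.Re z))%:C * (cos (complex.Im z) +i* sin (complex.Im z)).

Record uhp (R : rcfType) := Uhp { uval :> R[i] ; uvalP : 0 < complex.Im uval }.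
HB.instance Definition _ (R : rcfType) := [isSub for @uval R].

Section holomorphic_functions.
Variable R : realType.
Implicit Types F G : uhp R -> R[i]^o.

(* Extension by 0 to the whole plane. As the half-plane is open, differentiability
   of the extension at a point of the half-plane only depends on F. *)
Definition uhp_ext F : R[i]^o -> R[i]^o :=
  fun z => if insub z is Some w then F w else 0.

(* derivable over the field R[i]: the limit of h^-1 *: (F (w + h) - F w) as the
   complex number h tends to 0 exists *)
Definition holomorphic F :=
  forall w : uhp R, derivable (uhp_ext F) (uval w) 1.

Definition hardy_norm F : \bar R :=
  ereal_sup [set ((\int[@lebesgue_measure R]_x
    (normc (uhp_ext F (x +i* y)) ^+ 2)%:E) `^ 2^-1)%E | y in [set y : R | 0 < y]].

Definition bergman_norm (alpha : R) F : \bar R :=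
  ((\int[@lebesgue_measure R \x @lebesgue_measure R]_(p in
       [set p : R * R | (0 < p.2)%R])
    (normc (uhp_ext F (p.1 +i* p.2)) ^+ 2 * p.2 `^ alpha)%:E) `^ 2^-1)%E.

End holomorphic_functions.

(* The weighted L2 seminorm with respect to w.mu, of which both norms above are
   instances; used only to prove the norm axioms. *)
Section wL2.
Context d (T : measurableType d) (R : realType).
Variables (mu : {measure set T -> \bar R}) (D : set T) (mD : measurable D).
Variables (w : T -> R) (w0 : forall x, D x -> 0 <= w x) (mw : measurable_fun D w).
Implicit Types g : T -> R.

Definition wL2 g : \bar R := ((\int[mu]_(x in D) (g x ^+ 2 * w x)%:E) `^ 2^-1)%E.

Let h g := (fun x => g x * Num.sqrt (w x)) \_ D.

Let mh g : measurable_fun D g -> measurable_fun setT (h g).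
Proof.
move=> mg; apply/(measurable_restrictT _ mD).1.
apply: measurable_funM => //.
by apply: measurableT_comp => //; apply: continuous_measurable_fun; exact: sqrt_continuous.
Qed.

Let mgw g : measurable_fun D g ->
  measurable_fun D (fun x => (g x ^+ 2 * w x)%:E).
Proof.
move=> mg; apply/measurable_EFinP; apply: measurable_funM => //.
exact: measurable_funX.
Qed.

Let gw0 g x : D x -> (0 <= (g x ^+ 2 * w x)%:E)%E.
Proof. by move=> Dx; rewrite lee_fin mulr_ge0 ?sqr_ge0 ?w0. Qed.

Lemma wL2E g : wL2 g = ('N[mu]_2%:E[EFin \o h g])%E.
Proof.
rewrite unlock /wL2; congr ((_ `^ _)%E).
rewrite integral_mkcond; apply: eq_integral => x _.
rewrite /h /patch /=; case: ifPn => [|_].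
  rewrite inE => Dx; rewrite powR_mulrn// real_normK ?num_real// exprMn.
  by rewrite sqr_sqrtr ?w0.
by rewrite normr0 powR0.
Qed.

Lemma wL2_ge0 g : (0 <= wL2 g)%E.
Proof. exact: poweR_ge0. Qed.

Lemma le_wL2 g1 g2 : measurable_fun D g1 -> measurable_fun D g2 ->
  (forall x, D x -> 0 <= g1 x <= g2 x) -> (wL2 g1 <= wL2 g2)%E.
Proof.
move=> m1 m2 le12; apply: gt0_ler_poweR => //;
  rewrite ?in_itv/= ?leey ?integral_ge0//; do 1?exact: gw0.
apply: ge0_le_integral => //; try exact: mgw; first exact: gw0.
move=> x Dx; rewrite lee_fin ler_wpM2r ?w0//.
by have /andP[? ?] := le12 _ Dx; rewrite lerXn2r// nnegrE (le_trans _ (_ : g1 x <= _)).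
Qed.

Lemma wL2D g1 g2 : measurable_fun D g1 -> measurable_fun D g2 ->
  (wL2 (g1 \+ g2)%R <= wL2 g1 + wL2 g2)%E.
Proof.
move=> m1 m2; rewrite !wL2E.
have -> : h (g1 \+ g2) = (h g1 \+ h g2).
  by apply/funext => x; rewrite /h /patch/=; case: ifP => _; rewrite ?addr0// mulrDl.
by apply: minkowski_EFin; rewrite ?ler1n//; exact: mh.
Qed.

Lemma wL2Z c g : measurable_fun D g -> (wL2 (c \*o g)%R = `|c|%:E * wL2 g)%E.
Proof.
move=> mg; rewrite /wL2.
under eq_integral do rewrite /= exprMn -mulrA EFinM.
rewrite ge0_integralZl_EFin ?sqr_ge0//; do ?[exact: gw0|exact: mgw].
rewrite poweRM ?lee_fin ?sqr_ge0 ?integral_ge0//; last exact: gw0.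
congr (_ * _)%E; rewrite poweR_EFin -real_normK ?num_real//.
by rewrite -powR_mulrn// -powRrM mulfV// powRr1.
Qed.

Lemma wL2_eq0 g : measurable_fun D g -> (forall x, D x -> 0 < w x) ->
  wL2 g = 0%E -> mu.-negligible [set x | D x /\ g x <> 0].
Proof.
move=> mg wgt0 /poweR_eq0_eq0 => /(_ (integral_ge0 _ _)) h0.
have : (\int[mu]_(x in D) `| (g x ^+ 2 * w x)%:E |)%E = 0%E.
  rewrite -[RHS]h0; last exact: gw0.
  by apply: eq_integral => x; rewrite inE => Dx; rewrite gee0_abs ?gw0.
move=> /(ae_eq_integral_abs _ mD (mgw mg)); apply: negligibleS => x /=.
move=> [Dx gx] /(_ Dx) [] /eqP; rewrite mulf_eq0 sqrf_eq0 (gt_eqF (wgt0 _ Dx)) orbF.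
by move/eqP.
Qed.

End wL2.

Section norm_axioms.
Variable R : realType.
Implicit Types F G : uhp R -> R[i]^o.

Lemma normc_norm (z : R[i]) : `|z| = (normc z)%:C.
Proof. by []. Qed.

Definition cmod F (p : R * R) : R := normc (uhp_ext F (p.1 +i* p.2)).

Lemma normc_ge0 (z : R[i]) : 0 <= normc z.
Proof. by case: z => a b; exact: sqrtr_ge0. Qed.

Lemma ler_dist_normc (z z' : R[i]) : `|normc z - normc z'| <= normc (z - z').
Proof.
rewrite ler_norml; apply/andP; split.
  rewrite -normcN opprB lerBrDl -lerBrDr opprK.
  by rewrite (le_trans _ (le_normcD _ _))// addrC subrK.
by rewrite lerBlDr (le_trans _ (le_normcD _ _))// subrK.
Qed.

Lemma normc_le (x y : R) : normc (x +i* y) <= `|x| + `|y|.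
Proof.
have -> : x +i* y = (x%:C + (0 +i* y) : Rcomplex R) by apply/eqP; rewrite eq_complex /= addr0 add0r !eqxx.
apply: (le_trans (le_normcD _ _)).
by rewrite /= !expr0n/= !addr0 !add0r !sqrtr_sqr.
Qed.

Lemma cmod_continuous F a b : holomorphic F -> 0 < b -> forall e, 0 < e ->
  exists2 r, 0 < r & forall x y, `|x - a| < r -> `|y - b| < r ->
    `|cmod F (x, y) - cmod F (a, b)| < e.
Proof.
move=> hF b0 e e0.
have := hF (@Uhp R (a +i* b) b0).
move=> /derivable1_diffP/differentiable_continuous/= cF.

have e0C : 0 < e%:C by rewrite ltcR.
move/cvgrPdist_lt : cF => /(_ _ e0C) /nbhs_ballP[r /= r0 Br].
have [r' rE] : exists r' : R, r = r'%:C.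
  by apply/complex_realP; rewrite gtr0_real.
move: r0 Br; rewrite {}rE ltcR => r0 Br.
exists (r' / 2); first by rewrite divr_gt0.
move=> x y xa yb; rewrite distrC; apply: le_lt_trans (ler_dist_normc _ _) _.
rewrite -ltcR -normc_norm; apply: Br.
rewrite -ball_normE /= normc_norm ltcR.
have -> : (a +i* b - x +i* y) = (a - x) +i* (b - y) by simpc.
apply: (le_lt_trans (normc_le _ _)).
by rewrite (splitr r') ltrD// distrC.
Qed.

Lemma open_rect_measurable (U : set (R * R)) :
  (forall a b, U (a, b) -> exists2 r, 0 < r &
     forall x y, `|x - a| < r -> `|y - b| < r -> U (x, y)) ->
  measurable U.
Proof.
move=> oU.
pose V (q : rat * rat * rat) : set (R * R) :=
  ball (ratr q.1.1 : R) (ratr q.2) `*` ball (ratr q.1.2 : R) (ratr q.2).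
suff -> : U = \bigcup_q [set p | V q `<=` U /\ V q p].
  apply: countable_bigcupT_measurable => // q.
  have [VU|VU] := pselect (V q `<=` U).
    rewrite [X in measurable X](_ : _ = V q); last by apply/seteqP; split => p // [].
    by apply: measurableX; exact: measurable_ball.
  rewrite [X in measurable X](_ : _ = set0)//.
  by apply/seteqP; split => p // [].
apply/seteqP; split=> [[a b] Uab|p [q _ [+ Vqp]]]; last exact.
have [r r0 rU] := oU _ _ Uab.
have r20 : 0 < r / 2 by rewrite divr_gt0.
have /rat_in_itvoo[s] := r20; rewrite in_itv/= => /andP[s0 sr].
have /rat_in_itvoo[p] : a < a + ratr s by rewrite ltrDl.
rewrite in_itv/= => /andP[ap pa].
have /rat_in_itvoo[q] : b < b + ratr s by rewrite ltrDl.
rewrite in_itv/= => /andP[bq qb].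
exists ((p, q), s) => //; split; last first.
  by split; rewrite /ball/= ltr_distl; apply/andP; split; lra.
move=> [x y] []; rewrite /ball/= !ltr_distl => /andP[? ?] /andP[? ?].
by apply: rU; rewrite ltr_distl; apply/andP; split; lra.
Qed.

Lemma measurable_uhp : measurable [set p : R * R | 0 < p.2].
Proof.
apply: open_rect_measurable => a b /= b0; exists b => // x y _.
by rewrite ltr_distl => /andP[+ _]; rewrite subrr.
Qed.

Lemma measurable_cmod F : holomorphic F ->
  measurable_fun [set p : R * R | 0 < p.2] (cmod F).
Proof.
move=> hF; apply: (measurability _ (RGenOInfty.measurableE R)).
move=> _ [_ [c ->] <-]; apply: open_rect_measurable => a b [/= b0].
rewrite /= in_itv/= andbT => cab.

have ec : 0 < cmod F (a, b) - c by rewrite subr_gt0.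
have [r r0 rP] := cmod_continuous a hF b0 ec.
exists (Num.min r b); first by rewrite lt_min r0.
move=> x y; rewrite !lt_min => /andP[xr _] /andP[yr yb]; split => /=.
  by move: yb; rewrite ltr_distl subrr => /andP[].
rewrite in_itv/= andbT; have := rP x y xr yr.
by rewrite ltr_distl subKr => /andP[].
Qed.

Lemma cmodD F G p : cmod (F + G) p <= cmod F p + cmod G p.
Proof.
rewrite /cmod /uhp_ext; case: insubP => [u _ _|_]; first exact: le_normcD.
by rewrite normc0 addr0.
Qed.

Lemma cmodZ (c : R[i]) F p : cmod (c *: F) p = normc c * cmod F p.
Proof.
rewrite /cmod /uhp_ext; case: insubP => [u _ _|_]; last by rewrite normc0 mulr0.
by rewrite -normcM.
Qed.

Lemma cmod0 p : cmod 0 p = 0.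
Proof. by rewrite /cmod /uhp_ext; case: insubP => [u _ _|_]; rewrite normc0. Qed.

Lemma holomorphic_lincomb c F G : holomorphic F -> holomorphic G ->
  holomorphic (c *: F + G).
Proof.
move=> hF hG w.
have -> : uhp_ext (c *: F + G) = (fun z => c *: uhp_ext F z) + uhp_ext G.
  apply/funext => z; rewrite /uhp_ext/= !fctE.
  by case: insubP => [u _ _|_] //=; rewrite scaler0 addr0.
by apply: derivableD; [exact: derivableZ|].
Qed.

Lemma holomorphic0 : holomorphic (0 : uhp R -> R[i]^o).
Proof.
move=> w; rewrite (_ : uhp_ext 0 = cst 0); first exact: derivable_cst.
by apply/funext => z; rewrite /uhp_ext; case: insubP.
Qed.

Lemma cmod_gt0 F a b : holomorphic F -> 0 < b -> cmod F (a, b) != 0 ->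
  exists2 r, 0 < r & (ball a r `*` ball b r) `<=`
    [set p | 0 < p.2 /\ cmod F p <> 0].
Proof.
move=> hF b0 F0.
have e0 : 0 < cmod F (a, b) by rewrite lt_neqAle eq_sym F0 normc_ge0.
have [r r0 rP] := cmod_continuous a hF b0 e0.
exists (Num.min r b); first by rewrite lt_min r0.
move=> [x y] [] /=; rewrite /ball/= !lt_min => /andP[xr _] /andP[yr yb].
rewrite distrC in xr; rewrite distrC in yr.
split.
  by move: yb; rewrite ltr_distl => /andP[_]; lra.
have := rP x y xr yr.
by rewrite ltr_distl subrr => /andP[/gt_eqF/eqP].
Qed.

Local Notation leb := (@lebesgue_measure R).

Lemma hardy_normE F : hardy_norm F =
  ereal_sup [set wL2 leb setT (cst 1) (fun x => cmod F (x, y)) |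
    y in [set y : R | 0 < y]].
Proof.
congr ereal_sup; apply: eq_imagel => y _.
by congr (_ `^ _)%E; apply: eq_integral => x _; rewrite mulr1.
Qed.

Lemma bergman_normE alpha F : bergman_norm alpha F =
  wL2 (leb \x leb)%E [set p | 0 < p.2] (fun p => p.2 `^ alpha) (cmod F).
Proof. by []. Qed.

Lemma measurable_cmodx F y : holomorphic F -> 0 < y ->
  measurable_fun setT (fun x => cmod F (x, y)).
Proof.
move=> hF y0; apply: (measurable_comp measurable_uhp) (measurable_cmod hF) _.
  by move=> _ [x _ <-].
exact: pair2_measurable.
Qed.


Lemma ball_gt0 a r : 0 < r -> (0 < leb (ball a r))%E.
Proof. by move=> r0; rewrite lebesgue_measure_ball ?ltW// lte_fin mulrn_wgt0. Qed.

Lemma hardy_ge0 F : (0 <= hardy_norm F)%E.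
Proof.
rewrite hardy_normE; apply: (@le_trans _ _ (wL2 leb setT (cst 1) (fun x => cmod F (x, 1)))).
  exact: wL2_ge0.
by apply: ereal_sup_ubound; exists 1 => //=.
Qed.

Lemma hardyD F G : holomorphic F -> holomorphic G ->
  (hardy_norm (F + G)%R <= hardy_norm F + hardy_norm G)%E.
Proof.
move=> hF hG; rewrite !hardy_normE; apply: ge_ereal_sup => _ [y /= y0 <-].
have mF := measurable_cmodx hF y0; have mG := measurable_cmodx hG y0.
have m1 : measurable_fun setT (cst (1 : R) : R -> R) by [].
have hFG : holomorphic (F + G) by rewrite -[F]scale1r; exact: holomorphic_lincomb.
apply: (le_trans (le_wL2 leb _ _ m1 (measurable_cmodx hFG y0)
  (measurable_funD mF mG) _)) => //.
  by move=> x _; rewrite normc_ge0 cmodD.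
apply: (le_trans (wL2D leb _ _ m1 mF mG)) => //.
by apply: leeD; apply: ereal_sup_ubound; exists y.
Qed.

Lemma hardyZ (c : R[i]) F : holomorphic F ->
  hardy_norm (c *: F) = ((normc c)%:E * hardy_norm F)%E.
Proof.
move=> hF; rewrite !hardy_normE -ereal_supZl ?normc_ge0//; last first.
  by apply/set0P; eexists; exists 1 => //=.
congr ereal_sup; rewrite image_comp; apply: eq_imagel => y /= y0.
have mF := measurable_cmodx hF y0.
have m1 : measurable_fun setT (cst (1 : R) : R -> R) by [].
rewrite -[normc c]ger0_norm ?normc_ge0// -(wL2Z leb _ _ m1 _ mF)//.
by congr wL2; apply/funext => x; rewrite cmodZ.
Qed.

Lemma hardy_eq0 F : holomorphic F -> hardy_norm F = 0%E -> F = 0.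
Proof.
move=> hF; rewrite hardy_normE => F0; apply/funext => -[[a b] /= b0].
apply: contrapT => /eqP Fab.
have Fab' : cmod F (a, b) != 0.
  rewrite /cmod /uhp_ext insubT/=; apply: contra Fab => /eqP/eq0_normc h.
  by apply/eqP.
have [r r0 rP] := cmod_gt0 hF b0 Fab'.
have m1 : measurable_fun setT (cst (1 : R) : R -> R) by [].
have : wL2 leb setT (cst 1) (fun x => cmod F (x, b)) = 0%E.
  apply/eqP; rewrite eq_le wL2_ge0 andbT -F0.
  by apply: ereal_sup_ubound; exists b.
move=> h; have neg := @wL2_eq0 _ _ R leb setT measurableT (cst 1)
  (fun _ _ => ler01) m1 _ (measurable_cmodx hF b0) (fun _ _ => ltr01) h.
have : leb.-negligible (ball a r).
  apply: negligibleS neg => x xa; split => //.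
  have [] := rP (x, b) => //; split => //=; exact: ballxx.
move/(negligibleP leb (measurable_ball a r)) => h'.
by have := ball_gt0 a r0; rewrite [X in (_ < X)%E]h' ltxx.
Qed.

Variable alpha : R.

Lemma bergman_ge0 F : (0 <= bergman_norm alpha F)%E.
Proof. exact: wL2_ge0. Qed.

Let wgt0 (p : R * R) : 0 < p.2 -> 0 < p.2 `^ alpha.
Proof. by move=> p0; rewrite powR_gt0. Qed.

Let wge0 (p : R * R) : 0 < p.2 -> 0 <= p.2 `^ alpha.
Proof. by move=> p0; rewrite powR_ge0. Qed.

Let mw : measurable_fun [set p : R * R | 0 < p.2]
  (fun p : R * R => p.2 `^ alpha).
Proof.
apply: (@measurable_funS _ _ _ _ setT) => //.
exact: (measurableT_comp (measurable_powR alpha) measurable_snd).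
Qed.

Lemma bergmanD F G : holomorphic F -> holomorphic G ->
  (bergman_norm alpha (F + G)%R <= bergman_norm alpha F + bergman_norm alpha G)%E.
Proof.
move=> hF hG; rewrite !bergman_normE.
have mF := measurable_cmod hF; have mG := measurable_cmod hG.
have hFG : holomorphic (F + G) by rewrite -[F]scale1r; exact: holomorphic_lincomb.
apply: (le_trans (le_wL2 (leb \x leb)%E measurable_uhp wge0 mw
  (measurable_cmod hFG) (measurable_funD mF mG) _)).
  by move=> x _; rewrite normc_ge0 cmodD.
exact: (wL2D (leb \x leb)%E measurable_uhp wge0 mw mF mG).
Qed.

Lemma bergmanZ (c : R[i]) F : holomorphic F ->
  bergman_norm alpha (c *: F) = ((normc c)%:E * bergman_norm alpha F)%E.
Proof.
move=> hF; rewrite !bergman_normE.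
rewrite -[normc c]ger0_norm ?normc_ge0//.
rewrite -(wL2Z (leb \x leb)%E measurable_uhp wge0 mw _ (measurable_cmod hF))//.
by congr wL2; apply/funext => x; rewrite cmodZ.
Qed.

Lemma bergman_eq0 F : holomorphic F -> bergman_norm alpha F = 0%E -> F = 0.
Proof.
move=> hF; rewrite bergman_normE => F0; apply/funext => -[[a b] /= b0].
apply: contrapT => /eqP Fab.
have Fab' : cmod F (a, b) != 0.
  rewrite /cmod /uhp_ext insubT/=; apply: contra Fab => /eqP/eq0_normc h.
  by apply/eqP.
have [r r0 rP] := cmod_gt0 hF b0 Fab'.
have neg := @wL2_eq0 _ _ R (leb \x leb)%E _ measurable_uhp _ wge0 mw _
  (measurable_cmod hF) wgt0 F0.
have : (leb \x leb)%E.-negligible (ball a r `*` ball b r).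
  by apply: negligibleS neg => p /rP.
have mb (c : R) : measurable (ball c r : set (measurableTypeR R)).
  exact: measurable_ball.
move/(negligibleP (leb \x leb)%E (measurableX (mb a) (mb b))) => h.
have : (0 < (leb \x leb) (ball a r `*` ball b r))%E.
  by rewrite product_measure1E// mule_gt0// ball_gt0.
by rewrite [X in (_ < X)%E]h ltxx.
Qed.

End norm_axioms.

(* Hardy is H^2, Bergman alpha is A^2_alpha; the latter carries alpha > -1. *)
Variant hspace_kind (R : realType) : Type :=
  | Hardy
  | Bergman (alpha : R) of -1 < alpha.
Arguments Hardy {R}.

Section HSpace.
Variables (R : realType) (k : hspace_kind R).
Implicit Types F G : uhp R -> R[i]^o.

Definition hspace_norm F : \bar R :=
  match k with
  | Hardy => hardy_norm F
  | Bergman alpha _ => bergman_norm alpha F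
  end.

Lemma hspace_norm_ge0 F : (0 <= hspace_norm F)%E.
Proof. by rewrite /hspace_norm; case: k => *; [exact: hardy_ge0|exact: bergman_ge0]. Qed.

Lemma hspace_normD F G : holomorphic F -> holomorphic G ->
  (hspace_norm (F + G)%R <= hspace_norm F + hspace_norm G)%E.
Proof. by rewrite /hspace_norm; case: k => *; [exact: hardyD|exact: bergmanD]. Qed.

Lemma hspace_normZ (c : R[i]) F : holomorphic F ->
  hspace_norm (c *: F) = ((normc c)%:E * hspace_norm F)%E.
Proof. by rewrite /hspace_norm; case: k => *; [exact: hardyZ|exact: bergmanZ]. Qed.

Lemma hspace_norm_eq0 F : holomorphic F -> hspace_norm F = 0%E -> F = 0.
Proof.
by rewrite /hspace_norm; case: k => [|alpha _];
  [exact: hardy_eq0|exact: bergman_eq0].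
Qed.

Definition in_hspace : {pred uhp R -> R[i]^o} :=
  mem [set F | holomorphic F /\ (hspace_norm F < +oo)%E].

Record hspace := HSpace {
  hspace_fun :> uhp R -> R[i]^o ;
  hspaceP : hspace_fun \in in_hspace }.

HB.instance Definition _ := [isSub for hspace_fun].
HB.instance Definition _ := [Choice of hspace by <:].

Lemma in_hspace_submod_closed : submod_closed in_hspace.
Proof.
split; rewrite ?inE/=.
  split; first exact: holomorphic0.
  rewrite -(scale0r 0) hspace_normZ; last exact: holomorphic0.
  by rewrite normc0 mul0e.
move=> c F G /[!inE]/= -[hF F1] [hG G1]; split; first exact: holomorphic_lincomb.
have hcF : holomorphic (c *: F).
  by have := @holomorphic_lincomb R c F 0 hF (@holomorphic0 R); rewrite addr0.
apply: le_lt_trans (hspace_normD hcF hG) _.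
rewrite lte_add_pinfty// hspace_normZ// lte_mul_pinfty// lee_fin normc_ge0//.
Qed.

HB.instance Definition _ :=
  GRing.isSubmodClosed.Build _ _ in_hspace in_hspace_submod_closed.
HB.instance Definition _ := [SubChoice_isSubLmodule of hspace by <:].

(* The norm of a normed module over R[i] takes values in R[i]. *)
Definition hnorm (F : hspace) : R[i] := (fine (hspace_norm F))%:C.

Let hnormE (F : hspace) : hspace_norm F = (fine (hspace_norm F))%:E.
Proof.
have := hspaceP F; rewrite inE => -[_ Foo].
by rewrite fineK// ge0_fin_numE// hspace_norm_ge0.
Qed.

Let hol (F : hspace) : holomorphic F.
Proof. by have := hspaceP F; rewrite inE => -[]. Qed.

Lemma hnormD (F G : hspace) : hnorm (F + G) <= hnorm F + hnorm G.
Proof.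
rewrite /hnorm -rmorphD lecR -lee_fin EFinD -!hnormE.
exact: hspace_normD.
Qed.

Lemma hnormZ (c : R[i]) (F : hspace) : hnorm (c *: F) = `|c| * hnorm F.
Proof.
rewrite /hnorm normc_norm -rmorphM; congr (_%:C).
by apply/EFin_inj; rewrite EFinM -!hnormE; exact: hspace_normZ.
Qed.

Lemma hnorm_eq0 (F : hspace) : hnorm F = 0 -> F = 0.
Proof.
case=> F0; apply/val_inj/hspace_norm_eq0 => //.
by rewrite hnormE F0.
Qed.

HB.instance Definition _ :=
  Lmodule_isNormed.Build R[i] hspace hnormD hnormZ hnorm_eq0.

End HSpace.

Section bounded_operators.
Variables (K : numFieldType) (V : normedModType K).

Definition invertible_op (T : V -> V) :=
  exists S : {linear V -> V}, [/\ continuous S, cancel T S & cancel S T].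

Definition finite_dim (A : set V) :=
  exists n (e : 'I_n -> V),
    forall v, A v -> exists c : 'I_n -> K, v = \sum_(i < n) c i *: e i.

Definition finite_codim (A : set V) :=
  exists n (e : 'I_n -> V), forall v,
    exists2 a, A a & exists c : 'I_n -> K, v = a + \sum_(i < n) c i *: e i.

Definition fredholm (T : V -> V) :=
  [/\ finite_dim [set v | T v = 0], closed (range T) & finite_codim (range T)].

(* spectrum and ess_spectrum are meant for a continuous T. *)
Definition spectrum (T : {linear V -> V}) : set K :=
  [set lambda | ~ invertible_op (fun v => T v - lambda *: v)].

Definition ess_spectrum (T : {linear V -> V}) : set K :=
  [set lambda | ~ fredholm (fun v => T v - lambda *: v)].

End bounded_operators.

(* Main.v *)
(** Let C be the translation F |-> F (. + w0) and b = Im w0.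

    If |la| > 1 then C - la is inverted by a Neumann series, because the powers of C
    are uniformly bounded; when w0 is real this applies to C^-1 as well. If b > 0 and
    la <> 0 is off the spiral, then la = e^(- mu w0) for some mu such that the function
    e^(mu s) / (e^(2 i pi s / w0) - 1) decays on horizontal lines, and averaging the
    translates of F against it yields an operator S with (C - la) S = c C, c <> 0, by
    the residue theorem on a strip of height b.

    Conversely e^(i t w) (eta w + i)^-N, for eta -> 0, is a sequence of approximate
    eigenvectors for the value e^(i w0 t), and e^(i t w) (w + i)^-N, for t -> +oo, is
    one for the value 0 if b > 0. As C - la is injective in these cases, its range
    cannot be closed: by the open mapping theorem it would be bounded below. *)
Require Import Defs.
From HB Require Import structures.
From mathcomp Require Import all_boot all_order all_algebra.
From mathcomp Require Import complex.
From mathcomp Require Import all_classical all_reals all_analysis.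
From mathcomp Require Import measurable_realfun ring lra.
Set Implicit Arguments.
Unset Strict Implicit.
Unset Printing Implicit Defensive.
Import Order.TTheory GRing.Theory Num.Theory.
Import numFieldNormedType.Exports.
Import Normc.
Local Open Scope classical_set_scope.
Local Open Scope ring_scope.
Local Open Scope complex_scope.

(** * Complex derivatives and the exponential *)

(** Both kinds of spaces are handled through [line F y], the integral of [|F|^2] at height [y]: its
    supremum, or its integral against [y^alpha], is the squared norm, and operators are bounded by
    comparing such functions. The obstacle is a Bergman weight with [alpha < 0]: it grows towards
    the boundary, so a shift upwards cannot be bounded by comparing weights. A bound uniform in the
    shift comes from a mean value inequality for [|F|^2], which also gives point evaluations and
    hence completeness. In the kernel of [S], the exponent [mu] is determined up to multiples of
    [2 i pi / w0]. Its real part can be brought strictly between 0 and that of [2 i pi / w0], which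
    is what decay at both ends means, unless [la = e^(i w0 t)] for a real [t]. This is where the
    spiral enters; the values with [t < 0] have modulus above 1 and belong to the Neumann series.
    The identity [(C - la) S = c C] gives a right inverse because [la G = C G - (C - la) G], and
    injectivity because [S] commutes with [C]. *)

Section modulus.
Variable R : realType.
Implicit Types z w h : R[i].

Lemma ler_normcD z w : normc (z + w) <= normc z + normc w.
Proof. exact: (@le_normcD R). Qed.

Lemma normc_opp z : normc (- z) = normc z.
Proof. exact: (@normcN R). Qed.

Lemma ler_normcD4 z1 z2 z3 z4 : normc (z1 + z2 + z3 + z4) <=
  normc z1 + normc z2 + normc z3 + normc z4.
Proof.
apply: le_trans (ler_normcD _ _) _; rewrite lerD2r.
by apply: le_trans (ler_normcD _ _) _; rewrite lerD2r ler_normcD.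
Qed.

Lemma ler_normcB z w : normc (z - w) <= normc z + normc w.
Proof. by rewrite -(normc_opp w) ler_normcD. Qed.

Lemma ler_normcB2 z w : normc z - normc w <= normc (z + w).
Proof. by rewrite lerBlDr -{1}(addrK w z) ler_normcB. Qed.

Lemma normc_eq0 z : (normc z == 0) = (z == 0).
Proof. by apply/eqP/eqP => [/eq0_normc|->]; rewrite ?normc0. Qed.

Lemma normc_gt0 z : (0 < normc z) = (z != 0).
Proof. by rewrite lt_neqAle normc_ge0 andbT eq_sym normc_eq0. Qed.

Lemma normc_real (x : R) : normc x%:C = `|x|.
Proof. by rewrite /= expr0n/= addr0 sqrtr_sqr. Qed.

Lemma normc_sqr z : normc z ^+ 2 = complex.Re z ^+ 2 + complex.Im z ^+ 2.
Proof. by case: z => a b /=; rewrite sqr_sqrtr// addr_ge0// sqr_ge0. Qed.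

Lemma ler_Re_normc z : `|complex.Re z| <= normc z.
Proof.
rewrite -(@ler_pXn2r _ 2) ?nnegrE ?normc_ge0// normc_sqr real_normK ?num_real//.
by rewrite lerDl sqr_ge0.
Qed.

Lemma ler_Im_normc z : `|complex.Im z| <= normc z.
Proof.
rewrite -(@ler_pXn2r _ 2) ?nnegrE ?normc_ge0// normc_sqr real_normK ?num_real//.
by rewrite lerDr sqr_ge0.
Qed.

Lemma ler_normc_ReIm z : normc z <= `|complex.Re z| + `|complex.Im z|.
Proof. by case: z => a b; exact: normc_le. Qed.

Lemma normcX z n : normc (z ^+ n) = normc z ^+ n.
Proof. by elim: n => [|n IH]; rewrite ?expr0 ?normc1// !exprS normcM IH. Qed.

Lemma ReD z w : complex.Re (z + w) = complex.Re z + complex.Re w.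
Proof. by case: z w => ? ? []. Qed.
Lemma ImD z w : complex.Im (z + w) = complex.Im z + complex.Im w.
Proof. by case: z w => ? ? []. Qed.
Lemma ReN z : complex.Re (- z) = - complex.Re z.
Proof. by case: z. Qed.
Lemma ImN z : complex.Im (- z) = - complex.Im z.
Proof. by case: z. Qed.
Lemma ReM z w : complex.Re (z * w) =
  complex.Re z * complex.Re w - complex.Im z * complex.Im w.
Proof. by case: z w => ? ? []. Qed.
Lemma ImM z w : complex.Im (z * w) =
  complex.Re z * complex.Im w + complex.Im z * complex.Re w.
Proof. by case: z w => ? ? []. Qed.
End modulus.
Definition ReIm := (ReD, ImD, ReN, ImN, ReM, ImM).

Section complex_derivative.
Variable R : realType.
Implicit Types (f g : R[i] -> R[i]) (z l m h : R[i]).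

(* Complex derivatives are stated for total functions R[i] -> R[i] and the real
   modulus normc, which keeps the topology of R[i]^o out of the way. *)
Definition cder f z l := forall e : R, 0 < e -> exists2 d : R, 0 < d &
  forall h, normc h < d -> normc (f (z + h) - f z - l * h) <= e * normc h.

Definition cderivable f z := exists l, cder f z l.

Lemma cder_cont f z l : cder f z l -> forall e : R, 0 < e ->
  exists2 d : R, 0 < d & forall h, normc h < d -> normc (f (z + h) - f z) < e.
Proof.
move=> fl e e0; have [d d0 dP] := fl _ ltr01.
have L : 0 < 1 + normc l + 1 by have := normc_ge0 l; lra.
exists (Num.min d (e / (1 + normc l + 1))); first by rewrite lt_min d0 divr_gt0.
move=> h; rewrite lt_min => /andP[hd]; rewrite ltr_pdivlMr// => he.
have -> : f (z + h) - f z = (f (z + h) - f z - l * h) + l * h by ring.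
apply: le_lt_trans (ler_normcD _ _) _; rewrite normcM.
have := dP h hd; have := normc_ge0 h; nra.
Qed.

Lemma cder_ext f g z l : (exists2 d : R, 0 < d & forall h, normc h < d ->
  f (z + h) = g (z + h)) -> cder f z l -> cder g z l.
Proof.
move=> [d d0 fg] fl e /fl[d' d'0 P].
exists (Num.min d d'); first by rewrite lt_min d0.
move=> h; rewrite lt_min => /andP[hd hd'].
by rewrite -fg// -{2}(addr0 z) -fg ?normc0// addr0 P.
Qed.

Lemma cder_cst c z : cder (fun=> c) z 0.
Proof.
move=> e e0; exists 1 => // h _; rewrite (_ : _ - _ - _ = 0); last ring.
by rewrite normc0 mulr_ge0 ?normc_ge0 ?ltW.
Qed.

Lemma cder_id z : cder id z 1.
Proof.
move=> e e0; exists 1 => // h _; rewrite (_ : _ - _ - _ = 0); last by rewrite /id; ring.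
by rewrite normc0 mulr_ge0 ?normc_ge0 ?ltW.
Qed.

Lemma cderD f g z l m : cder f z l -> cder g z m ->
  cder (fun x => f x + g x) z (l + m).
Proof.
move=> fl gm e e0; have e2 : 0 < e / 2 by lra.
have [d d0 P] := fl _ e2; have [d' d'0 P'] := gm _ e2.
exists (Num.min d d'); first by rewrite lt_min d0.
move=> h; rewrite lt_min => /andP[/P {}P /P' {}P'].
rewrite (_ : _ - _ - _ = (f (z + h) - f z - l * h) + (g (z + h) - g z - m * h)); last ring.
by apply: le_trans (ler_normcD _ _) _; lra.
Qed.

Lemma cderM f g z l m : cder f z l -> cder g z m ->
  cder (fun x => f x * g x) z (l * g z + f z * m).
Proof.
move=> fl gm e e0.
(* [K] adds up the coefficients of [e' * normc h] in the bounds of the four terms into which the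
   remainder is split below; [e' <= 1] absorbs the product of two small terms. *)
pose K := normc (f z) + normc (g z) + normc l + 1.
have [[nf ng] nl] := (normc_ge0 (f z), normc_ge0 (g z), normc_ge0 l).
have K1 : 1 <= K by rewrite /K; lra.
pose e' := Num.min 1 (e / K).
have e'0 : 0 < e' by rewrite lt_min ltr01/= divr_gt0//; lra.
have e'1 : e' <= 1 by rewrite ge_min lexx.
have e'K : e' * K <= e.
  by rewrite -ler_pdivlMr ?ge_min ?lexx ?orbT//; lra.
have [d d0 P] := fl _ e'0; have [d' d'0 P'] := gm _ e'0.
have [d2 d20 P2] := cder_cont gm e'0.
exists (Num.min d (Num.min d' d2)); first by rewrite !lt_min d0 d'0.
move=> h; rewrite !lt_min => /andP[/P {}P /andP[/P' {}P' /P2 {}P2]].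
rewrite (_ : _ - _ - _ = (f (z + h) - f z - l * h) * g z +
  (f (z + h) - f z - l * h) * (g (z + h) - g z) +
  f z * (g (z + h) - g z - m * h) + l * h * (g (z + h) - g z)); last ring.
have h0 := normc_ge0 h.
have n1 := normc_ge0 (f (z + h) - f z - l * h).
have n2 := normc_ge0 (g (z + h) - g z).
have n3 := normc_ge0 (g (z + h) - g z - m * h).
apply: le_trans (ler_normcD4 _ _ _ _) _; rewrite !normcM.
apply: (@le_trans _ _ (e' * K * normc h)); last by rewrite ler_wpM2r.
rewrite /K (_ : _ * _ * _ = e' * normc h * normc (g z) + e' * normc h * 1 +
  normc (f z) * (e' * normc h) + normc l * normc h * e'); last ring.
apply: lerD; last by rewrite ler_wpM2l ?mulr_ge0 ?(ltW P2).
apply: lerD; last by rewrite ler_wpM2l.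
by apply: lerD; [exact: ler_wpM2r|apply: ler_pM => //; lra].
Qed.

Lemma cderZ f z l c : cder f z l -> cder (fun x => c * f x) z (c * l).
Proof. by move=> /(cderM (cder_cst c z)); rewrite mul0r add0r. Qed.

Lemma cderN f z l : cder f z l -> cder (fun x => - f x) z (- l).
Proof.
move=> /(cderZ (-1)); rewrite mulN1r; apply: cder_ext.
by exists 1 => // h _; rewrite mulN1r.
Qed.

Lemma cderB f g z l m : cder f z l -> cder g z m ->
  cder (fun x => f x - g x) z (l - m).
Proof. by move=> fl /cderN; exact: cderD. Qed.

Lemma cder_comp f g z l m : cder f z l -> cder g (f z) m ->
  cder (fun x => g (f x)) z (m * l).
Proof.
move=> fl gm e e0; have [nl nm] := (normc_ge0 l, normc_ge0 m).
pose K := normc l + normc m + 1.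
have K1 : 1 <= K by rewrite /K; lra.
pose e' := Num.min 1 (e / K).
have e'0 : 0 < e' by rewrite lt_min ltr01/= divr_gt0//; lra.
have e'1 : e' <= 1 by rewrite ge_min lexx.
have e'K : e' * K <= e.
  by rewrite -ler_pdivlMr ?ge_min ?lexx ?orbT//; lra.
have [d d0 P] := gm _ e'0; have [d' d'0 P'] := fl _ e'0.
have [d2 d20 P2] := cder_cont fl d0.
exists (Num.min d' d2); first by rewrite !lt_min d'0.
move=> h; rewrite !lt_min => /andP[/P' {}P' /P2 {}P2].
have h0 := normc_ge0 h.
set k := f (z + h) - f z in P' P2.
have fk : f (z + h) = f z + k by rewrite /k; ring.
rewrite fk (_ : _ - _ - _ = (g (f z + k) - g (f z) - m * k) + m * (k - l * h)); last ring.
have kE : normc k <= (1 + normc l) * normc h.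
  rewrite -(subrK (l * h) k); apply: le_trans (ler_normcD _ _) _.
  by rewrite normcM mulrDl lerD2r mul1r (le_trans P')// ler_piMl.
apply: le_trans (ler_normcD _ _) _; rewrite normcM.
apply: (@le_trans _ _ (e' * K * normc h)); last by rewrite ler_wpM2r.
rewrite (_ : _ * _ * _ = e' * ((1 + normc l) * normc h) + normc m * (e' * normc h)); last by rewrite /K; ring.
apply: lerD; last by rewrite ler_wpM2l.
by apply: (le_trans (P _ P2)); rewrite ler_wpM2l ?(ltW e'0).
Qed.

Lemma cderV_pt z : z != 0 -> cder (fun x => x^-1) z (- (z ^- 2)).
Proof.
move=> z0 e e0; have nz : 0 < normc z by rewrite normc_gt0.
pose N := normc z.
(* The first bound keeps [normc (z + h)] above [N / 2]; with it, the second one makes the remainder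
   [h ^+ 2 / (z ^+ 2 * (z + h))] at most [e * normc h] in modulus. *)
exists (Num.min (N / 2) (e * N ^+ 3 / 2)).
  by rewrite lt_min !divr_gt0// mulr_gt0// exprn_gt0.
move=> h; rewrite lt_min => /andP[h1 h2].
have zh : N / 2 <= normc (z + h).
  by apply: le_trans (ler_normcB2 _ _); rewrite -/N; lra.
have N0 : 0 < N by [].
have zh0 : z + h != 0 by rewrite -normc_gt0; lra.
rewrite (_ : _ - _ - _ = h ^+ 2 / (z ^+ 2 * (z + h))); last first.
  by field; rewrite z0 zh0.
rewrite (normcM (h ^+ 2)) normcV (normcM (z ^+ 2)) (normcX h) (normcX z).
rewrite ler_pdivrMr ?mulr_gt0 ?exprn_gt0//; last lra.
rewrite expr2 mulrAC ler_wpM2r ?normc_ge0//.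
rewrite -/N; apply: le_trans (ltW h2) _.
have -> : e * N ^+ 3 / 2 = e * N ^+ 2 * (N / 2) by field.
by rewrite [leRHS]mulrA ler_wpM2l// mulr_ge0 ?exprn_ge0 ?ltW.
Qed.

Lemma cderV f z l : cder f z l -> f z != 0 ->
  cder (fun x => (f x)^-1) z (- l / f z ^+ 2).
Proof.
move=> fl fz; rewrite (_ : - l / _ = - (f z ^- 2) * l); last by field.
exact: cder_comp fl (cderV_pt fz).
Qed.

Lemma cderX f z l n : cder f z l -> cder (fun x => f x ^+ n) z (l * f z ^+ n.-1 *+ n).
Proof.
move=> fl; elim: n => [|n IH].
  by rewrite mulr0n; apply: cder_ext (cder_cst 1 z); exists 1.
have := cderM fl IH; rewrite (_ : _ + _ = l * f z ^+ n.+1.-1 *+ n.+1).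
  by apply: cder_ext; exists 1 => // h _; rewrite exprS.
case: n {IH} => [|n] /=; first by rewrite mulr0n mulr0 addr0 mulr1n.
by rewrite mulrnAr mulrCA -exprS [RHS]mulrS.
Qed.

Lemma cder_affine a c f z l : cder f (a * z + c) l ->
  cder (fun x => f (a * x + c)) z (l * a).
Proof.
apply: (@cder_comp (fun x => a * x + c)).
have := cderD (cderZ a (cder_id z)) (cder_cst c z).
by rewrite mulr1 addr0.
Qed.

Lemma cder_shift c f z l : cder f (z + c) l -> cder (fun x => f (x + c)) z l.
Proof.
move=> fl; have := @cder_affine 1 c f z l; rewrite mul1r mulr1 => /(_ fl).
by apply: cder_ext; exists 1 => // h _; rewrite mul1r.
Qed.

End complex_derivative.

Section complex_exponential.
Variable R : realType.
Implicit Types z w : R[i].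

Lemma cexpD z w : cexp (z + w) = cexp z * cexp w.
Proof.
rewrite /cexp !ReIm expRD cosD sinD; apply/eqP; rewrite eq_complex !ReIm/=.
by apply/andP; split; apply/eqP; ring.
Qed.

Lemma cexp0 : cexp (0 : R[i]) = 1.
Proof. by rewrite /cexp /= expR0 cos0 sin0 mul1r. Qed.

Lemma normc_cexp z : normc (cexp z) = expR (complex.Re z).
Proof.
rewrite /cexp normcM normc_real gtr0_norm ?expR_gt0//= cos2Dsin2 sqrtr1 mulr1//.
Qed.

Lemma cexp_neq0 z : cexp z != 0.
Proof. by rewrite -normc_gt0 normc_cexp expR_gt0. Qed.

Lemma cexpN z : cexp (- z) = (cexp z)^-1.
Proof.
by apply: (mulfI (cexp_neq0 z)); rewrite -cexpD subrr cexp0 mulfV ?cexp_neq0.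
Qed.

Lemma cexpMn z n : cexp (z *+ n) = cexp z ^+ n.
Proof. by elim: n => [|n IH]; rewrite ?mulr0n ?cexp0// mulrS exprS cexpD IH. Qed.

Let real_diff (f : R -> R) (l : R) : is_derive (0 : R) (1 : R) f l ->
  forall e : R, 0 < e -> exists2 d : R, 0 < d &
  forall h, `|h| < d -> `|f h - f 0 - l * h| <= e * `|h|.
Proof.
move=> [fd <-] e e0; move: (fd); rewrite /derivable => /cvgrPdist_lt.
rewrite -/('D_1 f 0) => /(_ e e0).
rewrite near_withinE => /nbhs_ballP[d /= d0 P].
exists d => // h hd; have [->|h0] := eqVneq h 0.
  by rewrite subrr mulr0 subrr normr0 mulr0.
have := P h; rewrite /ball/= sub0r normrN => /(_ hd h0).
rewrite addr0 [_ *: 1]mulr1 => /ltW.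
have -> : 'D_1 f 0 - h^-1 *: (f h - f 0) = - ((f h - f 0 - 'D_1 f 0 * h) / h).
  by rewrite /GRing.scale/=; field.
by rewrite normrN normrM normfV ler_pdivrMr ?normr_gt0.
Qed.

Lemma cder_cexp z : cder (@cexp R) z (cexp z).
Proof.
move=> e e0; have n0 : 0 < normc (cexp z) by rewrite normc_gt0 cexp_neq0.
(* By [cexpD] only the expansion at 0 matters. It reduces to those of [expR], [cos] and [sin], and
   the error terms [q1] to [q5] add up to at most [7 * e' * N]; the 9 leaves room. Taking
   [normc h < e'] serves the product [a * b]. *)
pose e' := Num.min 1 (e / normc (cexp z) / 9).
have e'0 : 0 < e' by rewrite lt_min ltr01/= !divr_gt0.
have e'1 : e' <= 1 by rewrite ge_min lexx.
have e'K : 9 * e' * normc (cexp z) <= e.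
  by rewrite -ler_pdivlMr// mulrC -ler_pdivlMr// ge_min lexx orbT.
clearbody e'.
have [d1 d10 P1] := real_diff (is_derive_expR 0) e'0.
have [d2 d20 P2] := real_diff (is_derive_cos 0) e'0.
have [d3 d30 P3] := real_diff (is_derive_sin 0) e'0.
exists (Num.min e' (Num.min d1 (Num.min d2 d3))); first by rewrite !lt_min e'0 d10 d20 d30.
move=> h; rewrite !lt_min => /andP[he /andP[h1 /andP[h2 h3]]].
rewrite cexpD (_ : _ - _ - _ = cexp z * (cexp h - 1 - h)); last ring.
rewrite normcM.
apply: (@le_trans _ _ (normc (cexp z) * (9 * e' * normc h))); last first.
  by rewrite mulrA ler_wpM2r ?normc_ge0// mulrC.
rewrite ler_wpM2l ?normc_ge0//.
have ra := ler_Re_normc h; have ia := ler_Im_normc h.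
case: h he h1 h2 h3 ra ia => a b; set N := normc _ => he h1 h2 h3 ra ia.
have {}ra : `|a| <= N := ra; have {}ia : `|b| <= N := ia.
have N0 : 0 <= N by exact: normc_ge0.
have {}P1 := P1 a (le_lt_trans ra h1); have {}P2 := P2 b (le_lt_trans ia h2).
have {}P3 := P3 b (le_lt_trans ia h3).
move: P1 P2 P3; rewrite expR0 cos0 sin0 mul1r oppr0 mul0r !subr0 mul1r addr0 => P1 P2 P3.
apply: le_trans (ler_normc_ReIm _) _; rewrite /cexp !ReIm /=.
rewrite (_ : expR a * cos b - _ - 1 - a = (expR a - 1 - a) * cos b + (1 + a) * (cos b - 1)); last ring.
rewrite (_ : expR a * sin b + _ - _ - b = (expR a - 1 - a) * sin b + (1 + a) * (sin b - b) + a * b); last ring.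
have c1 : `|cos b| <= 1 by rewrite ler_norml cos_geN1 cos_le1.
have s1 : `|sin b| <= 1 by rewrite ler_norml sin_geN1 sin_le1.
have a1 : `|1 + a| <= 2.
  by rewrite (le_trans (ler_normD _ _))// normr1; lra.
have aN : e' * `|a| <= e' * N by rewrite ler_wpM2l ?(ltW e'0).
have bN : e' * `|b| <= e' * N by rewrite ler_wpM2l ?(ltW e'0).
have q1 : `|(expR a - 1 - a) * cos b| <= e' * N.
  by rewrite normrM -[leRHS]mulr1 ler_pM//; lra.
have q2 : `|(1 + a) * (cos b - 1)| <= 2 * (e' * N).
  by rewrite normrM ler_pM//; lra.
have q3 : `|(expR a - 1 - a) * sin b| <= e' * N.
  by rewrite normrM -[leRHS]mulr1 ler_pM//; lra.
have q4 : `|(1 + a) * (sin b - b)| <= 2 * (e' * N).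
  by rewrite normrM ler_pM//; lra.
have q5 : `|a * b| <= e' * N by rewrite normrM ler_pM//; lra.
apply: le_trans (lerD (ler_normD _ _) (le_trans (ler_normD _ _) (lerD (ler_normD _ _) (lexx _)))) _.
have q6 : 0 <= e' * N by rewrite mulr_ge0 ?(ltW e'0).
lra.
Qed.

Lemma cder_cexp_lin a z : cder (fun x : R[i] => cexp (a * x)) z (a * cexp (a * z)).
Proof.
rewrite mulrC; apply: (cder_comp _ (cder_cexp _)).
by have := cderZ a (cder_id z); rewrite mulr1.
Qed.

End complex_exponential.

Section derivable_cder.
Variable R : realType.

Lemma cder_derivable (f : R[i]^o -> R[i]^o) z :
  cderivable f z <-> derivable f z 1.
Proof.
split=> [[l fl]|fd].
  apply/cvg_ex; exists l; apply/cvgrPdist_lt => e e0.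
  have eE : e = (complex.Re e)%:C by rewrite RRe_real// gtr0_real.
  move: e0; rewrite eE ltcR => e0.
  have e2 : 0 < complex.Re e / 2 by rewrite divr_gt0.
  have [d d0 P] := fl _ e2.
  rewrite near_withinE; apply/nbhs_ballP; exists d%:C; first by rewrite /= ltcR.
  move=> h /=; rewrite -ball_normE /= sub0r normrN normc_norm ltcR => hd h0.
  rewrite normc_norm ltcR (_ : h *: 1 = h); last by rewrite /GRing.scale/= mulr1.
  rewrite [h + z]addrC.
  have -> : l - h^-1 *: (f (z + h) - f z) = - ((f (z + h) - f z - l * h) / h).
    by rewrite /GRing.scale/=; field.
  rewrite normc_opp normcM normcV; apply: (@le_lt_trans _ _ (complex.Re e / 2)); last lra.
  by rewrite ler_pdivrMr ?normc_gt0// P.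
exists ('D_1 f z) => e e0; move: (fd); rewrite /derivable => /cvgrPdist_lt.
have e0C : 0 < e%:C by rewrite ltcR.
move=> /(_ _ e0C); rewrite near_withinE => /nbhs_ballP[d /= d0].
have dE : d = (complex.Re d)%:C by rewrite RRe_real// gtr0_real.
move: d0; rewrite dE ltcR => d0 P.
exists (complex.Re d) => // h hd; have [->|h0] := eqVneq h 0.
  by rewrite addr0 subrr mulr0 subrr normc0 mulr0.
have := P h; rewrite -ball_normE /= sub0r normrN normc_norm ltcR => /(_ hd h0).
rewrite normc_norm ltcR (_ : h *: 1 = h); last by rewrite /GRing.scale/= mulr1.
rewrite [h + z]addrC => /ltW.
rewrite -/('D_1 f z).
have -> : 'D_1 f z - h^-1 *: (f (z + h) - f z) = - ((f (z + h) - f z - 'D_1 f z * h) / h).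
  by rewrite /GRing.scale/=; field.
by rewrite normc_opp normcM normcV ler_pdivrMr ?normc_gt0.
Qed.

End derivable_cder.

(** * Translation of the Lebesgue integral, and complex-valued integrals *)

Section translation_invariance.
Variable R : realType.
Local Notation leb := (@lebesgue_measure R).
Local Notation mR := (measurableTypeR R).

Let measurable_shift (a : R) : measurable_fun setT ((+%R a) : mR -> mR).
Proof. by apply: measurable_funD. Qed.

(** Both sides are measures in [A] that agree on bounded intervals, which characterizes the Lebesgue
    measure. *)
Lemma lebesgue_pushforward_shift (a : R) (A : set mR) : measurable A ->
  leb A = pushforward leb (+%R a) A.
Proof.
move=> mA.
pose m : {measure set mR -> \bar R} :=
  measure_function_pushforward__canonical__measure_function_Measure leb (measurable_shift a).
apply: (@lebesgue_measure_unique R m) => // _ [[u v] _ <-].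
transitivity (leb [set` `](u - a), (v - a)]]); last first.
  congr (leb _).
  by apply/seteqP; split=> x /=; rewrite !in_itv/= => /andP[? ?]; apply/andP; split; lra.
rewrite !lebesgue_measure_itv/= !lte_fin ltrD2r; case: ifP => // _.
by rewrite -!EFinB; congr EFin; ring.
Qed.

Lemma ge0_integral_shift (a : R) (D : set mR) (f : R -> \bar R) :
  measurable D -> measurable_fun D f -> (forall x, D x -> 0 <= f x)%E ->
  (\int[leb]_(x in +%R a @^-1` D) f (a + x)%R = \int[leb]_(x in D) f x)%E.
Proof.
move=> mD mf f0.
rewrite -(ge0_integral_pushforward (measurable_shift a) leb mD mf); last first.
  by move=> x; rewrite inE; exact: f0.
apply: eq_measure_integral => A mA _; exact/esym/lebesgue_pushforward_shift.
Qed.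

Lemma integral_shift (a : R) (D : set mR) (f : R -> \bar R) :
  measurable D -> measurable_fun D f ->
  (\int[leb]_(x in +%R a @^-1` D) f (a + x)%R = \int[leb]_(x in D) f x)%E.
Proof.
move=> mD mf; rewrite integralE [RHS]integralE.
congr (_ - _)%E.
  have := @ge0_integral_shift a D (f^\+)%E mD (measurable_funepos mf) (fun x _ => funepos_ge0 f x).
  by move=> <-; apply: eq_integral => x _; rewrite !funeposE.
have := @ge0_integral_shift a D (f^\-)%E mD (measurable_funeneg mf) (fun x _ => funeneg_ge0 f x).
by move=> <-; apply: eq_integral => x _; rewrite !funenegE.
Qed.

Lemma integrable_shift (a : R) (D : set mR) (f : R -> \bar R) :
  measurable D -> leb.-integrable D f ->
  leb.-integrable (+%R a @^-1` D) (fun x => f (a + x)%R).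
Proof.
move=> mD /integrableP[mf foo]; apply/integrableP; split.
  apply: (measurable_comp (F := D)) => //.
    by move=> _ [x /= Dx <-].
  exact: measurable_funTS.
have := @ge0_integral_shift a D (fun x => `|f x|%E) mD.
move=> ->//; exact: measurableT_comp.
Qed.

End translation_invariance.

Section complex_integral.
Variable R : realType.
Local Notation leb := (@lebesgue_measure R).
Local Notation C := R[i].
Local Notation mR := (measurableTypeR R).
Implicit Types (D : set mR) (g : R -> C).

Definition cintegrable D g :=
  leb.-integrable D (fun x => (complex.Re (g x))%:E) /\
  leb.-integrable D (fun x => (complex.Im (g x))%:E).

Definition cint D g : C :=
  (\int[leb]_(x in D) complex.Re (g x)) +i* (\int[leb]_(x in D) complex.Im (g x)).

Lemma eq_cint D g1 g2 : (forall x, D x -> g1 x = g2 x) -> cint D g1 = cint D g2.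
Proof.
by move=> g12; congr (_ +i* _); apply: eq_Rintegral => x; rewrite inE => /g12 ->.
Qed.

Lemma eq_cintegrable D g1 g2 : measurable D -> (forall x, D x -> g1 x = g2 x) ->
  cintegrable D g1 -> cintegrable D g2.
Proof.
move=> mD g12 [h1 h2]; split; [move: h1|move: h2];
  by apply: eq_integrable => // x; rewrite inE => /g12 ->.
Qed.

Lemma cintegrableD D g1 g2 : measurable D -> cintegrable D g1 -> cintegrable D g2 ->
  cintegrable D (fun x => g1 x + g2 x).
Proof.
move=> mD [h1 h1'] [h2 h2']; split.
  by have := integrableD mD h1 h2; apply: eq_integrable => // x _; rewrite ReD.
by have := integrableD mD h1' h2'; apply: eq_integrable => // x _; rewrite ImD.
Qed.

Lemma cintD D g1 g2 : measurable D -> cintegrable D g1 -> cintegrable D g2 ->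
  cint D (fun x => g1 x + g2 x) = cint D g1 + cint D g2.
Proof.
move=> mD [h1 h1'] [h2 h2']; apply/eqP; rewrite eq_complex !ReIm /=.
rewrite -!RintegralD//; apply/andP; split; apply/eqP; apply: eq_Rintegral => x _;
  by rewrite !ReIm.
Qed.

Lemma cintegrableZ D c g : measurable D -> cintegrable D g ->
  cintegrable D (fun x => c * g x).
Proof.
move=> mD [h1 h2]; split.
  have := integrableB mD (integrableZl mD (complex.Re c) h1) (integrableZl mD (complex.Im c) h2).
  by apply: eq_integrable => // x _; rewrite !ReIm.
have := integrableD mD (integrableZl mD (complex.Re c) h2) (integrableZl mD (complex.Im c) h1).
by apply: eq_integrable => // x _; rewrite !ReIm.
Qed.

Lemma cintZ D c g : measurable D -> cintegrable D g ->
  cint D (fun x => c * g x) = c * cint D g.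
Proof.
move=> mD [h1 h2]; apply/eqP; rewrite eq_complex !ReIm /=.
have i1 a : leb.-integrable D (EFin \o (fun x => a * complex.Re (g x))).
  by have := integrableZl mD a h1; apply: eq_integrable.
have i2 a : leb.-integrable D (EFin \o (fun x => a * complex.Im (g x))).
  by have := integrableZl mD a h2; apply: eq_integrable.
rewrite -!RintegralZl// -RintegralB// -RintegralD//.
apply/andP; split; apply/eqP; apply: eq_Rintegral => x _; by rewrite !ReIm.
Qed.

Lemma cintegrableN D g : measurable D -> cintegrable D g ->
  cintegrable D (fun x => - g x).
Proof.
move=> mD /(cintegrableZ (-1) mD); apply: eq_cintegrable => // x _.
by rewrite mulN1r.
Qed.

Lemma cintN D g : measurable D -> cintegrable D g ->
  cint D (fun x => - g x) = - cint D g.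
Proof.
by move=> mD ig; rewrite -mulN1r -cintZ//; apply: eq_cint => x _; rewrite mulN1r.
Qed.

Lemma cintegrableB D g1 g2 : measurable D -> cintegrable D g1 -> cintegrable D g2 ->
  cintegrable D (fun x => g1 x - g2 x).
Proof. by move=> mD h1 h2; apply: cintegrableD => //; exact: cintegrableN. Qed.

Lemma cintB D g1 g2 : measurable D -> cintegrable D g1 -> cintegrable D g2 ->
  cint D (fun x => g1 x - g2 x) = cint D g1 - cint D g2.
Proof. by move=> mD h1 h2; rewrite cintD ?cintN//; exact: cintegrableN. Qed.

(** The factor 2 comes from estimating the real and imaginary parts separately; the numerical
    constants of the Cauchy estimates inherit it. *)
Lemma cint_le D g (B : R -> R) : measurable D -> cintegrable D g ->
  leb.-integrable D (EFin \o B) -> (forall x, D x -> normc (g x) <= B x) ->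
  normc (cint D g) <= 2 * \int[leb]_(x in D) B x.
Proof.
move=> mD [h1 h2] iB gB; apply: le_trans (ler_normc_ReIm _) _ => /=.
rewrite mulrDl mul1r; apply: lerD.
  apply: (le_trans (le_normr_Rintegral mD h1)).
  apply: le_Rintegral => //; first exact: integrable_norm h1.
  by move=> x Dx; rewrite (le_trans (ler_Re_normc _))// gB.
apply: (le_trans (le_normr_Rintegral mD h2)).
apply: le_Rintegral => //; first exact: integrable_norm h2.
by move=> x Dx; rewrite (le_trans (ler_Im_normc _))// gB.
Qed.

Lemma cintegrable_le D g (B : R -> R) : measurable D ->
  measurable_fun D (fun x => complex.Re (g x)) ->
  measurable_fun D (fun x => complex.Im (g x)) ->
  leb.-integrable D (EFin \o B) -> (forall x, D x -> normc (g x) <= B x) ->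
  cintegrable D g.
Proof.
move=> mD m1 m2 iB gB; split.
  apply: (le_integrable mD _ _ iB); first exact/measurable_EFinP.
  move=> x Dx; rewrite lee_fin (le_trans (ler_Re_normc _))//.
  by rewrite (le_trans (gB _ Dx))// ler_norm.
apply: (le_integrable mD _ _ iB); first exact/measurable_EFinP.
move=> x Dx; rewrite lee_fin (le_trans (ler_Im_normc _))//.
by rewrite (le_trans (gB _ Dx))// ler_norm.
Qed.

Definition rcont g x := forall e : R, 0 < e -> exists2 d : R, 0 < d &
  forall y, `|y - x| < d -> normc (g y - g x) < e.

Lemma rcont_Re g x : rcont g x -> {for x, continuous (fun t => complex.Re (g t))}.
Proof.
move=> gx; apply/cvgrPdist_lt => e e0; have [d d0 P] := gx e e0.
apply/nbhs_ballP; exists d => // y; rewrite /ball/= => xy.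
rewrite -ReN -ReD; apply: le_lt_trans (ler_Re_normc _) _.
by rewrite -normc_opp opprB; apply: P; rewrite distrC.
Qed.

Lemma rcont_Im g x : rcont g x -> {for x, continuous (fun t => complex.Im (g t))}.
Proof.
move=> gx; apply/cvgrPdist_lt => e e0; have [d d0 P] := gx e e0.
apply/nbhs_ballP; exists d => // y; rewrite /ball/= => xy.
rewrite -ImN -ImD; apply: le_lt_trans (ler_Im_normc _) _.
by rewrite -normc_opp opprB; apply: P; rewrite distrC.
Qed.

Lemma cintegrable_itv a b g : (forall x, a <= x <= b -> rcont g x) ->
  cintegrable `[a, b] g.
Proof.
move=> gc; split; apply: continuous_compact_integrable;
  do ?[exact: segment_compact].
  apply: continuous_in_subspaceT => x; rewrite inE/= in_itv/= => xab.
  exact: rcont_Re (gc _ xab).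
apply: continuous_in_subspaceT => x; rewrite inE/= in_itv/= => xab.
exact: rcont_Im (gc _ xab).
Qed.

Lemma measurable_rcont_Re g : (forall x, rcont g x) ->
  measurable_fun setT (fun x => complex.Re (g x)).
Proof.
by move=> gc; apply: continuous_measurable_fun => x; exact: rcont_Re.
Qed.

Lemma measurable_rcont_Im g : (forall x, rcont g x) ->
  measurable_fun setT (fun x => complex.Im (g x)).
Proof.
by move=> gc; apply: continuous_measurable_fun => x; exact: rcont_Im.
Qed.

Lemma cint_itv_split a b c g : a <= b -> b <= c ->
  (forall x, a <= x <= c -> rcont g x) ->
  cint `[a, c] g = cint `[a, b] g + cint `[b, c] g.
Proof.
move=> ab bc /cintegrable_itv[h1 h2].
have E (f : mR -> R) : leb.-integrable `[a, c] (EFin \o f) ->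
  \int[leb]_(x in `[a, c]) f x =
  \int[leb]_(x in `[a, b]) f x + \int[leb]_(x in `[b, c]) f x.
  move=> fi.
  have := @Rintegral_itvB R f (BLeft a) (BRight c) b fi.
  rewrite !bnd_simp => /(_ ab bc) h.
  have -> : \int[leb]_(x in `[b, c]) f x = \int[leb]_(x in `]b, c]) f x.
    apply/esym/Rintegral_itv_obnd_cbnd.
    apply: integrableS fi => //; apply: subset_itv; rewrite bnd_simp//.
  by rewrite -h addrC subrK.
by apply/eqP; rewrite eq_complex !ReIm /= !E ?eqxx.
Qed.

Lemma cint_itv_shift (p a b : R) g : (forall x, a + p <= x <= b + p -> rcont g x) ->
  cint `[a, b] (fun x => g (p + x)) = cint `[a + p, b + p] g.
Proof.
move=> gc.
have E : +%R p @^-1` [set` `[a + p, b + p]] = [set` `[a, b]].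
  by apply/seteqP; split=> x /=; rewrite !in_itv/= => /andP[? ?]; apply/andP; split; lra.
have [h1 h2] := cintegrable_itv gc.
rewrite /cint -E /Rintegral; congr (fine _ +i* fine _).
  by rewrite -(integral_shift p (f := fun x => (complex.Re (g x))%:E))//; exact: measurable_int h1.
by rewrite -(integral_shift p (f := fun x => (complex.Im (g x))%:E))//; exact: measurable_int h2.
Qed.

Lemma cint_itv_le a b g (B : R) : a <= b -> (forall x, a <= x <= b -> rcont g x) ->
  (forall x, a <= x <= b -> normc (g x) <= B) ->
  normc (cint `[a, b] g) <= 2 * (b - a) * B.
Proof.
move=> ab gc gB.
have := @cint_le `[a, b] g (cst B) (measurable_itv _) (cintegrable_itv gc).
have -> : \int[leb]_(x in `[a, b]) cst B x = B * (b - a).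
  rewrite Rintegral_cst//= lebesgue_measure_itv/= lte_fin.
  by case: ltP => //= ba; congr (_ * _); apply/esym/eqP; rewrite subr_eq0 eq_le ab ba.
rewrite -mulrA [B * _]mulrC; apply.
  apply: continuous_compact_integrable; first exact: segment_compact.
  by apply: continuous_subspaceT => x; exact: cst_continuous.
by move=> x; rewrite /= in_itv/=; exact: gB.
Qed.

End complex_integral.

(** * Cauchy's theorem on rectangles *)

Section rectangle_integral.
Variable R : realType.
Local Notation C := R[i].
Implicit Types (f g : C -> C) (z p r : C) (x y a b c d : R).

Definition ccont f z := forall e : R, 0 < e -> exists2 d : R, 0 < d &
  forall h, normc h < d -> normc (f (z + h) - f z) < e.

Lemma cderivable_ccont f z : cderivable f z -> ccont f z.
Proof. by move=> [l fl]; exact: (cder_cont fl). Qed.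

Lemma ccont_h f x y : ccont f (x +i* y) -> rcont (fun t => f (t +i* y)) x.
Proof.
move=> fc e e0; have [d d0 P] := fc e e0; exists d => // t td.
have -> : t +i* y = (x +i* y) + (t - x)%:C.
  by apply/eqP; rewrite eq_complex !ReIm/=; apply/andP; split; apply/eqP; ring.
by apply: P; rewrite normc_real.
Qed.

Lemma ccont_v f x y : ccont f (x +i* y) -> rcont (fun t => f (x +i* t)) y.
Proof.
move=> fc e e0; have [d d0 P] := fc e e0; exists d => // t td.
have -> : x +i* t = (x +i* y) + 'i * (t - y)%:C.
  by apply/eqP; rewrite eq_complex !ReIm/=; apply/andP; split; apply/eqP; ring.
apply: P; rewrite normcM normc_real /= expr0n/= add0r expr1n sqrtr1 mul1r//.
Qed.

(* the integral of f over the boundary of [a, b] x [c, d], counterclockwise *)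
Definition rint f a b c d : C :=
  cint `[a, b] (fun x => f (x +i* c)) - cint `[a, b] (fun x => f (x +i* d)) +
  'i * (cint `[c, d] (fun y => f (b +i* y)) - cint `[c, d] (fun y => f (a +i* y))).

Definition cont_on f a b c d := forall x y,
  a <= x <= b -> c <= y <= d -> ccont f (x +i* y).

Lemma cont_on_bottom f a b c d : c <= d -> cont_on f a b c d ->
  forall x, a <= x <= b -> rcont (fun t => f (t +i* c)) x.
Proof. by move=> cd fc x xab; apply: ccont_h; apply: fc; rewrite ?lexx. Qed.

Lemma cont_on_top f a b c d : c <= d -> cont_on f a b c d ->
  forall x, a <= x <= b -> rcont (fun t => f (t +i* d)) x.
Proof. by move=> cd fc x xab; apply: ccont_h; apply: fc; rewrite ?lexx ?andbT. Qed.

Lemma cont_on_left f a b c d : a <= b -> cont_on f a b c d ->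
  forall y, c <= y <= d -> rcont (fun t => f (a +i* t)) y.
Proof. by move=> ab fc y ycd; apply: ccont_v; apply: fc; rewrite ?lexx. Qed.

Lemma cont_on_right f a b c d : a <= b -> cont_on f a b c d ->
  forall y, c <= y <= d -> rcont (fun t => f (b +i* t)) y.
Proof. by move=> ab fc y ycd; apply: ccont_v; apply: fc; rewrite ?lexx ?andbT. Qed.

(** Continuity along the four sides only, so that linearity and bounds of [rint] are available for
    functions with a pole inside the rectangle. *)
Definition edge_cont f a b c d := [/\
  forall x, a <= x <= b -> rcont (fun t => f (t +i* c)) x,
  forall x, a <= x <= b -> rcont (fun t => f (t +i* d)) x,
  forall y, c <= y <= d -> rcont (fun t => f (a +i* t)) y &
  forall y, c <= y <= d -> rcont (fun t => f (b +i* t)) y].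

Lemma cont_on_edge f a b c d : a <= b -> c <= d -> cont_on f a b c d ->
  edge_cont f a b c d.
Proof.
by move=> ab cd fc; split;
  [apply: cont_on_bottom fc|apply: cont_on_top fc|apply: cont_on_left fc|apply: cont_on_right fc].
Qed.

Lemma rint_hsplit f a m b c d : a <= m -> m <= b ->
  (forall x, a <= x <= b -> rcont (fun t => f (t +i* c)) x) ->
  (forall x, a <= x <= b -> rcont (fun t => f (t +i* d)) x) ->
  rint f a b c d = rint f a m c d + rint f m b c d.
Proof.
by move=> am mb fc fd; rewrite /rint (cint_itv_split am mb fc) (cint_itv_split am mb fd); ring.
Qed.

Lemma rint_vsplit f a b c m d : c <= m -> m <= d ->
  (forall y, c <= y <= d -> rcont (fun t => f (a +i* t)) y) ->
  (forall y, c <= y <= d -> rcont (fun t => f (b +i* t)) y) ->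
  rint f a b c d = rint f a b c m + rint f a b m d.
Proof.
by move=> cm md fa fb; rewrite /rint (cint_itv_split cm md fa) (cint_itv_split cm md fb); ring.
Qed.

Lemma rintD f g a b c d : edge_cont f a b c d -> edge_cont g a b c d ->
  rint (fun z => f z + g z) a b c d = rint f a b c d + rint g a b c d.
Proof.
move=> [f1 f2 f3 f4] [g1 g2 g3 g4]; rewrite /rint !cintD//; first (by ring);
  by apply: cintegrable_itv.
Qed.

Lemma rintZ k f a b c d : edge_cont f a b c d ->
  rint (fun z => k * f z) a b c d = k * rint f a b c d.
Proof.
move=> [f1 f2 f3 f4]; rewrite /rint !cintZ//; first (by ring);
  by apply: cintegrable_itv.
Qed.

(** Each side contributes twice its length times [B], by [cint_itv_le], and there are two sides of
    each length. *)
Lemma rint_le f a b c d (B : R) : a <= b -> c <= d -> edge_cont f a b c d ->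
  (forall x y, a <= x <= b -> c <= y <= d -> [|| x == a, x == b, y == c | y == d] ->
    normc (f (x +i* y)) <= B) ->
  normc (rint f a b c d) <= 4 * ((b - a) + (d - c)) * B.
Proof.
move=> ab cd [f1 f2 f3 f4] fB; rewrite /rint.
have i1 : normc ('i : C) = 1 by rewrite /= expr0n/= add0r expr1n sqrtr1.
apply: le_trans (ler_normcD _ _) _; rewrite normcM i1 mul1r.
apply: le_trans (lerD (ler_normcB _ _) (ler_normcB _ _)) _.
have B1 : normc (cint `[a, b] (fun x => f (x +i* c))) <= 2 * (b - a) * B.
  by apply: cint_itv_le => // x xab; apply: fB; rewrite ?lexx ?eqxx ?orbT.
have B2 : normc (cint `[a, b] (fun x => f (x +i* d))) <= 2 * (b - a) * B.
  by apply: cint_itv_le => // x xab; apply: fB; rewrite ?lexx ?eqxx ?orbT ?cd.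
have B3 : normc (cint `[c, d] (fun y => f (b +i* y))) <= 2 * (d - c) * B.
  by apply: cint_itv_le => // x xab; apply: fB; rewrite ?lexx ?eqxx ?orbT ?ab.
have B4 : normc (cint `[c, d] (fun y => f (a +i* y))) <= 2 * (d - c) * B.
  by apply: cint_itv_le => // x xab; apply: fB; rewrite ?lexx ?eqxx ?orbT.
nra.
Qed.

Lemma ccont_affine k l z : ccont (fun w => k + l * w) z.
Proof.
apply: cderivable_ccont; exists (0 + l * 1).
by apply: cderD; [exact: cder_cst|exact/cderZ/cder_id].
Qed.

(** The values of an affine function at opposite points of parallel sides differ by a constant. So
    each pair of sides contributes an explicit product, and the two products cancel. *)
Lemma rint_affine k l a b c d : a <= b -> c <= d ->
  rint (fun z => k + l * z) a b c d = 0.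
Proof.
move=> ab cd.
have [f1 f2 f3 f4] : edge_cont (fun z => k + l * z) a b c d.
  by apply: cont_on_edge => // x y _ _; exact: ccont_affine.
have C (u v : R) (w : C) : u <= v -> cint `[u, v] (fun=> w) = (v - u)%:C * w.
  move=> uv; rewrite /cint !Rintegral_cst//= lebesgue_measure_itv/= lte_fin.
  apply/eqP; rewrite eq_complex !ReIm/=.
  have -> : fine (if u < v then (v%:E - u%:E)%E else 0%E) = v - u.
    by case: ltP => // vu; apply/esym/eqP; rewrite subr_eq0 eq_le uv vu.
  by apply/andP; split; apply/eqP; ring.
rewrite /rint -!cintB//; try exact: cintegrable_itv.
rewrite (@eq_cint _ _ _ (fun=> l * ('i * (c - d)%:C))); last first.
  move=> x _; apply/eqP; rewrite eq_complex !ReIm/=.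
  by apply/andP; split; apply/eqP; ring.
rewrite (@eq_cint _ _ (fun y => k + l * (b +i* y) - _) (fun=> l * (b - a)%:C)); last first.
  move=> x _; apply/eqP; rewrite eq_complex !ReIm/=.
  by apply/andP; split; apply/eqP; ring.
by rewrite !C// !rmorphB/=; ring.
Qed.

End rectangle_integral.

Section goursat.
Variable R : realType.
Local Notation C := R[i].
Variables (f : C -> C) (a s c t : R).
Hypotheses (s0 : 0 <= s) (t0 : 0 <= t).
Hypothesis fd : forall x y, a <= x <= a + s -> c <= y <= c + t -> cderivable f (x +i* y).

Let S n := s / 2 ^+ n.
Let T n := t / 2 ^+ n.
Let I n (p : R * R) := rint f p.1 (p.1 + S n) p.2 (p.2 + T n).
Let inside n (p : R * R) := [&& a <= p.1, p.1 + S n <= a + s, c <= p.2 & p.2 + T n <= c + t].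

Let S0 n : 0 <= S n. Proof. by rewrite divr_ge0// exprn_ge0. Qed.
Let T0 n : 0 <= T n. Proof. by rewrite divr_ge0// exprn_ge0. Qed.
Let SS n : S n = 2 * S n.+1.
Proof. by rewrite /S exprS; field; rewrite expf_neq0. Qed.
Let TS n : T n = 2 * T n.+1.
Proof. by rewrite /T exprS; field; rewrite expf_neq0. Qed.

(** The integral over a rectangle is the sum of those over its four quarters, so one quarter keeps
    at least a fourth of the modulus. The hypothesis [inside n p] stands under the existential so
    that [choice] gives a total function. *)
Let step n p : exists q : R * R, inside n p ->
  [/\ inside n.+1 q, p.1 <= q.1 /\ q.1 + S n.+1 <= p.1 + S n,
      p.2 <= q.2 /\ q.2 + T n.+1 <= p.2 + T n &
      normc (I n p) <= 4 * normc (I n.+1 q)].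
Proof.
have contra4 (m u v w z : R) : m <= u + v + w + z -> 4 * u < m -> 4 * v < m ->
    4 * w < m -> 4 * z < m -> False by lra.
have [|np] := boolP (inside n p); last by exists p.
case: p => x y ins0; have {ins0} [ax xa cy yc] : [/\ a <= x, x + S n <= a + s, c <= y & y + T n <= c + t].
  exact: and4P ins0.
have [S1 T1] := (S0 n.+1, T0 n.+1); have [Sn Tn] := (SS n, TS n).
set s1 := S n.+1 in S1 Sn; set t1 := T n.+1 in T1 Tn.
have g1 : x + s1 <= x + S n by rewrite lerD2l Sn; lra.
have g2 : x + s1 + s1 <= x + S n by rewrite -addrA lerD2l Sn; lra.
have g3 : y + t1 <= y + T n by rewrite lerD2l Tn; lra.
have g4 : y + t1 + t1 <= y + T n by rewrite -addrA lerD2l Tn; lra.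
have g5 : x <= x + s1 by rewrite lerDl.
have g6 : y <= y + t1 by rewrite lerDl.
have ins u v : x <= u -> u + s1 <= x + S n -> y <= v -> v + t1 <= y + T n -> inside n.+1 (u, v).
  move=> h1 h2 h3 h4; rewrite /inside/= -/s1 -/t1 (le_trans ax h1) (le_trans h2 xa).
  by rewrite (le_trans cy h3) (le_trans h4 yc).
have fc u v : x <= u <= x + S n -> y <= v <= y + T n -> ccont f (u +i* v).
  move=> /andP[u1 u2] /andP[v1 v2]; apply: cderivable_ccont; apply: fd.
    by rewrite (le_trans ax u1) (le_trans u2 xa).
  by rewrite (le_trans cy v1) (le_trans v2 yc).
have g7 := le_trans g5 g1; have g8 := le_trans g6 g3.
have E : I n (x, y) = (I n.+1 (x, y) + I n.+1 (x + s1, y)) +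
    (I n.+1 (x, y + t1) + I n.+1 (x + s1, y + t1)).
  rewrite /I /= -/s1 -/t1.
  have -> : x + s1 + s1 = x + S n by rewrite Sn; ring.
  have -> : y + t1 + t1 = y + T n by rewrite Tn; ring.
  have hc v u : y <= v <= y + T n -> x <= u <= x + S n -> rcont (fun t => f (t +i* v)) u.
    by move=> vP uP; apply: ccont_h; apply: fc.
  have vc u v : x <= u <= x + S n -> y <= v <= y + T n -> rcont (fun t => f (u +i* t)) v.
    by move=> uP vP; apply: ccont_v; apply: fc.
  rewrite (@rint_vsplit _ f x (x + S n) y (y + t1) (y + T n)) //; try by move=> v; apply: vc; rewrite lexx ?g7.
  by congr (_ + _); apply: rint_hsplit => // u; apply: hc; rewrite ?lexx ?g6 ?g3 ?g8.
have N : normc (I n (x, y)) <= normc (I n.+1 (x, y)) + normc (I n.+1 (x + s1, y)) +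
    normc (I n.+1 (x, y + t1)) + normc (I n.+1 (x + s1, y + t1)).
  by rewrite E addrA; exact: ler_normcD4.
have use u v : x <= u -> u + s1 <= x + S n -> y <= v -> v + t1 <= y + T n ->
    normc (I n (x, y)) <= 4 * normc (I n.+1 (u, v)) -> exists q : R * R, true ->
    [/\ inside n.+1 q, x <= q.1 /\ q.1 + S n.+1 <= x + S n,
      y <= q.2 /\ q.2 + T n.+1 <= y + T n & normc (I n (x, y)) <= 4 * normc (I n.+1 q)].
  by move=> *; exists (u, v) => _; split; [exact: ins|split|split|].
have [h1|h1] := leP (normc (I n (x, y))) (4 * normc (I n.+1 (x, y))); first exact: use h1.
have [h2|h2] := leP (normc (I n (x, y))) (4 * normc (I n.+1 (x + s1, y))); first exact: use h2.
have [h3|h3] := leP (normc (I n (x, y))) (4 * normc (I n.+1 (x, y + t1))); first exact: use h3.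
have [h4|h4] := leP (normc (I n (x, y))) (4 * normc (I n.+1 (x + s1, y + t1))); first exact: use h4.
by case: (contra4 _ _ _ _ _ N h1 h2 h3 h4).
Qed.

Let nested (u l : nat -> R) :
  (forall n, u n <= u n.+1 /\ u n.+1 + l n.+1 <= u n + l n) -> (forall n, 0 <= l n) ->
  exists z, forall n, u n <= z <= u n + l n.
Proof.
move=> h l0.
have mono n k : u n <= u (n + k)%N /\ u (n + k)%N + l (n + k)%N <= u n + l n.
  elim: k => [|k [IH1 IH2]]; first by rewrite addn0.
  by rewrite addnS; have [h1 h2] := h (n + k)%N; split; lra.
have ub m n : u m <= u n + l n.
  have [mn|nm] := leqP m n.
    have [h1 _] := mono m (n - m)%N; rewrite subnKC// in h1.
    by have := l0 n; lra.
  have [_ h1] := mono n (m - n)%N; rewrite subnKC// in h1; last exact: ltnW.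
  by have := l0 m; lra.
exists (sup (range u)) => n; apply/andP; split.
  apply: ub_le_sup; last by exists n.
  by exists (u 0%N + l 0%N) => _ [m _ <-].
apply: ge_sup; first by exists (u 0%N); exists 0%N.
by move=> _ [m _ <-].
Qed.

(** Repeated quartering leads to rectangles shrinking to a point where [f] is differentiable. There
    the remainder of first order is at most [k] times the diameter, and so is its integral times the
    perimeter: the resulting factor [4 ^ -n] compensates the factor [4 ^ n] lost in [grow]. *)
Lemma goursat_aux : rint f a (a + s) c (c + t) = 0.
Proof.
have near2 (p r u v : R) : p <= u <= p + r -> p <= v <= p + r -> - r <= u - v <= r by lra.
have [nx nxP] := choice (fun np : nat * (R * R) => step np.1 np.2).
pose fix q n : R * R := if n is m.+1 then nx (m, q m) else (a, c).
have ins n : inside n (q n).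
  elim: n => [|n IH] /=; first by rewrite /inside/= /S /T expr0 !divr1 !lexx.
  by have [] := nxP (n, q n) IH.
have nst n := nxP (n, q n) (ins n).
have [x xP] : exists x, forall n, (q n).1 <= x <= (q n).1 + S n.
  apply: nested => // n; by have [_ [? ?] _ _] := nst n.
have [y yP] : exists y, forall n, (q n).2 <= y <= (q n).2 + T n.
  apply: nested => // n; by have [_ _ [? ?] _] := nst n.
have grow n : normc (I 0 (a, c)) <= 4 ^+ n * normc (I n (q n)).
  elim: n => [|n IH]; first by rewrite expr0 mul1r.
  apply: le_trans IH _; rewrite exprSr -mulrA ler_wpM2l ?exprn_ge0//.
  by have [_ _ _ ?] := nst n.
have fxy : cderivable f (x +i* y).
  by apply: fd; [have := xP 0%N|have := yP 0%N]; rewrite /S /T /= expr0 divr1.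
have I0 : I 0 (a, c) = rint f a (a + s) c (c + t).
  by rewrite /I /S /T /= expr0 !divr1.
apply/eqP; rewrite -normc_eq0 eq_le normc_ge0 andbT -I0.
have st0 : 0 <= s + t by rewrite addr_ge0.
apply/ler_addgt0Pr => e e0; rewrite add0r.
(* The final bound is [4 * (s + t) ^+ 2 * k]; the added 1 covers the degenerate case [s = t = 0]. *)
pose k := e / (4 * ((s + t) ^+ 2 + 1)).
have D0 : 0 < 4 * ((s + t) ^+ 2 + 1) by have := sqr_ge0 (s + t); lra.
have k0 : 0 < k by rewrite divr_gt0.
have kE : 4 * (s + t) ^+ 2 * k <= e.
  have -> : e = k * (4 * ((s + t) ^+ 2 + 1)) by rewrite /k divfK// gt_eqF.
  by rewrite mulrC ler_wpM2l ?(ltW k0)//; lra.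
have [l fl] := fxy; have [d d0 P] := fl _ k0.
have [n nd] : exists n, (s + t) / 2 ^+ n < d.
  have := @cvg_geometric R (s + t) 2^-1; rewrite ger0_norm ?invr_ge0//.
  rewrite invf_lt1 ?ltr1n// => /(_ isT) /cvgrPdist_lt /(_ _ d0) [n _ /(_ n (leqnn n))].
  rewrite /= sub0r normrN ger0_norm; last by rewrite mulr_ge0// exprn_ge0// invr_ge0.
  by rewrite exprVn; exists n.
apply: le_trans (grow n) _.
have [Sn Tn] := (S0 n, T0 n).
have STn : S n + T n = (s + t) / 2 ^+ n by rewrite -mulrDl.
have qs := ins n; move/and4P: qs => [q1 q2 q3 q4].
have fc u v : (q n).1 <= u <= (q n).1 + S n -> (q n).2 <= v <= (q n).2 + T n -> ccont f (u +i* v).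
  move=> /andP[u1 u2] /andP[v1 v2]; apply: cderivable_ccont; apply: fd.
    by rewrite (le_trans q1 u1) (le_trans u2 q2).
  by rewrite (le_trans q3 v1) (le_trans v2 q4).
pose z := x +i* y.
(* [err] is [f] minus its affine approximation at [z], which does not change the integral by
   [rint_affine]. *)
pose err w := f w + ((- f z + l * z) + (- l) * w).
have fe : edge_cont f (q n).1 ((q n).1 + S n) (q n).2 ((q n).2 + T n).
  by apply: cont_on_edge => //; rewrite lerDl.
have ae : edge_cont (fun w => (- f z + l * z) + (- l) * w) (q n).1 ((q n).1 + S n) (q n).2 ((q n).2 + T n).
  by apply: cont_on_edge; rewrite ?lerDl// => u v _ _; exact: ccont_affine.
have -> : I n (q n) = rint err (q n).1 ((q n).1 + S n) (q n).2 ((q n).2 + T n).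
  by rewrite rintD// rint_affine ?addr0 ?lerDl.
have ee : edge_cont err (q n).1 ((q n).1 + S n) (q n).2 ((q n).2 + T n).
  apply: cont_on_edge; rewrite ?lerDl// => u v uP vP.
  apply: cderivable_ccont.
  have [l' fl'] : cderivable f (u +i* v).
    move: uP vP => /andP[u1 u2] /andP[v1 v2]; apply: fd.
      by rewrite (le_trans q1 u1) (le_trans u2 q2).
    by rewrite (le_trans q3 v1) (le_trans v2 q4).
  exists (l' + (0 + - l * 1)); apply: cderD => //.
  by apply: cderD; [exact: cder_cst|exact/cderZ/cder_id].
have B : normc (rint err (q n).1 ((q n).1 + S n) (q n).2 ((q n).2 + T n)) <=
   4 * (S n + T n) * (k * (S n + T n)).
  have := @rint_le _ err (q n).1 ((q n).1 + S n) (q n).2 ((q n).2 + T n) (k * (S n + T n)).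
  rewrite !lerDl ![_ + _ - _]addrAC !subrr !add0r; apply => // u v uP vP _.
  have -> : u +i* v = z + ((u - x) +i* (v - y)).
    by rewrite /z; apply/eqP; rewrite eq_complex /=; apply/andP; split; apply/eqP; ring.
  set h := (u - x) +i* (v - y).
  have hN : normc h <= S n + T n.
    apply: le_trans (normc_le _ _) _; apply: lerD; rewrite ler_norml.
      exact: near2 uP (xP n).
    exact: near2 vP (yP n).
  have -> : err (z + h) = f (z + h) - f z - l * h by rewrite /err; ring.
  apply: (@le_trans _ _ (k * normc h)); last by rewrite ler_wpM2l// (ltW k0).
  by apply: P; lra.
apply: (@le_trans _ _ (4 ^+ n * (4 * (S n + T n) * (k * (S n + T n))))).
  by rewrite ler_wpM2l// exprn_ge0.
have -> : 4 ^+ n * (4 * (S n + T n) * (k * (S n + T n))) = 4 * (s + t) ^+ 2 * k.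
  rewrite STn (_ : (4 : R) ^+ n = 2 ^+ n * 2 ^+ n).
    by field; rewrite expf_neq0.
  by rewrite -exprMn; congr (_ ^+ _); ring.
by [].
Qed.

End goursat.

(** * The residue theorem for one pole in a rectangle *)

Section residue.
Variable R : realType.
Local Notation C := R[i].
Implicit Types (f g : C -> C) (p r z : C) (a b c d x y : R).

Lemma goursat f a b c d : a <= b -> c <= d ->
  (forall x y, a <= x <= b -> c <= y <= d -> cderivable f (x +i* y)) ->
  rint f a b c d = 0.
Proof.
move=> ab cd fd; have := @goursat_aux _ f a (b - a) c (d - c).
rewrite ![_ + (_ - _)]addrC !subrK !subr_ge0; exact.
Qed.

(** The left, right, lower and upper strips are cut off in this order; [f] is differentiable on each
    of them, so [goursat] makes their contributions vanish. *)
Lemma rint_annulus f a a' b' b c c' d' d :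
  a <= a' -> a' <= b' -> b' <= b -> c <= c' -> c' <= d' -> d' <= d ->
  (forall x y, a <= x <= b -> c <= y <= d ->
    [|| x <= a', b' <= x, y <= c' | d' <= y] -> cderivable f (x +i* y)) ->
  rint f a b c d = rint f a' b' c' d'.
Proof.
move=> aa' ab' bb' cc' cd' dd' fd.
have fc x y : a <= x <= b -> c <= y <= d ->
    [|| x <= a', b' <= x, y <= c' | d' <= y] -> ccont f (x +i* y).
  by move=> ? ? ?; apply: cderivable_ccont; exact: fd.
have a'b : a' <= b by apply: le_trans bb'.
have c'd : c' <= d by apply: le_trans dd'.
have cd : c <= d by apply: le_trans c'd.
have ab : a <= b by apply: le_trans a'b.
rewrite (rint_hsplit aa' a'b); last 2 first.
- by move=> x xP; apply: ccont_h; apply: fc => //; rewrite ?lexx ?cc' ?orbT.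
- by move=> x xP; apply: ccont_h; apply: fc => //; rewrite ?lexx ?cd ?dd' ?orbT.
rewrite goursat//; last first.
  move=> x y /andP[h1 h2] yP; apply: fd => //; last by rewrite h2.
  by rewrite h1 (le_trans h2 a'b).
rewrite add0r (rint_hsplit ab' bb'); last 2 first.
- move=> x /andP[h1 h2]; apply: ccont_h; apply: fc; rewrite ?lexx ?cc' ?orbT//.
  by rewrite h2 (le_trans aa' h1).
- move=> x /andP[h1 h2]; apply: ccont_h; apply: fc; rewrite ?lexx ?cd ?dd' ?orbT//.
  by rewrite h2 (le_trans aa' h1).
rewrite (@goursat f b' b)//; last first.
  move=> x y /andP[h1 h2] yP; apply: fd => //; last by rewrite h1 orbT.
  by rewrite h2 (le_trans aa')// (le_trans ab').
have bP : a <= b' <= b by rewrite bb' (le_trans aa').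
have aP : a <= a' <= b by rewrite aa' a'b.
rewrite addr0 (rint_vsplit cc' c'd); last 2 first.
- by move=> y yP; apply: ccont_v; apply: fc; rewrite ?lexx.
- by move=> y yP; apply: ccont_v; apply: fc; rewrite ?lexx ?orbT.
rewrite goursat//; last first.
  move=> x y /andP[h1 h2] /andP[k1 k2]; apply: fd; last by rewrite k2 !orbT.
    by rewrite (le_trans aa')// (le_trans h2).
  by rewrite k1 (le_trans k2 c'd).
rewrite add0r (rint_vsplit cd' dd'); last 2 first.
- move=> y /andP[k1 k2]; apply: ccont_v; apply: fc; rewrite ?lexx//.
  by rewrite k2 (le_trans cc').
- move=> y /andP[k1 k2]; apply: ccont_v; apply: fc; rewrite ?lexx ?orbT//.
  by rewrite k2 (le_trans cc').
rewrite (@goursat f a' b' d' d)// ?addr0//.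
move=> x y /andP[h1 h2] /andP[k1 k2]; apply: fd; last by rewrite k1 !orbT.
  by rewrite (le_trans aa')// (le_trans h2).
by rewrite k2 (le_trans cc')// (le_trans cd').
Qed.

Lemma rint_shift g p a b c d :
  edge_cont g (a - complex.Re p) (b - complex.Re p) (c - complex.Im p) (d - complex.Im p) ->
  rint (fun z => g (z - p)) a b c d =
  rint g (a - complex.Re p) (b - complex.Re p) (c - complex.Im p) (d - complex.Im p).
Proof.
case: p => px py /= [g1 g2 g3 g4].
rewrite /rint -!cint_itv_shift//=; congr (_ - _ + 'i * (_ - _)); apply: eq_cint => x _;
  by congr g; apply/eqP; rewrite eq_complex /= ![- _ + x]addrC !eqxx.
Qed.

(* The value is 2 i pi, but only wind != 0 is needed. *)
Definition wind : C := rint (fun z => z^-1) (-1) 1 (-1) 1.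

Lemma cderivable_inv z : z != 0 -> cderivable (fun z => z^-1) z.
Proof. by move=> z0; exists (- (z ^- 2)); exact: cderV_pt. Qed.

Lemma complex_neq0 x y : (x != 0) || (y != 0) -> x +i* y != 0.
Proof. by rewrite eq_complex /= negb_and. Qed.

Lemma wind_rect a b c d : a < 0 -> 0 < b -> c < 0 -> 0 < d ->
  rint (fun z => z^-1) a b c d = wind.
Proof.
suff H a' b' c' d' a1 b1 c1 d1 : a' <= a1 -> a1 < 0 -> 0 < b1 -> b1 <= b' ->
    c' <= c1 -> c1 < 0 -> 0 < d1 -> d1 <= d' ->
    rint (fun z : C => z^-1) a' b' c' d' = rint (fun z => z^-1) a1 b1 c1 d1.
  move=> a0 b0 c0 d0.
  (* Two rectangles around 0 need not be nested, so both are compared with their intersection. *)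
  rewrite (H a b c d (Num.max a (-1)) (Num.min b 1) (Num.max c (-1)) (Num.min d 1));
    rewrite ?le_max ?ge_min ?gt_max ?lt_min ?lexx ?a0 ?b0 ?c0 ?d0 ?ltrN10 ?ltr01//.
  by apply/esym/H;
    rewrite ?le_max ?ge_min ?gt_max ?lt_min ?lexx ?a0 ?b0 ?c0 ?d0 ?ltrN10 ?ltr01 ?orbT.
move=> aa a0 b0 bb cc c0 d0 dd; apply: rint_annulus => //; try lra.
move=> x y _ _ h; apply: cderivable_inv; apply: complex_neq0.
case/or4P: h => h.
- by rewrite lt_eqF//; lra.
- by rewrite gt_eqF//; lra.
- by rewrite (@lt_eqF _ _ y) ?orbT//; lra.
- by rewrite (@gt_eqF _ _ y) ?orbT//; lra.
Qed.

(** In the imaginary part of [wind], every side contributes a nonnegative amount, and the lower side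
    contributes at least 1 because its integrand [1 / (x ^+ 2 + 1)] is at least [1 / 2]. *)
Lemma wind_neq0 : wind != 0.
Proof.
suff : 0 < complex.Im wind by apply: contraTneq => ->; rewrite ltxx.
have fe : edge_cont (fun z : C => z^-1) (-1) 1 (-1) 1.
  by split=> x _; [apply: ccont_h|apply: ccont_h|apply: ccont_v|apply: ccont_v];
    apply: cderivable_ccont; apply: cderivable_inv; apply: complex_neq0;
    rewrite ?oppr_eq0 ?oner_eq0 ?orbT.
have [f1 f2 f3 f4] := fe.
rewrite /wind /rint !ReIm /= mul0r add0r !mul1r.
have lb (h : measurableTypeR R -> R) (k : R) : lebesgue_measure.-integrable `[-1, 1] (EFin \o h) ->
   (forall x, -1 <= x <= 1 -> k <= h x) ->
   2 * k <= \int[@lebesgue_measure R]_(x in `[-1, 1]) h x.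
  move=> ih hk.
  have -> : 2 * k = \int[@lebesgue_measure R]_(x in `[-1, 1]) cst k x.
    rewrite Rintegral_cst//= lebesgue_measure_itv/= lte_fin.
    have -> : (-1 < 1 :> R) by lra.
    by rewrite /=; ring.
  apply: le_Rintegral => //.
    apply: continuous_compact_integrable; first exact: segment_compact.
    by apply: continuous_subspaceT => x; exact: cst_continuous.
have ub (h : measurableTypeR R -> R) (k : R) : lebesgue_measure.-integrable `[-1, 1] (EFin \o h) ->
   (forall x, -1 <= x <= 1 -> h x <= k) ->
   \int[@lebesgue_measure R]_(x in `[-1, 1]) h x <= 2 * k.
  move=> ih hk.
  have -> : 2 * k = \int[@lebesgue_measure R]_(x in `[-1, 1]) cst k x.
    rewrite Rintegral_cst//= lebesgue_measure_itv/= lte_fin.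
    have -> : (-1 < 1 :> R) by lra.
    by rewrite /=; ring.
  apply: le_Rintegral => //.
    apply: continuous_compact_integrable; first exact: segment_compact.
    by apply: continuous_subspaceT => x; exact: cst_continuous.
have D (x : R) : 0 < x ^+ 2 + 1 by have := sqr_ge0 x; lra.
have D' (x : R) : 0 <= (x ^+ 2 + 1)^-1 by rewrite invr_ge0 ltW.
have S : ((-1) ^+ 2 = 1 :> R) /\ (1 ^+ 2 = 1 :> R) by rewrite expr1n sqrrN expr1n.
have b1 := lb _ (2^-1) (cintegrable_itv f1).2; rewrite /= S.1 in b1.
have b2 := ub _ 0 (cintegrable_itv f2).2; rewrite /= S.2 in b2.
have b3 := ub _ 0 (cintegrable_itv f3).1; rewrite /= S.1 in b3.
have b4 := lb _ 0 (cintegrable_itv f4).1; rewrite /= S.2 in b4.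
rewrite S.1 S.2.
have c1 : forall x : R, -1 <= x <= 1 -> 2^-1 <= - (-1 / (x ^+ 2 + 1)).
  move=> x /andP[? ?]; rewrite mulN1r opprK lef_pV2 ?posrE//.
  have x1 : x ^+ 2 <= 1 by rewrite expr2; nra.
  lra.
have c2 : forall x : R, -1 <= x <= 1 -> - (1 / (x ^+ 2 + 1)) <= 0.
  by move=> x _; rewrite mul1r oppr_le0.
have c3 : forall x : R, -1 <= x <= 1 -> -1 / (1 + x ^+ 2) <= 0.
  by move=> x _; rewrite mulN1r oppr_le0 addrC.
have c4 : forall x : R, -1 <= x <= 1 -> 0 <= 1 / (1 + x ^+ 2).
  by move=> x _; rewrite mul1r addrC.
move: (b1 c1) (b2 c2) (b3 c3) (b4 c4).
do 4 (move: (Rintegral _ _ _) => ?); lra.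
Qed.

(** After subtraction of [r / (z - p)] the remaining function [k] satisfies [(z - p) k(z) -> 0]. Its
    integral can be moved to a small square around [p], where the length of the boundary beats the
    growth of [k]. The pole is described by a limit, so no Laurent expansion occurs. *)
Lemma residue_rint f p r a b c d :
  a < complex.Re p < b -> c < complex.Im p < d ->
  (forall x y, a <= x <= b -> c <= y <= d -> x +i* y != p -> cderivable f (x +i* y)) ->
  (forall e : R, 0 < e -> exists2 d : R, 0 < d & forall h, h != 0 ->
    normc h < d -> normc (h * f (p + h) - r) <= e) ->
  rint f a b c d = r * wind.
Proof.
move=> /andP[ap pb] /andP[cp pd] fd fr.
have pE : p = complex.Re p +i* complex.Im p by case: (p).
set px := complex.Re p in ap pb pE *; set py := complex.Im p in cp pd pE *.
pose k z := f z + (- r) * (z - p)^-1.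
have np x y : (x != px) || (y != py) -> x +i* y != p.
  by rewrite pE eq_complex /= negb_and.
have ic z : z != p -> cderivable (fun z => (z - p)^-1) z.
  move=> zp; have [l il] := @cderivable_inv (z - p) (ltac:(by rewrite subr_eq0)).
  by exists l; exact: (cder_shift il).
have edg g : (forall x y, a <= x <= b -> c <= y <= d -> x +i* y != p -> cderivable g (x +i* y)) ->
    edge_cont g a b c d.
  have cd := ltW (lt_trans cp pd); have ab := ltW (lt_trans ap pb).
  move=> gd; split=> x xP; [apply: ccont_h|apply: ccont_h|apply: ccont_v|apply: ccont_v];
    apply: cderivable_ccont; apply: gd; rewrite ?xP ?lexx ?ab ?cd//; apply: np.
  - by rewrite (lt_eqF cp) orbT.
  - by rewrite (gt_eqF pd) orbT.
  - by rewrite (lt_eqF ap).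
  - by rewrite (gt_eqF pb).
have fE := edg f fd.
have iE : edge_cont (fun z => (z - p)^-1) a b c d.
  by apply: edg => x y _ _; exact: ic.
have kd x y : a <= x <= b -> c <= y <= d -> x +i* y != p -> cderivable k (x +i* y).
  move=> xP yP xy; have [l fl] := fd x y xP yP xy; have [m im] := ic _ xy.
  by exists (l + - r * m); apply: cderD => //; exact: cderZ.
have kE := edg k kd.
have E : rint f a b c d = rint k a b c d + r * rint (fun z => (z - p)^-1) a b c d.
  rewrite -rintZ// -rintD//; last first.
    by apply: edg => x y _ _ xy; have [m im] := ic _ xy; exists (r * m); exact: cderZ.
  congr (rint _ a b c d); apply/funext => z; rewrite /k; ring.
have W : rint (fun z => (z - p)^-1) a b c d = wind.
  rewrite (@rint_shift (fun z => z^-1)) ?wind_rect ?subr_lt0 ?subr_gt0//.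
  by split=> x _; [apply: ccont_h|apply: ccont_h|apply: ccont_v|apply: ccont_v];
    apply: cderivable_ccont; apply: cderivable_inv; apply: complex_neq0;
    rewrite subr_eq0 ?(lt_eqF ap) ?(gt_eqF pb) ?(lt_eqF cp) ?(gt_eqF pd) ?orbT.
rewrite E W (_ : rint k a b c d = 0) ?add0r//.
apply/eqP; rewrite -normc_eq0 eq_le normc_ge0 andbT.
apply/ler_addgt0Pr => e e0; rewrite add0r.
have e16 : 0 < e / 16 by lra.
have [t t0 P] := fr _ e16.
(* On the boundary of the square of half-side [s], the distance to [p] lies between [s] and
   [2 * s < t]. There [k] is at most [e / 16 / s], and [rint_le] multiplies this by [16 * s]. *)
pose s := Num.min (t / 3) (Num.min (Num.min (px - a) (b - px)) (Num.min (py - c) (d - py))).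
have s0 : 0 < s by rewrite !lt_min !subr_gt0 ap pb cp pd divr_gt0.
have st : s <= t / 3 by rewrite ge_min lexx.
have s1 : s <= px - a by rewrite !ge_min lexx ?orbT.
have s2 : s <= b - px by rewrite !ge_min lexx ?orbT.
have s3 : s <= py - c by rewrite !ge_min lexx ?orbT.
have s4 : s <= d - py by rewrite !ge_min lexx ?orbT.
move: s s0 st s1 s2 s3 s4 => s s0 st s1 s2 s3 s4.
have notp x y : [|| x <= px - s, px + s <= x, y <= py - s | py + s <= y] -> x +i* y != p.
  move=> h; apply: np; case/or4P: h => h.
  - by rewrite lt_eqF// (le_lt_trans h)// gtrBl.
  - by rewrite gt_eqF// (lt_le_trans _ h)// ltrDl.
  - by rewrite (@lt_eqF _ _ y) ?orbT// (le_lt_trans h)// gtrBl.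
  - by rewrite (@gt_eqF _ _ y) ?orbT// (lt_le_trans _ h)// ltrDl.
rewrite (@rint_annulus k a (px - s) (px + s) b c (py - s) (py + s) d); try lra; last first.
  by move=> x y xP yP h; apply: kd => //; exact: notp.
have := @rint_le _ k (px - s) (px + s) (py - s) (py + s) (e / 16 / s).
have -> : 4 * (px + s - (px - s) + (py + s - (py - s))) * (e / 16 / s) = e.
  by field; rewrite gt_eqF.
apply; try lra.
- have kc x y : px - s <= x <= px + s -> py - s <= y <= py + s ->
    [|| x <= px - s, px + s <= x, y <= py - s | py + s <= y] -> ccont k (x +i* y).
    move=> xP yP h; apply: cderivable_ccont; apply: kd; last exact: notp.
      by apply/andP; split; lra.
    by apply/andP; split; lra.
  by split=> x xP; [apply: ccont_h|apply: ccont_h|apply: ccont_v|apply: ccont_v];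
    apply: kc; rewrite ?lexx ?orbT//; apply/andP; split; lra.
- move=> x y /andP[x1 x2] /andP[y1 y2] h.
  have xyp : x +i* y != p by apply: notp; case/or4P: h => /eqP ->; rewrite lexx ?orbT.
  pose u := x +i* y - p.
  have u0 : u != 0 by rewrite subr_eq0.
  have uRe : complex.Re u = x - px by rewrite /u ReD ReN.
  have uIm : complex.Im u = y - py by rewrite /u ImD ImN.
  have ut : normc u < t.
    apply: le_lt_trans (ler_normc_ReIm _) _; rewrite uRe uIm.
    have : `|x - px| <= s by rewrite ler_norml; apply/andP; split; lra.
    have : `|y - py| <= s by rewrite ler_norml; apply/andP; split; lra.
    lra.
  have us : s <= normc u.
    case/or4P: h => /eqP h.
    + apply: le_trans (ler_Re_normc _); rewrite uRe h (_ : px - s - px = - s) ?normrN; last ring.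
      exact: ler_norm.
    + apply: le_trans (ler_Re_normc _); rewrite uRe h (_ : px + s - px = s) ?ler_norm//; ring.
    + apply: le_trans (ler_Im_normc _); rewrite uIm h (_ : py - s - py = - s) ?normrN; last ring.
      exact: ler_norm.
    + apply: le_trans (ler_Im_normc _); rewrite uIm h (_ : py + s - py = s) ?ler_norm//; ring.
  have -> : k (x +i* y) = (u * f (p + u) - r) / u.
    have -> : p + u = x +i* y by rewrite /u; ring.
    by rewrite /k -/u; field.
  rewrite normcM normcV; apply: ler_pM; rewrite ?normc_ge0 ?invr_ge0 ?normc_ge0//.
    exact: P.
  by rewrite lef_pV2 ?posrE ?normc_gt0.
Qed.

End residue.

(** * Cauchy's formula, second differences and limits of holomorphic functions *)

Section cauchy_estimates.
Variable R : realType.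
Local Notation C := R[i].
Implicit Types (f g : C -> C) (p r z h k : C) (a b c d x y rho : R).

Definition sqderiv f z rho := forall x y, `|x - complex.Re z| <= rho ->
  `|y - complex.Im z| <= rho -> cderivable f (x +i* y).

Lemma sqderivE f z rho x y : sqderiv f z rho ->
  complex.Re z - rho <= x <= complex.Re z + rho ->
  complex.Im z - rho <= y <= complex.Im z + rho -> cderivable f (x +i* y).
Proof. by move=> fd xP yP; apply: fd; rewrite ler_distl. Qed.

Lemma cauchy_formula f p a b c d :
  a < complex.Re p < b -> c < complex.Im p < d ->
  (forall x y, a <= x <= b -> c <= y <= d -> cderivable f (x +i* y)) ->
  rint (fun z => f z / (z - p)) a b c d = f p * wind R.
Proof.
move=> ap cp fd; apply: (residue_rint (p := p)) => //.
  move=> x y xP yP xy; have [l fl] := fd x y xP yP.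
  have [m im] := @cderivable_inv R (x +i* y - p) (ltac:(by rewrite subr_eq0)).
  by exists (l * (x +i* y - p)^-1 + f (x +i* y) * m); apply: cderM => //; exact: cder_shift im.
have [l fl] : cderivable f p.
  case: p ap cp => px py /= /andP[? ?] /andP[? ?].
  by apply: fd; apply/andP; split; apply: ltW.
move=> e e0; have [t t0 P] := cder_cont fl e0; exists t => // h h0 ht.
have -> : h * (f (p + h) / (p + h - p)) - f p = f (p + h) - f p.
  by rewrite [p + h]addrC addrK mulrCA divff// mulr1.
exact/ltW/P.
Qed.

(* This estimate survives limits and integrals, and by
   cderivable_of_second_difference it implies differentiability. *)
Lemma second_difference f z rho (A : R) : 0 < rho -> sqderiv f z rho ->
  (forall x y, `|x - complex.Re z| <= rho -> `|y - complex.Im z| <= rho ->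
     normc (f (x +i* y)) <= A) ->
  forall h k, normc h <= rho / 2 -> normc k <= rho / 2 ->
  normc (k * (f (z + h) - f z) - h * (f (z + k) - f z)) <=
  64 / normc (wind R) / rho ^+ 2 * A * (normc h * normc k * normc (h - k)).
Proof.
move=> rho0 fd fA h k hr kr.
have w0 : 0 < normc (wind R) by rewrite normc_gt0 wind_neq0.
have zE : z = complex.Re z +i* complex.Im z by case: (z).
set x := complex.Re z in fd fA zE; set y := complex.Im z in fd fA zE.
pose I f := rint f (x - rho) (x + rho) (y - rho) (y + rho).
have xr : x - rho <= x + rho by lra.
have yr : y - rho <= y + rho by lra.
have fd' u v : x - rho <= u <= x + rho -> y - rho <= v <= y + rho -> cderivable f (u +i* v).
  by move=> ? ?; apply: (sqderivE fd).
have sm h' : normc h' <= rho / 2 -> x - rho < complex.Re (z + h') < x + rho /\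
    y - rho < complex.Im (z + h') < y + rho.
  move=> hr'; have := ler_Re_normc h'; have := ler_Im_normc h'.
  rewrite !ler_norml ReD ImD -/x -/y => /andP[? ?] /andP[? ?].
  by split; apply/andP; split; lra.
have CF h' : normc h' <= rho / 2 -> I (fun u => f u / (u - (z + h'))) = f (z + h') * wind R.
  by move=> /sm[? ?]; apply: cauchy_formula.
have c0 : normc (0 : C) <= rho / 2 by rewrite normc0; lra.
have bd u v : x - rho <= u <= x + rho -> y - rho <= v <= y + rho ->
    [|| u == x - rho, u == x + rho, v == y - rho | v == y + rho] ->
    rho <= normc (u +i* v - z).
  move=> _ _ /or4P[] /eqP ->.
  - apply: le_trans (ler_Re_normc _); rewrite ReD ReN -/x/= (_ : x - rho - x = - rho); last ring.
    by rewrite normrN ler_norm.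
  - by apply: le_trans (ler_Re_normc _); rewrite ReD ReN -/x/= (_ : x + rho - x = rho) ?ler_norm//; ring.
  - apply: le_trans (ler_Im_normc _); rewrite ImD ImN -/y/= (_ : y - rho - y = - rho); last ring.
    by rewrite normrN ler_norm.
  - by apply: le_trans (ler_Im_normc _); rewrite ImD ImN -/y/= (_ : y + rho - y = rho) ?ler_norm//; ring.
have bd' h' u v : normc h' <= rho / 2 -> x - rho <= u <= x + rho -> y - rho <= v <= y + rho ->
    [|| u == x - rho, u == x + rho, v == y - rho | v == y + rho] ->
    rho / 2 <= normc (u +i* v - (z + h')).
  move=> hh uP vP uv; have := bd u v uP vP uv.
  rewrite (_ : u +i* v - (z + h') = (u +i* v - z) + (- h')); last by rewrite opprD addrA.
  by have := ler_normcB2 (u +i* v - z) (- h'); rewrite normc_opp; lra.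
have edg g : (forall u v, x - rho <= u <= x + rho -> y - rho <= v <= y + rho ->
    [|| u == x - rho, u == x + rho, v == y - rho | v == y + rho] -> cderivable g (u +i* v)) ->
    edge_cont g (x - rho) (x + rho) (y - rho) (y + rho).
  by move=> gd; split=> u uP; [apply: ccont_h|apply: ccont_h|apply: ccont_v|apply: ccont_v];
    apply: cderivable_ccont; apply: gd; rewrite ?uP ?lexx ?eqxx ?orbT ?xr ?yr.
have eC h' : normc h' <= rho / 2 -> edge_cont (fun u => f u / (u - (z + h'))) (x - rho) (x + rho) (y - rho) (y + rho).
  move=> hh; apply: edg => u v uP vP uv; have [l fl] := fd' _ _ uP vP.
  have nz : u +i* v - (z + h') != 0.
    by rewrite -normc_gt0; have := bd' h' u v hh uP vP uv; lra.
  have [m im] := cderivable_inv nz.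
  by exists (l * (u +i* v - (z + h'))^-1 + f (u +i* v) * m); apply: cderM => //; exact: cder_shift im.
have eZ m g : edge_cont g (x - rho) (x + rho) (y - rho) (y + rho) ->
    edge_cont (fun u => m * g u) (x - rho) (x + rho) (y - rho) (y + rho).
  have rZ w t : rcont w t -> rcont (fun u => m * w u) t.
    move=> wt e e0; have m0 : 0 < normc m + 1 by have := normc_ge0 m; lra.
    have [t' t'0 P] := wt (e / (normc m + 1)) (divr_gt0 e0 m0); exists t' => // s /P.
    rewrite ltr_pdivlMr// -mulrBr normcM; have := normc_ge0 (w s - w t); nra.
  by move=> [g1 g2 g3 g4]; split=> u uP; apply: rZ; [exact: g1|exact: g2|exact: g3|exact: g4].
have eD g1 g2 : edge_cont g1 (x - rho) (x + rho) (y - rho) (y + rho) ->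
    edge_cont g2 (x - rho) (x + rho) (y - rho) (y + rho) ->
    edge_cont (fun u => g1 u + g2 u) (x - rho) (x + rho) (y - rho) (y + rho).
  have rD w w' t : rcont w t -> rcont w' t -> rcont (fun u => w u + w' u) t.
    move=> wt wt' e e0; have e2 : 0 < e / 2 by lra.
    have [t1 t10 P1] := wt _ e2; have [t2 t20 P2] := wt' _ e2.
    exists (Num.min t1 t2); first by rewrite lt_min t10.
    move=> s; rewrite lt_min => /andP[/P1 {}P1 /P2 {}P2].
    rewrite opprD addrACA; apply: le_lt_trans (ler_normcD _ _) _; lra.
  move=> [a1 a2 a3 a4] [b1 b2 b3 b4]; split=> u uP; apply: rD;
    [exact: a1|exact: b1|exact: a2|exact: b2|exact: a3|exact: b3|exact: a4|exact: b4].
(* The combination of Cauchy kernels that reproduces the second difference. It simplifies to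
   [f u * h * k * (h - k)] over the product of the three denominators, which shows the factors of
   the claim. The [z + 0] gives all three terms the shape required by [CF] and [eC]. *)
pose G u := k * (f u / (u - (z + h))) + (- h * (f u / (u - (z + k))) + (h - k) * (f u / (u - (z + 0)))).
have GE : edge_cont G (x - rho) (x + rho) (y - rho) (y + rho).
  by rewrite /G; apply: (eD _ _); [exact/eZ/eC|apply: (eD _ _); [exact/eZ/eC|exact/eZ/eC]].
have IG : I G = (k * (f (z + h) - f z) - h * (f (z + k) - f z)) * wind R.
  rewrite /I /G rintD ?rintD ?rintZ; try (by do ?[exact: eC|exact/eZ/eC|apply: (eD _ _)]).
  rewrite -/(I (fun u => f u / (u - (z + h)))) -/(I (fun u => f u / (u - (z + k)))) -/(I (fun u => f u / (u - (z + 0)))).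
  by rewrite !CF// addr0; ring.
(* On the boundary the three denominators are at least [rho], [rho / 2] and [rho / 2], hence
   [4 / rho ^+ 3]. The length factor of [rint_le] is [16 * rho], which makes 64 in all. *)
have := @rint_le _ G (x - rho) (x + rho) (y - rho) (y + rho)
  (A * (normc h * normc k * normc (h - k)) * 4 / rho ^+ 3) xr yr GE.
rewrite -/(I G) IG normcM -ler_pdivlMr// => H.
apply: le_trans (H _) _; last first.
  by rewrite le_eqVlt; apply/orP; left; apply/eqP; field; rewrite ?gt_eqF.
move=> u v uP vP uv.
set t := u +i* v.
have n1 := bd _ _ uP vP uv; have n2 := bd' h _ _ hr uP vP uv; have n3 := bd' k _ _ kr uP vP uv.
rewrite -/t in n1 n2 n3.
have r20 : 0 < rho / 2 by rewrite divr_gt0.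
have d1 : t - z != 0 by rewrite -normc_gt0 (lt_le_trans rho0 n1).
have d2 : t - (z + h) != 0 by rewrite -normc_gt0 (lt_le_trans r20 n2).
have d3 : t - (z + k) != 0 by rewrite -normc_gt0 (lt_le_trans r20 n3).
have -> : G t = f t * (h * k * (h - k)) / ((t - z) * (t - (z + h)) * (t - (z + k))).
  by rewrite /G addr0; field; rewrite d1 d2 d3.
rewrite (normcM (_ * _)) normcV (normcM (_ * _)) (normcM (t - z)) (normcM (f t)) (normcM (h * k)) (normcM h).
have At : normc (f t) <= A.
  by apply: fA; rewrite ler_distl.
have -> : A * (normc h * normc k * normc (h - k)) * 4 / rho ^+ 3 =
   (A * (normc h * normc k * normc (h - k))) * (rho * (rho / 2) * (rho / 2))^-1.
  by field; rewrite gt_eqF.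
have P0 : 0 < rho * (rho / 2) * (rho / 2) by rewrite !mulr_gt0.
apply: ler_pM.
- by rewrite !mulr_ge0 ?normc_ge0.
- by rewrite invr_ge0 !mulr_ge0 ?normc_ge0.
- by rewrite ler_wpM2r// !mulr_ge0 ?normc_ge0.
rewrite lef_pV2 ?posrE ?mulr_gt0 ?normc_gt0//.
by apply: ler_pM => //; [rewrite mulr_ge0 ?ltW|exact: ltW|apply: ler_pM => //; exact: ltW].
Qed.

End cauchy_estimates.

Section complex_limits.
Variable R : realType.
Local Notation C := R[i].
Implicit Types (f g : C -> C) (z h k l : C) (rho : R) (u : nat -> C).

Definition ccvg u l := forall e : R, 0 < e ->
  exists N, forall n, (N <= n)%N -> normc (u n - l) <= e.

Definition ccauchy u := forall e : R, 0 < e ->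
  exists N, forall m n, (N <= m)%N -> (N <= n)%N -> normc (u m - u n) <= e.

Lemma real_cauchy (v : nat -> R) : (forall e : R, 0 < e ->
  exists N, forall m n, (N <= m)%N -> (N <= n)%N -> `|v m - v n| <= e) ->
  exists a : R, forall e : R, 0 < e -> exists N, forall n, (N <= n)%N -> `|v n - a| <= e.
Proof.
move=> vc; have cv : cvgn v.
  apply/cauchy_cvgP/cauchy_exP => e e0.
  have [N P] := vc (e / 2) (divr_gt0 e0 (ltr0n _ 2)).
  exists (v N); exists N => // n /= Nn; rewrite /ball/=.
  by apply: le_lt_trans (P _ _ (leqnn N) Nn) _; rewrite ltr_pdivrMr// mulr_natr mulr2n ltrDl.
exists (limn v) => e e0; move/cvgrPdist_le : cv => /(_ e e0)[N _ P].
by exists N => n Nn; rewrite distrC; exact: P.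
Qed.

Lemma ccauchy_cvg u : ccauchy u -> exists l, ccvg u l.
Proof.
move=> uc.
have [a aP] : exists a, forall e : R, 0 < e -> exists N, forall n, (N <= n)%N -> `|complex.Re (u n) - a| <= e.
  apply: real_cauchy => e /uc[N P]; exists N => m n mN nN.
  by rewrite -ReN -ReD (le_trans (ler_Re_normc _))// P.
have [b bP] : exists a, forall e : R, 0 < e -> exists N, forall n, (N <= n)%N -> `|complex.Im (u n) - a| <= e.
  apply: real_cauchy => e /uc[N P]; exists N => m n mN nN.
  by rewrite -ImN -ImD (le_trans (ler_Im_normc _))// P.
exists (a +i* b) => e e0; have e2 : 0 < e / 2 by lra.
have [N1 P1] := aP _ e2; have [N2 P2] := bP _ e2.
exists (maxn N1 N2) => n; rewrite geq_max => /andP[/P1 {}P1 /P2 {}P2].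
by rewrite (le_trans (ler_normc_ReIm _))// !ReIm/=; lra.
Qed.

Lemma ccvg_le u l z (B : R) : ccvg u l -> (forall n, normc (u n - z) <= B) ->
  normc (l - z) <= B.
Proof.
move=> ul uB; apply/ler_addgt0Pr => e /ul[N P].
rewrite (_ : l - z = - (u N - l) + (u N - z)); last ring.
by rewrite (le_trans (ler_normcD _ _))// normc_opp addrC lerD// P.
Qed.

Lemma ccvgD u v l m : ccvg u l -> ccvg v m -> ccvg (fun n => u n + v n) (l + m).
Proof.
move=> ul vm e e0; have e2 : 0 < e / 2 by lra.
have [N1 P1] := ul _ e2; have [N2 P2] := vm _ e2.
exists (maxn N1 N2) => n; rewrite geq_max => /andP[/P1 {}P1 /P2 {}P2].
by rewrite opprD addrACA (le_trans (ler_normcD _ _))//; lra.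
Qed.

Lemma ccvgZ u l c : ccvg u l -> ccvg (fun n => c * u n) (c * l).
Proof.
move=> ul e e0; have c0 : 0 < normc c + 1 by have := normc_ge0 c; lra.
have [N P] := ul (e / (normc c + 1)) (divr_gt0 e0 c0); exists N => n /P.
rewrite ler_pdivlMr// -mulrBr normcM => h.
by have := normc_ge0 (u n - l); nra.
Qed.

(** Divided by [h * k], the hypothesis says that the difference quotient [q] is Lipschitz with
    constant [M] away from 0. So it has a limit at 0, first along the sequence [t n] and then in
    general. *)
Lemma cderivable_of_second_difference f z (rho M : R) : 0 < rho ->
  (forall h k, normc h <= rho -> normc k <= rho ->
    normc (k * (f (z + h) - f z) - h * (f (z + k) - f z)) <=
    M * (normc h * normc k * normc (h - k))) -> cderivable f z.
Proof.
move=> rho0 fM; pose q h := (f (z + h) - f z) / h.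
(* The choice [h = rho], [k = - rho] makes the coefficient of [M] positive. *)
have M0 : 0 <= M.
  have r0 : normc rho%:C = rho by rewrite normc_real ger0_norm// ltW.
  have := fM rho%:C (- rho%:C); rewrite normc_opp opprK r0 lexx => /(_ isT isT).
  move=> /(le_trans (normc_ge0 _)); rewrite pmulr_lge0//.
  rewrite !mulr_gt0// normc_gt0 -rmorphD/= -complexr0 complex_neq0//.
  by rewrite gt_eqF// addr_gt0.
have qM h k : h != 0 -> k != 0 -> normc h <= rho -> normc k <= rho ->
    normc (q h - q k) <= M * normc (h - k).
  move=> h0 k0 hr kr.
  have -> : q h - q k = (k * (f (z + h) - f z) - h * (f (z + k) - f z)) / (h * k).
    by rewrite /q; field; rewrite h0 k0.
  rewrite normcM normcV (normcM h) ler_pdivrMr ?mulr_gt0 ?normc_gt0//.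
  by rewrite -mulrA [normc (h - k) * _]mulrC fM.
pose t n : C := (rho / n.+1%:R)%:C.
have tn n : normc (t n) = rho / n.+1%:R.
  by rewrite normc_real ger0_norm// divr_ge0// ltW.
have t0 n : t n != 0 by rewrite -normc_gt0 tn divr_gt0.
have tr n : normc (t n) <= rho by rewrite tn ler_pdivrMr// ler_peMr ?(ltW rho0)// ler1n.
have tcvg e : 0 < e -> exists N, forall n, (N <= n)%N -> normc (t n) <= e.
  move=> e0; exists (Num.truncn (rho / e)) => n Nn; rewrite tn ler_pdivrMr// mulrC -ler_pdivrMr//.
  by apply: le_trans (ltW (truncnS_gt _)) _; rewrite ler_nat.
have [l lP] : exists l, ccvg (fun n => q (t n)) l.
  apply: ccauchy_cvg => e e0.
  have [N P] := tcvg (e / (M + 1) / 2) (ltac:(rewrite !divr_gt0//; lra)).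
  exists N => m n mN nN; apply: le_trans (qM _ _ (t0 m) (t0 n) (tr m) (tr n)) _.
  have a1 := P _ mN; have a2 := P _ nN; have a3 := ler_normcB (t m) (t n).
  have : normc (t m - t n) <= e / (M + 1) by lra.
  rewrite ler_pdivlMr; last lra.
  by have := normc_ge0 (t m - t n); nra.
exists l => e e0; exists (Num.min rho (e / (M + 1))).
  by rewrite lt_min rho0 divr_gt0//; lra.
move=> h; rewrite lt_min => /andP[hr he].
have [->|h0] := eqVneq h 0.
  by rewrite addr0 subrr mulr0 subrr normc0 mulr0.
have -> : f (z + h) - f z - l * h = - ((l - q h) * h) by rewrite /q; field.
rewrite normc_opp normcM ler_wpM2r ?normc_ge0//.
apply/ler_addgt0Pr => d d0.
have [N1 P1] := lP (d / 2) (divr_gt0 d0 (ltr0n _ 2)).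
have [N2 P2] := tcvg (d / (M + 1) / 2) (ltac:(rewrite !divr_gt0//; lra)).
pose n := maxn N1 N2.
have {}P1 := P1 n (leq_maxl _ _); have {}P2 := P2 n (leq_maxr _ _).
rewrite (_ : l - q h = - (q (t n) - l) + (q (t n) - q h)); last ring.
apply: le_trans (ler_normcD _ _) _; rewrite normc_opp.
have := qM _ _ (t0 n) h0 (tr n) (ltW hr).
have := ler_normcB (t n) h.
move: he; rewrite ltr_pdivlMr; last lra.
have : normc (t n) * (M + 1) <= d / 2.
  by rewrite -ler_pdivlMr; [rewrite mulrAC|lra].
have [] := (normc_ge0 (t n), normc_ge0 h).
nra.
Qed.

(** Pointwise convergence and a common bound suffice: [second_difference] holds for all [F n] with
    the same constant and passes to the limit. *)
Lemma cderivable_limit (F : nat -> C -> C) f z rho (A : R) : 0 < rho ->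
  (forall n, sqderiv (F n) z rho) ->
  (forall n x y, `|x - complex.Re z| <= rho -> `|y - complex.Im z| <= rho ->
     normc (F n (x +i* y)) <= A) ->
  (forall h, normc h <= rho -> ccvg (fun n => F n (z + h)) (f (z + h))) ->
  cderivable f z.
Proof.
move=> r0 Fd FA Ff; have r2 : 0 < rho / 2 by lra.
apply: (cderivable_of_second_difference (rho := rho / 2)
   (M := 64 / normc (wind R) / rho ^+ 2 * A) r2) => h k hr kr.
have c0 : ccvg (fun n => F n z) (f z).
  by have := Ff 0; rewrite addr0; apply; rewrite normc0 ltW.
have ch : ccvg (fun n => F n (z + h)) (f (z + h)) by apply: Ff; lra.
have ck : ccvg (fun n => F n (z + k)) (f (z + k)) by apply: Ff; lra.
have cN u l : ccvg u l -> ccvg (fun n => - u n) (- l).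
  move=> ul e /ul[N P]; exists N => n /P; rewrite -opprD normc_opp//.
have := ccvgD (ccvgZ k (ccvgD ch (cN _ _ c0))) (cN _ _ (ccvgZ h (ccvgD ck (cN _ _ c0)))).
move=> cc; rewrite -[X in normc X]subr0; apply: (ccvg_le cc) => n; rewrite subr0.
exact: (second_difference r0 (Fd n) (FA n) hr kr).
Qed.

End complex_limits.

(** * A mean value inequality for the squared modulus *)

Section area_integrals.
Variable R : realType.
Local Notation leb := (@lebesgue_measure R).
Local Notation mR := (measurableTypeR R).
Local Notation C := R[i].

(** If all values exceeded [c + e], the integral would be at least [(c + e) * (b - a)]; the slack
    [e] makes this contradictory without a minimum being attained. *)
Lemma exists_le_mean (h : mR -> \bar R) (a b c : R) : a < b ->
  measurable_fun `[a, b] h -> (forall x, 0 <= h x)%E ->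
  (\int[leb]_(x in `[a, b]) h x <= (c * (b - a))%:E)%E ->
  forall e : R, 0 < e -> exists2 y : R, a <= y <= b & (h y <= (c + e)%:E)%E.
Proof.
move=> ab mh h0 hc e e0; apply: contrapT => H.
have ba : 0 < b - a by rewrite subr_gt0.
have c0 : 0 <= c.
  by rewrite -(pmulr_lge0 _ ba) -lee_fin (le_trans _ hc)// integral_ge0.
have : (((c + e) * (b - a))%:E <= \int[leb]_(x in `[a, b]) h x)%E.
  have -> : ((c + e) * (b - a))%:E = (\int[leb]_(x in `[a, b]) (cst (c + e)%:E x))%E.
    by rewrite integral_cst//= lebesgue_measure_itv/= lte_fin ab -EFinB -EFinM.
  apply: ge0_le_integral => //.
    by move=> x _; rewrite lee_fin addr_ge0// ltW.
  move=> x; rewrite /= in_itv/= => xab; apply: contrapT => /negP; rewrite -ltNge => hx.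
  by apply: H; exists x => //; exact: ltW.
move=> /le_trans/(_ hc); rewrite lee_fin ler_pM2r//; lra.
Qed.

Section tonelli_on_rectangles.
Variable G : mR * mR -> \bar R.
Hypotheses (mG : measurable_fun setT G) (G0 : forall p, (0 <= G p)%E).
Variables (I J : set mR).
Hypotheses (mI : measurable I) (mJ : measurable J).

Let G1 (A : set (mR * mR)) := G \_ A.

Let mG1 A : measurable A -> measurable_fun setT (G1 A).
Proof. move=> mA; exact: ((measurable_restrictT G mA).1 (measurable_funTS mG)).
Qed.

Let G10 A p : (0 <= G1 A p)%E.
Proof. by rewrite /G1/patch; case: ifP. Qed.

Lemma measurable_int_x : measurable_fun setT (fun y => \int[leb]_(x in I) G (x, y))%E.
Proof.
have := measurable_fun_fubini_tonelli_G (m1 := leb) (G1 (I `*` setT)) (mG1 (measurableX mI measurableT)) (G10 _).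
apply: eq_measurable_fun => y _; rewrite /fubini_G [RHS]integral_mkcond.
apply: eq_integral => x _; rewrite /G1/patch/=.
have [Ix|nI] := pselect (I x); first by rewrite !mem_set.
by rewrite !memNset// => -[].
Qed.

Lemma tonelli_itv : (\int[leb]_(y in J) \int[leb]_(x in I) G (x, y) =
  \int[leb]_(x in I) \int[leb]_(y in J) G (x, y))%E.
Proof.
have := fubini_tonelli (m1 := leb) (m2 := leb) (G1 (I `*` J)) (mG1 (measurableX mI mJ)) (G10 _).
rewrite [X in X = _ -> _](_ : _ = (\int[leb]_(x in I) \int[leb]_(y in J) G (x, y))%E); last first.
  rewrite [RHS]integral_mkcond; apply: eq_integral => x _; rewrite /patch.
  have [Ix|nI] := pselect (I x).
    rewrite (mem_set Ix) [RHS]integral_mkcond; apply: eq_integral => y _; rewrite /G1/patch/=.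
    have [Jy|nJ] := pselect (J y); first by rewrite !mem_set.
    by rewrite !memNset// => -[].
  rewrite (memNset nI) integral0_eq// => y _; rewrite /G1/patch/= memNset//.
  by case.
move=> ->.
rewrite [LHS]integral_mkcond; apply: eq_integral => y _; rewrite /patch.
have [Jy|nJ] := pselect (J y).
  rewrite (mem_set Jy) [LHS]integral_mkcond; apply: eq_integral => x _; rewrite /G1/patch/=.
  have [Ix|nI] := pselect (I x); first by rewrite !mem_set.
  by rewrite !memNset// => -[].
rewrite (memNset nJ) integral0_eq// => x _; rewrite /G1/patch/= memNset//.
by case.
Qed.

End tonelli_on_rectangles.

(** Meant for a side of a rectangle, with [g] the square of a holomorphic function, [h] its modulus
    extended measurably to the line, and [w] a Cauchy kernel. *)
Lemma cint_le_sq (a b r : R) (g w : R -> C) (h : mR -> R) : a <= b -> 0 < r ->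
  (forall x, a <= x <= b -> rcont (fun t => g t * w t) x) ->
  measurable_fun setT h -> (forall x, 0 <= h x) ->
  (forall x, a <= x <= b -> normc (g x) = h x) ->
  (forall x, a <= x <= b -> normc (w x) <= r) ->
  forall c : R, (\int[leb]_(x in `[a, b]) (h x)%:E <= c%:E)%E ->
  normc (cint `[a, b] (fun x => g x * w x)) <= 2 * r * c.
Proof.
move=> ab r0 gc mh h0 gh wr c hc.
have mab : measurable ([set` `[a, b]] : set mR) by exact: measurable_itv.
have ih : leb.-integrable `[a, b] (EFin \o h).
  apply/integrableP; split; first exact/measurable_EFinP/measurable_funTS.
  under eq_integral do rewrite /= ger0_norm//.
  by apply: le_lt_trans hc _; rewrite ltry.
have irh : leb.-integrable `[a, b] (EFin \o (fun x => r * h x)).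
  by have := integrableZl mab r ih; apply: eq_integrable.
have := @cint_le _ `[a, b] (fun x => g x * w x) (fun x => r * h x) (measurable_itv _)
  (cintegrable_itv gc) irh.
have H : forall x, [set` `[a, b]] x -> normc (g x * w x) <= r * h x.
  move=> x; rewrite /= in_itv/= => xab.
  by rewrite normcM mulrC (gh _ xab) ler_wpM2r// wr.
move=> /(_ H) /le_trans; apply; rewrite RintegralZl//.
rewrite mulrA ler_wpM2l ?mulr_ge0 ?(ltW r0)//.
rewrite -lee_fin /Rintegral fineK//.
by apply: integrable_fin_num.
Qed.

(** Cauchy's formula for [f ^+ 2] is applied to a rectangle whose sides are picked in the four outer
    bands of width [rho / 2] of the square. In each band there is a side on which the integral of
    [|f|^2] is at most its mean, and it stays at distance [rho / 2] from [z]. *)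
Lemma mean_inequality (f : C -> C) (z : C) (rho : R) (G : mR * mR -> R) :
  0 < rho -> sqderiv f z rho ->
  measurable_fun setT G -> (forall p, 0 <= G p) ->
  (forall x y, `|x - complex.Re z| <= rho -> `|y - complex.Im z| <= rho ->
    normc (f (x +i* y)) ^+ 2 = G (x, y)) ->
  ((normc (f z) ^+ 2)%:E <= (32 / normc (wind R) / rho ^+ 2)%:E *
    \int[leb]_(y in `[(complex.Im z - rho)%R, (complex.Im z + rho)%R])
    \int[leb]_(x in `[(complex.Re z - rho)%R, (complex.Re z + rho)%R]) (G (x, y))%:E)%E.
Proof.
move=> rho0 fd mG G0 fG.
have N1 (u : R) : u - rho < u - rho / 2 by lra.
have N2 (u : R) : u - rho / 2 <= u + rho by lra.
have N3 (u : R) : u - rho / 2 - (u - rho) = rho / 2 by lra.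
have N4 (u : R) : u - rho <= u + rho / 2 by lra.
have N5 (u : R) : u + rho / 2 < u + rho by lra.
have N6 (u : R) : u + rho - (u + rho / 2) = rho / 2 by lra.
have N7 (u : R) : u - rho / 2 < u by lra.
have N8 (u : R) : u < u + rho / 2 by lra.
have sum4 (p q r t m : R) : p <= m -> q <= m -> r <= m -> t <= m -> (p + q) + (r + t) <= 4 * m.
  by lra.
have far (u w : R) : u <= w - rho / 2 \/ w + rho / 2 <= u -> rho / 2 <= `|u - w|.
  by case=> h; rewrite ler_normr; apply/orP; [right|left]; lra.
have w0 : 0 < normc (wind R) by rewrite normc_gt0 wind_neq0.
have zE : z = complex.Re z +i* complex.Im z by case: (z).
set X := complex.Re z in fd fG zE *; set Y := complex.Im z in fd fG zE *.
have mGE : measurable_fun setT (EFin \o G) by exact/measurable_EFinP.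
have GE0 p : (0 <= (EFin \o G) p)%E by rewrite lee_fin.
set IX : set mR := [set` `[X - rho, X + rho]]; set IY : set mR := [set` `[Y - rho, Y + rho]].
have mIX : measurable IX by exact: measurable_itv.
have mIY : measurable IY by exact: measurable_itv.
pose B (y : mR) : \bar R := (\int[leb]_(x in IX) (G (x, y))%:E)%E.
pose V (x : mR) : \bar R := (\int[leb]_(y in IY) (G (x, y))%:E)%E.
have mB : measurable_fun setT B by have := @measurable_int_x _ mGE GE0 _ mIX; exact.
have mGs : measurable_fun setT (EFin \o (G \o (fun p : mR * mR => (p.2, p.1)))).
  apply/measurable_EFinP; apply: measurableT_comp => //.
  by apply: measurable_fun_pair; [exact: measurable_snd|exact: measurable_fst].
have mV : measurable_fun setT V.
  apply: (@measurable_int_x _ mGs _ IY mIY).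
  by move=> p; rewrite lee_fin; exact: G0.
have B0 y : (0 <= B y)%E by apply: integral_ge0 => x _; rewrite lee_fin.
have V0 y : (0 <= V y)%E by apply: integral_ge0 => x _; rewrite lee_fin.
pose I0 : \bar R := (\int[leb]_(y in IY) \int[leb]_(x in IX) (G (x, y))%:E)%E.
rewrite -/I0.
have IV : I0 = (\int[leb]_(x in IX) V x)%E.
  by exact: (tonelli_itv mGE GE0 mIX mIY).
have I00 : (0 <= I0)%E by apply: integral_ge0 => y _; exact: B0.
have K0 : 0 < 32 / normc (wind R) / rho ^+ 2 by rewrite !divr_gt0// exprn_gt0.
have [Ioo|] := eqVneq I0 +oo%E; first by rewrite Ioo gt0_muley ?leey// lte_fin.
rewrite -ltey -ge0_fin_numE// => /fineK; set i := fine I0 => iE.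
rewrite -iE -EFinM lee_fin.
have i0 : 0 <= i by rewrite -lee_fin iE.
apply/ler_addgt0Pr => e e0.
(* Each side contributes at most [2 * (2 / rho) * (2 * i / rho + d)]. Four sides divided by
   [normc (wind R)] give the constant 32 of the statement and, from [d], exactly [e]. *)
pose d := e * normc (wind R) * rho / 16.
have d0 : 0 < d by rewrite divr_gt0// !mulr_gt0.
(* The mean over a band of width [rho / 2] is at most [2 * i / rho], since the integral over the
   band is at most that over the whole square. *)
have sub (h : mR -> \bar R) (a a' b b' : R) : measurable_fun setT h -> (forall x, 0 <= h x)%E ->
    a' <= a -> a < b -> b <= b' -> b - a = rho / 2 ->
    (\int[leb]_(x in `[a', b']) h x = I0)%E ->
    exists2 y, a <= y <= b & (h y <= (2 * i / rho + d)%:E)%E.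
  move=> mh h0 aa ab bb bar hI; apply: (exists_le_mean ab (measurable_funTS mh) h0 _ d0).
  rewrite bar (_ : 2 * i / rho * (rho / 2) = i); last by field; rewrite gt_eqF.
  rewrite iE -hI; apply: ge0_subset_integral => //=; first exact: measurable_funTS.
  by apply: subset_itv; rewrite bnd_simp.
have [y1 /andP[y1a y1b] y1B] : exists2 y, Y - rho <= y <= Y - rho / 2 & (B y <= (2 * i / rho + d)%:E)%E.
  by apply: (sub B (Y - rho) (Y - rho) (Y - rho / 2) (Y + rho)); rewrite ?lexx ?N1 ?N2 ?N3.
have [y2 /andP[y2a y2b] y2B] : exists2 y, Y + rho / 2 <= y <= Y + rho & (B y <= (2 * i / rho + d)%:E)%E.
  by apply: (sub B (Y + rho / 2) (Y - rho) (Y + rho) (Y + rho)); rewrite ?lexx ?N4 ?N5 ?N6.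
have [x1 /andP[x1a x1b] x1B] : exists2 y, X - rho <= y <= X - rho / 2 & (V y <= (2 * i / rho + d)%:E)%E.
  by apply: (sub V (X - rho) (X - rho) (X - rho / 2) (X + rho)); rewrite ?lexx ?N1 ?N2 ?N3.
have [x2 /andP[x2a x2b] x2B] : exists2 y, X + rho / 2 <= y <= X + rho & (V y <= (2 * i / rho + d)%:E)%E.
  by apply: (sub V (X + rho / 2) (X - rho) (X + rho) (X + rho)); rewrite ?lexx ?N4 ?N5 ?N6.
have fd' u v : x1 <= u <= x2 -> y1 <= v <= y2 -> cderivable f (u +i* v).
  move=> /andP[u1 u2] /andP[v1 v2]; apply: (sqderivE fd).
    by rewrite (le_trans x1a u1) (le_trans u2 x2b).
  by rewrite (le_trans y1a v1) (le_trans v2 y2b).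
have f2d u v : x1 <= u <= x2 -> y1 <= v <= y2 -> cderivable (fun z => f z ^+ 2) (u +i* v).
  by move=> uP vP; have [l fl] := fd' u v uP vP; eexists; exact: (cderX 2 fl).
have CF := @cauchy_formula R (fun z => f z ^+ 2) z x1 x2 y1 y2.
have zx : x1 < complex.Re z < x2 by rewrite -/X (le_lt_trans x1b) ?(lt_le_trans _ x2a).
have zy : y1 < complex.Im z < y2 by rewrite -/Y (le_lt_trans y1b) ?(lt_le_trans _ y2a).
have {}CF := CF zx zy f2d.
have gE u v : x1 <= u <= x2 -> y1 <= v <= y2 -> normc (f (u +i* v) ^+ 2) = G (u, v).
  move=> /andP[u1 u2] /andP[v1 v2]; rewrite normcX fG//; rewrite ler_distl.
    by rewrite (le_trans x1a u1) (le_trans u2 x2b).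
  by rewrite (le_trans y1a v1) (le_trans v2 y2b).
have wr u v : rho / 2 <= `|u - X| \/ rho / 2 <= `|v - Y| -> normc (u +i* v - z)^-1 <= 2 / rho.
  move=> h; rewrite normcV -[2 / rho]invrK lef_pV2 ?posrE ?invr_gt0 ?divr_gt0//.
    rewrite invf_div; case: h => h; apply: le_trans h _.
      by apply: le_trans (ler_Re_normc _); rewrite ReD ReN.
    by apply: le_trans (ler_Im_normc _); rewrite ImD ImN.
  apply: lt_le_trans (_ : rho / 2 <= _); first by rewrite divr_gt0.
  case: h => h; apply: le_trans h _.
    by apply: le_trans (ler_Re_normc _); rewrite ReD ReN.
  by apply: le_trans (ler_Im_normc _); rewrite ImD ImN.
have contF u v : x1 <= u <= x2 -> y1 <= v <= y2 -> (rho / 2 <= `|u - X| \/ rho / 2 <= `|v - Y|) ->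
    ccont (fun z' => f z' ^+ 2 * (z' - z)^-1) (u +i* v).
  move=> uP vP uv; apply: cderivable_ccont; have [l fl] := f2d u v uP vP.
  have nz : u +i* v - z != 0.
    rewrite -normc_gt0; apply: lt_le_trans (_ : rho / 2 <= _); first by rewrite divr_gt0.
    case: uv => h; apply: le_trans h _.
      by apply: le_trans (ler_Re_normc _); rewrite ReD ReN.
    by apply: le_trans (ler_Im_normc _); rewrite ImD ImN.
  have [m im] := cderivable_inv nz.
  by exists (l * (u +i* v - z)^-1 + f (u +i* v) ^+ 2 * m); apply: cderM => //; exact: cder_shift im.
pose c := 2 * i / rho + d.
have x12 : x1 <= x2 by case/andP: zx => /lt_trans h /h /ltW.
have y12 : y1 <= y2 by case/andP: zy => /lt_trans h /h /ltW.
have r20 : 0 < 2 / rho by rewrite divr_gt0.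
have mx y : measurable_fun setT (fun x : mR => G (x, y)) by exact: measurableT_comp.
have my x : measurable_fun setT (fun y : mR => G (x, y)) by exact: measurableT_comp.
have hor y : y1 <= y <= y2 -> (y <= Y - rho / 2 \/ Y + rho / 2 <= y) -> (B y <= c%:E)%E ->
    normc (cint `[x1, x2] (fun x => f (x +i* y) ^+ 2 * (x +i* y - z)^-1)) <= 2 * (2 / rho) * c.
  move=> yP yY By; apply: (@cint_le_sq x1 x2 (2 / rho) (fun x => f (x +i* y) ^+ 2) (fun x => (x +i* y - z)^-1) (fun x => G (x, y))) => //.
  - by move=> x xP; apply: (@ccont_h _ (fun z' => f z' ^+ 2 * (z' - z)^-1)); apply: contF => //; right; exact: far.
  - by move=> x xP; exact: gE.
  - by move=> x xP; apply: wr; right; exact: far.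
  apply: le_trans By; apply: ge0_subset_integral => //=.
  - exact/measurable_EFinP/measurable_funTS.
  - by move=> x _; rewrite lee_fin.
  - by apply: subset_itv; rewrite bnd_simp.
have ver x : x1 <= x <= x2 -> (x <= X - rho / 2 \/ X + rho / 2 <= x) -> (V x <= c%:E)%E ->
    normc (cint `[y1, y2] (fun y => f (x +i* y) ^+ 2 * (x +i* y - z)^-1)) <= 2 * (2 / rho) * c.
  move=> xP xX Vx; apply: (@cint_le_sq y1 y2 (2 / rho) (fun y => f (x +i* y) ^+ 2) (fun y => (x +i* y - z)^-1) (fun y => G (x, y))) => //.
  - by move=> y yP; apply: (@ccont_v _ (fun z' => f z' ^+ 2 * (z' - z)^-1)); apply: contF => //; left; exact: far.
  - by move=> y yP; exact: gE.
  - by move=> y yP; apply: wr; left; exact: far.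
  apply: le_trans Vx; apply: ge0_subset_integral => //=.
  - exact/measurable_EFinP/measurable_funTS.
  - by move=> y _; rewrite lee_fin.
  - by apply: subset_itv; rewrite bnd_simp.
have h1 := hor y1; have h2 := hor y2; have v1 := ver x1; have v2 := ver x2.
rewrite lexx y12 in h1; rewrite lexx y12 in h2; rewrite lexx x12 in v1; rewrite lexx x12 in v2.
have {}h1 := h1 isT (or_introl y1b) y1B; have {}h2 := h2 isT (or_intror y2a) y2B.
have {}v1 := v1 isT (or_introl x1b) x1B; have {}v2 := v2 isT (or_intror x2a) x2B.
have N : normc (f z ^+ 2 * wind R) <= 4 * (2 * (2 / rho) * c).
  rewrite -CF /rint; have i1 : normc ('i : C) = 1 by rewrite /= expr0n/= add0r expr1n sqrtr1.
  apply: le_trans (ler_normcD _ _) _; rewrite normcM i1 mul1r.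
  apply: le_trans (lerD (ler_normcB _ _) (ler_normcB _ _)) _.
  exact: sum4 h1 h2 v2 v1.
rewrite normcM normcX -ler_pdivlMr// in N.
apply: le_trans N _.
rewrite le_eqVlt; apply/orP; left; apply/eqP.
by rewrite /c /d; field; rewrite ?gt_eqF.
Qed.

End area_integrals.

(** * Integrals on horizontal lines *)

Section power_integral.
Variable R : realType.
Local Notation leb := (@lebesgue_measure R).
Local Notation mR := (measurableTypeR R).

Lemma measurable_powRE (a : R) (D : set mR) : measurable_fun D (fun y : mR => (y `^ a)%:E).
Proof. by apply/measurable_EFinP; apply: measurable_funTS; exact: measurable_powR. Qed.

(** For [al < 0] the integrand is unbounded at 0, so the fundamental theorem of calculus is used on
    [[b / n.+1, b]] and monotone convergence does the rest. *)
Lemma integral_powR_near0 (al b : R) : -1 < al -> 0 < b ->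
  (\int[leb]_(y in `]0%R, b]) (y `^ al)%:E <= (b `^ (al + 1) / (al + 1))%:E)%E.
Proof.
move=> al1 b0; have a0 : 0 < al + 1 by lra.
pose F n : set mR := [set` `[b / n.+1%:R, b]].
have FU : \bigcup_n F n = [set` `]0%R, b]].
  apply/seteqP; split=> x /=.
    move=> [n _]; rewrite /F/= !in_itv/= => /andP[h ->]; rewrite andbT.
    by apply: lt_le_trans h; rewrite divr_gt0.
  rewrite in_itv/= => /andP[x0 xb]; exists (Num.truncn (b / x)) => //.
  rewrite /F/= in_itv/= xb andbT ler_pdivrMr// mulrC -ler_pdivrMr//.
  exact: ltW (truncnS_gt _).
have nd : nondecreasing_seq F.
  move=> m n mn; rewrite subsetEset; apply: subset_itv; rewrite ?bnd_simp//.
  by rewrite ler_wpM2l ?(ltW b0)// lef_pV2 ?posrE// ler_nat.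
have mF i : measurable (F i) by exact: measurable_itv.
have mf i : measurable_fun (F i) (fun y : mR => (y `^ al)%:E) by exact: measurable_powRE.
have f0 i (x : mR) : F i x -> (0 <= (x `^ al)%:E)%E by rewrite lee_fin powR_ge0.
have := ge0_nondecreasing_set_cvg_integral (mu := leb) nd mF mf f0.
rewrite FU => /cvg_lim <-//; apply: lime_le.
  apply: ereal_nondecreasing_is_cvgn.
  exact: ge0_nondecreasing_set_nondecreasing_integral.
near=> n; rewrite /F.
have n0 : (0 < n)%N by near: n; exact: nbhs_infty_gt.
have bn0 : 0 < b / n.+1%:R by rewrite divr_gt0.
have bn : b / n.+1%:R < b by rewrite ltr_pdivrMr// ltr_pMr// ltr1n.
have pos x : x \in `[b / n.+1%:R, b] -> 0 < x.
  by rewrite in_itv/= => /andP[h _]; apply: lt_le_trans h.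
have cpow c x : 0 < x -> {for x, continuous (fun y : R => y `^ c)}.
  move=> x0; apply: differentiable_continuous; apply/derivable1_diffP.
  by apply: derivable_powR; rewrite in_itv/= x0.
have dF (x : R) : 0 < x -> is_derive x (1 : R) (fun y : R => (al + 1)^-1 *: (y `^ (al + 1))) (x `^ al).
  move=> x0; have := is_deriveZ (f := fun y : R => y `^ (al + 1)) (al + 1)^-1 (is_derive1_powR (al + 1) x0).
  by rewrite addrK /GRing.scale/= mulKf ?gt_eqF.
rewrite (@continuous_FTC2 R _ (fun y => (al + 1)^-1 *: (y `^ (al + 1))))//.
- rewrite -EFinB lee_fin /GRing.scale/= mulrC lerBlDr lerDl mulr_ge0 ?powR_ge0//.
  by rewrite invr_ge0 ltW.
- by apply: continuous_in_subspaceT => x /set_mem/=/pos; exact: cpow.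
- split.
  + move=> x; rewrite in_itv/= => /andP[h _]; apply: ex_derive.
    by apply: dF; apply: lt_trans h.
  + apply: cvg_at_right_filter; apply: cvgZr; exact: cpow.
  + apply: cvg_at_left_filter; apply: cvgZr; exact: cpow.
- move=> x; rewrite in_itv/= => /andP[h _]; rewrite derive1E.
  by have [_ ->] := dF x (lt_trans bn0 h).
Unshelve. all: end_near. Qed.

(** The two comparisons of [x] and [y] serve the two signs of [a]: for [a < 0] the inequality is the
    one for [- a] with [x] and [y] exchanged. *)
Lemma powR_ratio (a x y : R) : 0 < x -> 0 < y -> x <= 2 * y -> y <= 2 * x ->
  x `^ a <= 2 `^ `|a| * y `^ a.
Proof.
move=> x0 y0 xy yx.
have [a0|a0] := leP 0 a.
  rewrite ger0_norm// -powRM ?(ltW y0)//.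
  by apply: ge0_ler_powR; rewrite ?nnegrE ?mulr_ge0 ?(ltW x0) ?(ltW y0).
have [c c0 ->] : exists2 c, 0 <= c & a = - c.
  by exists (- a); rewrite ?oppr_ge0 ?(ltW a0) ?opprK.
rewrite normrN ger0_norm// !powRN.
rewrite -[leLHS]mul1r ler_pdivrMr ?powR_gt0// mulrAC ler_pdivlMr ?powR_gt0// mul1r.
rewrite -powRM ?(ltW x0)//.
by apply: ge0_ler_powR; rewrite ?nnegrE ?mulr_ge0 ?(ltW x0) ?(ltW y0).
Qed.

End power_integral.

(** * The squared norm as a functional of the integrals on lines *)

Section energy.
Variable R : realType.
Local Notation leb := (@lebesgue_measure R).
Local Notation mR := (measurableTypeR R).
Implicit Types (M : mR -> \bar R) (k : hspace_kind R).

(* For M y = int |F(x + i y)|^2 dx this is the square of the norm of F. *)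
Definition energy k M : \bar R :=
  match k with
  | Hardy => ereal_sup [set M y | y in [set y : R | (0 < y)%R]]
  | Bergman al _ => \int[leb]_(y in `]0%R, +oo[) (M y * (y `^ al)%:E)
  end%E.

Let mitv (i : interval R) : measurable ([set` i] : set mR).
Proof. exact: measurable_itv. Qed.

Let mMp M al (D : set mR) : measurable_fun setT M ->
  measurable_fun D (fun y => M y * (y `^ al)%:E)%E.
Proof.
by move=> mM; apply: emeasurable_funM; [exact: measurable_funTS|exact: measurable_powRE].
Qed.

Let Mp0 M al y : (forall y, 0 <= M y)%E -> (0 <= M y * (y `^ al)%:E)%E.
Proof. by move=> M0; rewrite mule_ge0// lee_fin powR_ge0. Qed.

Lemma energy_ge0 k M : (forall y, 0 <= M y)%E -> (0 <= energy k M)%E.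
Proof.
move=> M0; case: k => [|al _] /=; last by apply: integral_ge0 => y _; exact: Mp0.
by apply: (@le_trans _ _ (M 1)) => //; apply: ereal_sup_ubound; exists 1 => /=.
Qed.

Lemma energy_le k M M' (c : R) : 0 <= c ->
  measurable_fun setT M -> measurable_fun setT M' ->
  (forall y, 0 <= M y)%E -> (forall y, 0 <= M' y)%E ->
  (forall y, 0 < y -> (M y <= c%:E * M' y)%E) ->
  (energy k M <= c%:E * energy k M')%E.
Proof.
move=> c0 mM mM' M0 M'0 MM'; case: k => [|al al1] /=.
  apply: ge_ereal_sup => _ [y /= y0 <-]; apply: le_trans (MM' y y0) _.
  by rewrite lee_wpmul2l ?lee_fin//; apply: ereal_sup_ubound; exists y.
rewrite -ge0_integralZl//; last 2 first.
- exact: mMp.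
- by move=> y _; exact: Mp0.
apply: ge0_le_integral => //.
- by move=> y _; exact: Mp0.
- exact: mMp.
- by apply: emeasurable_funM => //; exact: mMp.
move=> y; rewrite /= in_itv/= andbT => y0.
by rewrite muleA lee_wpmul2r ?lee_fin ?powR_ge0// MM'.
Qed.

(* the consequence of subharmonicity of |F|^2 that is needed *)
Definition submean (K0 : R) M := forall y : R, 0 < y ->
  (M y <= (K0 / y)%:E * \int[leb]_(t in `[(y / 2)%R, (3 / 2 * y)%R]) M t)%E.

(** The factor by which the energy controls a single line. In the Bergman case it comes from
    [submean]: on [[y / 2, 3 y / 2]] the weight [t ^ al] is comparable to [y ^ al] up to [2 ^ |al|].
    It is decreasing because [al > -1]. *)
Definition line_bound k (K0 : R) (y : R) : R :=
  match k with
  | Hardy => 1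
  | Bergman al _ => K0 * 2 `^ `|al| * y `^ (- 1 - al)
  end.

Lemma line_bound_ge0 k K0 y : 0 <= K0 -> 0 <= line_bound k K0 y.
Proof. by case: k => [|al al1] K00 //=; rewrite !mulr_ge0 ?powR_ge0. Qed.

Lemma line_bound_decr k K0 (y y' : R) : 0 <= K0 -> 0 < y -> y <= y' ->
  line_bound k K0 y' <= line_bound k K0 y.
Proof.
case: k => [|al al1] K00 y0 yy //=; rewrite ler_wpM2l ?mulr_ge0 ?powR_ge0//.
have c0 : 0 <= al + 1 by lra.
rewrite (_ : -1 - al = - (al + 1)); last ring.
rewrite !powRN lef_pV2 ?posrE ?powR_gt0//; last exact: lt_le_trans yy.
by apply: ge0_ler_powR; rewrite ?nnegrE ?(ltW y0)// (le_trans (ltW y0)).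
Qed.

Lemma line_le_energy k M K0 y : 0 <= K0 -> measurable_fun setT M ->
  (forall y, 0 <= M y)%E -> submean K0 M -> 0 < y ->
  (M y <= (line_bound k K0 y)%:E * energy k M)%E.
Proof.
move=> K00 mM M0 sM y0; case: k => [|al al1] /=.
  by rewrite mul1e; apply: ereal_sup_ubound; exists y.
apply: (le_trans (sM y y0)).
rewrite (_ : K0 * _ * _ = K0 / y * (2 `^ `|al| * y `^ (- al))); last first.
  rewrite (_ : -1 - al = - al + - 1); last ring.
  rewrite powRD; last by rewrite (gt_eqF y0) implybT.
  by rewrite powR_inv1 ?(ltW y0)//; ring.
rewrite (EFinM (K0 / y)) -muleA lee_wpmul2l ?lee_fin ?divr_ge0 ?(ltW y0)//.
rewrite -ge0_integralZl//; last 3 first.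
- exact: mMp.
- by move=> t _; exact: Mp0.
- by rewrite lee_fin mulr_ge0 ?powR_ge0.
apply: (@le_trans _ _ (\int[leb]_(t in `[(y / 2)%R, (3 / 2 * y)%R])
    ((2 `^ `|al| * y `^ (- al))%:E * (M t * (t `^ al)%:E)))%E); last first.
  apply: ge0_subset_integral => //.
  - by apply: emeasurable_funM => //; exact: mMp.
  - by move=> t _; rewrite mule_ge0 ?Mp0// lee_fin mulr_ge0 ?powR_ge0.
  - by move=> t /=; rewrite !in_itv/= => /andP[h _]; rewrite andbT; lra.
apply: ge0_le_integral => //.
- exact: measurable_funTS.
- by apply: emeasurable_funM => //; exact: mMp.
move=> t; rewrite /= in_itv/= => /andP[t1 t2].
rewrite muleC -muleA -EFinM -[leLHS]mule1 lee_wpmul2l// lee_fin.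
have t0 : 0 < t by lra.
have := @powR_ratio R (- al) t y t0 y0; rewrite normrN => h.
have h1 : t <= 2 * y by lra. have h2 : y <= 2 * t by lra.
have {h h1 h2} := h h1 h2; rewrite powRN => h.
by rewrite mulrC -ler_pdivrMr ?powR_gt0// mul1r.
Qed.

(** The point is that [K] does not depend on [B]. For [y > B] the weights at [y] and [B + y] are
    comparable. For [y <= B] the line at height [B + y] is bounded by the energy times a multiple of
    [B ^ (-1 - al)], which cancels against the integral of the weight over []0, B]], a multiple of
    [B ^ (al + 1)]. *)
Lemma energy_shift k (K0 : R) : 0 <= K0 -> exists2 K : R, 0 <= K & forall M B,
  measurable_fun setT M -> (forall y, 0 <= M y)%E -> submean K0 M -> 0 <= B ->
  (energy k (fun y => M (B + y)%R) <= K%:E * energy k M)%E.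
Proof.
move=> K00; case: k => [|al al1] /=.
  exists 1 => // M B mM M0 sM B0; rewrite mul1e.
  apply: ge_ereal_sup => _ [y /= y0 <-]; apply: ereal_sup_ubound.
  by exists (B + y) => //=; rewrite ltr_wpDl.
have a0 : 0 < al + 1 by lra.
pose c := 2 `^ `|al|.
have c1 : 1 <= c by rewrite /c -[leLHS](powRr0 2) ler_powR// ler1n.
(* The first summand bounds the part [y <= B], the second one the part [y > B]. *)
pose K := K0 * c / (al + 1) + c.
have K0' : 0 <= K0 * c / (al + 1) by rewrite !mulr_ge0// ?invr_ge0; lra.
exists K => [|M B mM M0 sM]; first by rewrite /K; lra.
rewrite le_eqVlt => /predU1P[<-|B0].
  under eq_integral do rewrite add0r.
  set E := integral _ _ _; have E0 : (0 <= E)%E by apply: integral_ge0 => t _; exact: Mp0.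
  by rewrite -[leLHS]mul1e lee_wpmul2r// lee_fin /K; lra.
set E := (X in (_ <= _ * X)%E).
have E0 : (0 <= E)%E by apply: integral_ge0 => t _; exact: Mp0.
have mMB : measurable_fun setT (fun y : mR => M (B + y)%R).
  by apply: measurableT_comp => //; exact: measurable_funD.
have U : [set` `]0%R, +oo[] = [set` `]0%R, B]] `|` [set` `]B, +oo[] :> set mR.
  apply/seteqP; split=> t /=; rewrite !in_itv/= ?andbT.
    by move=> t0; have [tB|tB] := leP t B; [left|right]; rewrite ?t0.
  by case=> [/andP[//]|]; apply: lt_trans.
rewrite U ge0_integral_setU//; last 3 first.
- exact: mMp.
- by move=> t _; exact: (@Mp0 (fun y => M (B + y)%R) al t (fun y => M0 _)).
- by apply/disj_setPS => t /= []; rewrite !in_itv/= andbT => /andP[_ h1] h2; lra.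
rewrite /K EFinD ge0_muleDl ?lee_fin//; last by lra.
apply: leeD.
  have := @line_le_energy (Bergman al1) M K0 _ K00 mM M0 sM; rewrite -/E => lb.
  pose c2 := K0 * c * B `^ (- 1 - al).
  have c20 : 0 <= c2 by rewrite /c2 !mulr_ge0 ?powR_ge0.
  apply: (@le_trans _ _ (\int[leb]_(y in `]0%R, B]) (c2%:E * E * (y `^ al)%:E))%E).
    apply: ge0_le_integral => //.
    - by move=> t _; exact: (@Mp0 (fun y => M (B + y)%R) al t (fun y => M0 _)).
    - exact: mMp.
    - by apply: emeasurable_funM => //; exact: measurable_powRE.
    move=> t; rewrite /= in_itv/= => /andP[t0 tB].
    rewrite lee_wpmul2r ?lee_fin ?powR_ge0//.
    have Bt : 0 < B + t by rewrite addr_gt0.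
    apply: le_trans (lb _ Bt) _; rewrite lee_wpmul2r// lee_fin.
    by apply: (@line_bound_decr (Bergman al1)) => //; rewrite lerDl ltW.
  rewrite ge0_integralZl//; last 3 first.
  - exact: measurable_powRE.
  - by move=> t _; rewrite lee_fin powR_ge0.
  - by rewrite mule_ge0// lee_fin.
  apply: (@le_trans _ _ (c2%:E * E * (B `^ (al + 1) / (al + 1))%:E)%E).
    by rewrite lee_wpmul2l ?mule_ge0 ?lee_fin// integral_powR_near0.
  rewrite -muleA [(E * _)%E]muleC muleA -EFinM lee_wpmul2r// lee_fin.
  rewrite le_eqVlt; apply/orP; left; apply/eqP; rewrite /c2.
  have -> : B `^ (al + 1) = (B `^ (-1 - al))^-1 by rewrite -powRN; congr (_ `^ _); ring.
  by field; rewrite ?gt_eqF ?powR_gt0.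
rewrite -ge0_integralZl//; last 3 first.
- exact: mMp.
- by move=> t _; exact: Mp0.
- by rewrite lee_fin; lra.
have mcM : measurable_fun setT (fun y => c%:E * (M y * (y `^ al)%:E))%E.
  by apply: emeasurable_funM => //; exact: mMp.
have cM0 y : (0 <= c%:E * (M y * (y `^ al)%:E))%E.
  by rewrite mule_ge0 ?Mp0// lee_fin; lra.
apply: (@le_trans _ _ (\int[leb]_(y in `[(2 * B)%R, +oo[) (c%:E * (M y * (y `^ al)%:E)))%E); last first.
  apply: ge0_subset_integral => //; first exact: measurable_funTS.
  by move=> t /=; rewrite !in_itv/= !andbT; lra.
rewrite -(ge0_integral_shift B (mitv _) (measurable_funTS mcM) (fun x _ => cM0 x)).
have -> : +%R B @^-1` [set` `[(2 * B)%R, +oo[] = [set` `[B, +oo[] :> set mR.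
  by apply/seteqP; split=> t /=; rewrite !in_itv/= !andbT; lra.
apply: (@le_trans _ _ (\int[leb]_(y in `[B, +oo[) (M (B + y)%R * (y `^ al)%:E))%E).
  apply: ge0_subset_integral => //.
  - exact: mMp.
  - by move=> t _; exact: (@Mp0 (fun y => M (B + y)%R) al t (fun y => M0 _)).
  - by apply: subset_itv; rewrite ?bnd_simp.
apply: ge0_le_integral => //.
- by move=> t _; exact: (@Mp0 (fun y => M (B + y)%R) al t (fun y => M0 _)).
- exact: mMp.
- apply: measurable_funTS; apply: (measurableT_comp mcM); exact: measurable_funD.
move=> t; rewrite /= in_itv/= andbT => Bt.
rewrite muleCA lee_wpmul2l// -EFinM lee_fin.
by apply: powR_ratio; lra.
Qed.

Lemma limn_einfZ (u : nat -> \bar R) (c : R) : 0 < c ->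
  (limn_einf u * c%:E <= limn_einf (fun n => u n * c%:E))%E.
Proof.
move=> c0; rewrite !limn_einf_lim.
have cu : cvgn (einfs u) by exact: is_cvg_einfs.
have h : (einfs u n * c%:E)%E @[n --> \oo] --> (limn (einfs u) * c%:E)%E.
  exact: cvgeZr.
rewrite -(cvg_lim _ h)//; apply: lee_lim.
- by apply/cvg_ex; exists (limn (einfs u) * c%:E)%E.
- exact: is_cvg_einfs.
apply: nearW => n; apply: le_ereal_inf_tmp => _ [m /= nm <-].
rewrite lee_wpmul2r ?lee_fin ?(ltW c0)//.
by apply: ereal_inf_lbound; exists m.
Qed.

Lemma energy_fatou k M (Mn : nat -> mR -> \bar R) (A : R) :
  measurable_fun setT M -> (forall n, measurable_fun setT (Mn n)) ->
  (forall y, 0 <= M y)%E -> (forall n y, 0 <= Mn n y)%E ->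
  (forall y : R, 0 < y -> (M y <= limn_einf (fun n => Mn n y))%E) ->
  (forall n, energy k (Mn n) <= A%:E)%E -> (energy k M <= A%:E)%E.
Proof.
move=> mM mMn M0 Mn0 Mle.
have einf_le (u : nat -> \bar R) : (forall n, u n <= A%:E)%E -> (limn_einf u <= A%:E)%E.
  move=> uA; apply: (@le_trans _ _ (limn_esup u)); first exact: limn_einf_sup.
  rewrite limn_esup_lim; apply: lime_le; first exact: is_cvg_esups.
  by apply: nearW => n; apply: ge_ereal_sup => _ [m _ <-].
case: k => [|al al1] /= eA.
  apply: ge_ereal_sup => _ [y /= y0 <-]; apply: le_trans (Mle y y0) _.
  by apply: einf_le => n; apply: le_trans (eA n); apply: ereal_sup_ubound; exists y.
apply: (@le_trans _ _ (\int[leb]_(y in `]0%R, +oo[)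
    limn_einf (fun n => Mn n y * (y `^ al)%:E)))%E; last first.
  apply: (@le_trans _ _ (limn_einf (fun n => \int[leb]_(y in `]0%R, +oo[) (Mn n y * (y `^ al)%:E))%E)).
    apply: fatou => //; first by move=> n; exact: mMp.
    by move=> n y _; exact: Mp0.
  by apply: einf_le.
apply: ge0_le_integral => //.
- by move=> y _; exact: Mp0.
- exact: mMp.
- rewrite (_ : (fun x => _) = (fun x => - limn_esup (-%E \o (fun n => Mn n x * (x `^ al)%:E)))%E); last first.
    by apply/funext => x; rewrite limn_esupN oppeK.
  apply: measurableT_comp => //; apply: measurable_fun_limn_esup => n.
  by apply: measurableT_comp => //; exact: mMp.
move=> y; rewrite /= in_itv/= andbT => y0.
apply: le_trans (limn_einfZ _ (powR_gt0 al y0)).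
by rewrite lee_wpmul2r ?lee_fin ?powR_ge0// Mle.
Qed.

End energy.

Section function_energy.
Variable R : realType.
Local Notation leb := (@lebesgue_measure R).
Local Notation mR := (measurableTypeR R).
Local Notation C := R[i].
Implicit Types (F G : uhp R -> C^o) (k : hspace_kind R).

Lemma uhp_extE F (w : uhp R) : uhp_ext F (uval w) = F w.
Proof. by rewrite /uhp_ext valK. Qed.

Lemma uhp_ext_out F (z : C) : complex.Im z <= 0 -> uhp_ext F z = 0.
Proof. by move=> z0; rewrite /uhp_ext insubF//; apply/negbTE; rewrite -leNgt. Qed.

Lemma uhp_ext_in F (z : C) (z0 : 0 < complex.Im z) : uhp_ext F z = F (Uhp z0).
Proof. by rewrite -uhp_extE. Qed.

Lemma holomorphicE F : holomorphic F <->
  forall z : C, 0 < complex.Im z -> cderivable (uhp_ext F) z.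
Proof.
split=> [hF z z0|h w]; first by apply/cder_derivable; exact: (hF (Uhp z0)).
by apply/cder_derivable; apply: h; exact: uvalP.
Qed.

Lemma holomorphic_sq F (z : C) (rho : R) : holomorphic F ->
  rho < complex.Im z -> sqderiv (uhp_ext F) z rho.
Proof.
move=> /holomorphicE hF rz x y _; rewrite ler_distl => /andP[h _].
by apply: hF => /=; lra.
Qed.

(** Being 0 at heights [<= 0], it is measurable on the whole plane, and Tonelli's theorem applies to
    it without restriction to the half-plane. *)
Definition mod2 F (p : mR * mR) : R := normc (uhp_ext F (p.1 +i* p.2)) ^+ 2.

Lemma mod2_ge0 F p : 0 <= mod2 F p.
Proof. by rewrite exprn_ge0// normc_ge0. Qed.

Lemma mod2_out F x (y : R) : y <= 0 -> mod2 F (x, y) = 0.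
Proof. by move=> y0; rewrite /mod2 uhp_ext_out// normc0 expr0n. Qed.

Lemma measurable_mod2 F : holomorphic F -> measurable_fun setT (mod2 F).
Proof.
move=> hF; have mc := measurable_cmod hF.
have /(measurable_restrictT _ (@measurable_uhp R)).1 :
    measurable_fun [set p : R * R | 0 < p.2] (mod2 F).
  exact: (measurable_funX 2 mc).
apply: eq_measurable_fun => -[x y] _; rewrite /patch.
by case: ifPn => // /negP; rewrite inE /= => /negP; rewrite -leNgt => /mod2_out ->.
Qed.

Definition line F (y : mR) : \bar R := (\int[leb]_x (mod2 F (x, y))%:E)%E.

Lemma line_ge0 F y : (0 <= line F y)%E.
Proof. by apply: integral_ge0 => x _; rewrite lee_fin mod2_ge0. Qed.

Lemma measurable_line F : holomorphic F -> measurable_fun setT (line F).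
Proof.
move=> hF.
have mE : measurable_fun setT (EFin \o mod2 F) by apply/measurable_EFinP; exact: measurable_mod2.
by have := @measurable_int_x R _ mE (fun p => mod2_ge0 F p) setT measurableT.
Qed.

Lemma bergman_energy F al : holomorphic F ->
  (\int[leb \x leb]_(p in [set p : R * R | (0 < p.2)%R])
    (normc (uhp_ext F (p.1 +i* p.2)) ^+ 2 * p.2 `^ al)%:E)%E =
  (\int[leb]_(y in `]0%R, +oo[) (line F y * (y `^ al)%:E))%E.
Proof.
move=> hF; rewrite [LHS]integral_mkcond.
have mg : measurable_fun setT (fun p : mR * mR => (mod2 F p * p.2 `^ al)%:E).
  apply/measurable_EFinP; apply: measurable_funM; first exact: measurable_mod2.
  exact: (measurableT_comp (measurable_powR al) measurable_snd).
have g0 p : (0 <= (mod2 F p * p.2 `^ al)%:E)%E by rewrite lee_fin mulr_ge0 ?mod2_ge0 ?powR_ge0.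
transitivity (\int[leb \x leb]_p (mod2 F p * p.2 `^ al)%:E)%E.
  apply: eq_integral => -[x y] _; rewrite /patch.
  case: ifPn => // /negP; rewrite inE /= => /negP; rewrite -leNgt => y0.
  by rewrite mod2_out// mul0r.
rewrite (fubini_tonelli2 _ mg g0) [RHS]integral_mkcond; apply: eq_integral => y _.
rewrite /fubini_G /patch.
have my : measurable_fun setT (fun x : mR => (mod2 F (x, y))%:E).
  by apply/measurable_EFinP; apply: measurableT_comp; [exact: measurable_mod2|exact: pair2_measurable].
case: ifPn => [_|].
  rewrite muleC -ge0_integralZl//; last 2 first.
  - by move=> x _; rewrite lee_fin mod2_ge0.
  - by rewrite lee_fin powR_ge0.
  by apply: eq_integral => x _; rewrite /= -EFinM mulrC.
move=> /negP; rewrite inE/= in_itv/= andbT => /negP; rewrite -leNgt => y0.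
by rewrite integral0_eq// => x _; rewrite mod2_out// mul0r.
Qed.

(** The Bergman case is Tonelli's theorem. In the Hardy case the root is taken out of the supremum
    by monotonicity of the square root in one direction and of the square in the other. *)
Lemma hspace_normE k F : holomorphic F ->
  hspace_norm k F = (energy k (line F) `^ 2^-1)%E.
Proof.
move=> hF; case: k => [|al al1] /=; last by rewrite /bergman_norm bergman_energy.
rewrite /hardy_norm; apply/eqP; rewrite eq_le; apply/andP; split.
  apply: ge_ereal_sup => _ [y /= y0 <-].
  apply: gt0_ler_poweR => //; rewrite ?in_itv/= ?leey ?andbT.
  - exact: line_ge0.
  - by apply: (@energy_ge0 _ (@Hardy R)); exact: line_ge0.
  by apply: ereal_sup_ubound; exists y.
set s := (X in (_ <= X)%E).
have s0 : (0 <= s)%E.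
  by rewrite /s; apply: (le_trans (poweR_ge0 (line F 1) 2^-1)); apply: ereal_sup_ubound; exists 1 => /=.
have pw (x : \bar R) : (0 <= x)%E -> ((x `^ 2) `^ 2^-1 = x)%E.
  by move=> x0; rewrite -poweRrM mulfV// poweRe1.
rewrite -[leRHS](pw _ s0); apply: gt0_ler_poweR => //; rewrite ?in_itv/= ?leey ?andbT.
- by apply: (@energy_ge0 _ (@Hardy R)); exact: line_ge0.
- exact: poweR_ge0.
apply: ge_ereal_sup => _ [y /= y0 <-].
rewrite (_ : line F y = ((line F y `^ 2^-1) `^ 2)%E); last first.
  by rewrite -poweRrM mulVf// poweRe1// line_ge0.
apply: gt0_ler_poweR => //; rewrite ?in_itv/= ?leey ?andbT ?poweR_ge0//.
by apply: ereal_sup_ubound; exists y.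
Qed.

Lemma energy_le_hspace_norm k F (A : R) : holomorphic F -> 0 <= A ->
  (hspace_norm k F <= A%:E)%E <-> (energy k (line F) <= (A ^+ 2)%:E)%E.
Proof.
move=> hF A0; rewrite hspace_normE//.
have e0 H : (0 <= energy k (line H))%E by apply: energy_ge0; exact: line_ge0.
have AE : A%:E = ((A ^+ 2)%:E `^ 2^-1)%E.
  by rewrite poweR_EFin -powR_mulrn// -powRrM mulfV// powRr1.
split=> h; last first.
  rewrite AE; apply: gt0_ler_poweR => //; rewrite ?in_itv/= ?leey ?andbT//.
  by rewrite lee_fin exprn_ge0.
rewrite -[leLHS](@poweRe1 _ (energy k (line F)))// -(@mulVf _ 2)// poweRrM.
apply: (@le_trans _ _ (A%:E `^ 2)%E).
  by apply: gt0_ler_poweR => //; rewrite ?in_itv/= ?leey ?andbT ?poweR_ge0 ?lee_fin.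
by rewrite poweR_EFin powR_mulrn.
Qed.

(** [mean_inequality] with [rho = y / 2] has the constant [128 / normc (wind R) / y ^+ 2], and
    integration over abscissas within [y / 2] multiplies it by [y]. *)
Definition submean_cst : R := 128 / normc (wind R).

Lemma submean_cst_ge0 : 0 <= submean_cst.
Proof. by rewrite /submean_cst !mulr_ge0 ?invr_ge0 ?normc_ge0. Qed.

Let mean_rect F (x y : R) : holomorphic F -> 0 < y ->
  ((mod2 F (x, y))%:E <= (32 / normc (wind R) / (y / 2) ^+ 2)%:E *
    \int[leb]_(t in `[(y / 2)%R, (3 / 2 * y)%R])
    \int[leb]_(s in `[(x - y / 2)%R, (x + y / 2)%R]) (mod2 F (s, t))%:E)%E.
Proof.
move=> hF y0; have y2 : 0 < y / 2 by rewrite divr_gt0.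
have := @mean_inequality R (uhp_ext F) (x +i* y) (y / 2) (mod2 F) y2 _
  (measurable_mod2 hF) (mod2_ge0 F) (fun _ _ _ _ => erefl _).
have -> : complex.Im (x +i* y) - y / 2 = y / 2 by rewrite /=; field.
have -> : complex.Im (x +i* y) + y / 2 = 3 / 2 * y by rewrite /=; field.
by apply; apply: holomorphic_sq => //=; lra.
Qed.

(** [mean_rect] is integrated over all abscissas [x]. After the substitution [s = x + u] and
    Tonelli's theorem, the inner integral no longer depends on [u], which leaves a factor [y], the
    width of the rectangle. *)
Lemma submean_line F : holomorphic F -> submean submean_cst (line F).
Proof.
move=> hF y y0.
have y2 : 0 < y / 2 by rewrite divr_gt0.
pose c := 32 / normc (wind R) / (y / 2) ^+ 2.
have c0 : 0 <= c by rewrite /c !mulr_ge0 ?invr_ge0 ?normc_ge0 ?exprn_ge0// ltW.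
set J : set mR := [set` `[y / 2, 3 / 2 * y]].
set U : set mR := [set` `[- (y / 2), y / 2]].
have mJ : measurable J by exact: measurable_itv.
have mU : measurable U by exact: measurable_itv.
have mE : measurable_fun setT (EFin \o mod2 F) by apply/measurable_EFinP; exact: measurable_mod2.
have E0 p : (0 <= (EFin \o mod2 F) p)%E by rewrite lee_fin mod2_ge0.
pose V (s : mR) : \bar R := (\int[leb]_(t in J) (mod2 F (s, t))%:E)%E.
have V0 s : (0 <= V s)%E by apply: integral_ge0 => t _; exact: E0.
have mEs : measurable_fun setT ((EFin \o mod2 F) \o (fun p : mR * mR => (p.2, p.1))).
  by apply: measurableT_comp => //; apply: measurable_fun_pair; [exact: measurable_snd|exact: measurable_fst].
have mV : measurable_fun setT V.
  by have := @measurable_int_x R _ mEs (fun p => E0 _) J mJ.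
have mVp : measurable_fun setT (fun p : mR * mR => V (p.1 + p.2)).
  apply: measurableT_comp => //; apply: measurable_funD; [exact: measurable_fst|exact: measurable_snd].
have VU (x : R) : ((mod2 F (x, y))%:E <= c%:E * \int[leb]_(u in U) V (x + u)%R)%E.
  apply: le_trans (mean_rect x hF y0) _; rewrite lee_wpmul2l//.
  set I : set mR := [set` `[x - y / 2, x + y / 2]].
  have mI : measurable I by exact: measurable_itv.
  rewrite (tonelli_itv mE E0 mI mJ) -/V.
  rewrite -(ge0_integral_shift x mI (measurable_funTS mV) (fun t _ => V0 t)).
  rewrite (_ : +%R x @^-1` I = U)//.
  by apply/seteqP; split=> t; rewrite /I/U/= !in_itv/= => /andP[? ?]; apply/andP; split; lra.
have mW : measurable_fun setT (fun x : mR => \int[leb]_(u in U) V (x + u)%R)%E.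
  have mVs : measurable_fun setT (fun p : mR * mR => V (p.2 + p.1)).
    apply: measurableT_comp => //; apply: measurable_funD; [exact: measurable_snd|exact: measurable_fst].
  by have := @measurable_int_x R _ mVs (fun p => V0 _) U mU.
have my : measurable_fun setT (fun x : mR => (mod2 F (x, y))%:E).
  exact: (measurableT_comp mE (pair2_measurable y)).
apply: (@le_trans _ _ (\int[leb]_x (c%:E * \int[leb]_(u in U) V (x + u)%R))%E).
  apply: ge0_le_integral => //; first by move=> x _; exact: E0.
  by apply: emeasurable_funM.
rewrite ge0_integralZl//; last by move=> x _; apply: integral_ge0 => u _; exact: V0.
have := tonelli_itv mVp (fun p => V0 _) (I := setT) measurableT mU => /= <-.
rewrite (_ : (\int[leb]_(u in U) _)%E = (\int[leb]_(u in U) cst (\int[leb]_x V x) u)%E); last first.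
  apply: eq_integral => u _ /=.
  rewrite -[RHS](ge0_integral_shift u measurableT mV (fun t _ => V0 t)) preimage_setT.
  by apply: eq_integral => x _; rewrite addrC.
rewrite integral_cst//= lebesgue_measure_itv/= lte_fin.
have -> : - (y / 2) < y / 2 by lra.
rewrite -(tonelli_itv mE E0 (I := setT) measurableT mJ) -/(line F).
rewrite -EFinD muleCA -EFinM muleC.
rewrite (_ : submean_cst / y = c * (y / 2 - - (y / 2)))//.
by rewrite /c /submean_cst; field; rewrite (gt_eqF y0) normc_eq0 wind_neq0.
Qed.

(** The constant of [mean_rect] times the length [y] of [[y / 2, 3 y / 2]] is [submean_cst / y];
    every line in this range is bounded by the value of [line_bound] at its lower end. *)
Definition pt_bound k (y : R) : R := submean_cst / y * line_bound k submean_cst (y / 2).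

Lemma pt_bound_ge0 k y : 0 <= y -> 0 <= pt_bound k y.
Proof.
move=> y0; rewrite mulr_ge0 ?(divr_ge0 submean_cst_ge0)//.
exact/line_bound_ge0/submean_cst_ge0.
Qed.

Lemma pt_bound_decr k (y y' : R) : 0 < y -> y <= y' -> pt_bound k y' <= pt_bound k y.
Proof.
move=> y0 yy; have y'0 : 0 < y' by apply: lt_le_trans yy.
apply: ler_pM.
- by rewrite (divr_ge0 submean_cst_ge0)// ltW.
- exact/line_bound_ge0/submean_cst_ge0.
- by rewrite ler_wpM2l ?submean_cst_ge0// lef_pV2.
- by apply: line_bound_decr; rewrite ?submean_cst_ge0 ?divr_gt0// ler_pM2r.
Qed.

Lemma mod2_le_energy k F (x y : R) : holomorphic F -> 0 < y ->
  ((mod2 F (x, y))%:E <= (pt_bound k y)%:E * energy k (line F))%E.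
Proof.
move=> hF y0; apply: le_trans (mean_rect x hF y0) _.
have y2 : 0 < y / 2 by rewrite divr_gt0.
set c := 32 / normc (wind R) / (y / 2) ^+ 2.
have c0 : 0 <= c by rewrite /c !mulr_ge0 ?invr_ge0 ?normc_ge0 ?exprn_ge0// ltW.
have mE : measurable_fun setT (EFin \o mod2 F) by apply/measurable_EFinP; exact: measurable_mod2.
have E0 p : (0 <= (EFin \o mod2 F) p)%E by rewrite lee_fin mod2_ge0.
have K0 := submean_cst_ge0.
pose L := line_bound k submean_cst (y / 2).
have L0 : 0 <= L by exact: line_bound_ge0.
have e0 : (0 <= energy k (line F))%E by apply: energy_ge0; exact: line_ge0.
have -> : pt_bound k y = c * (y * L).
  by rewrite /pt_bound /c -/L /submean_cst; field; rewrite (gt_eqF y0) normc_eq0 wind_neq0.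
rewrite (EFinM c) -muleA lee_wpmul2l//.
apply: (@le_trans _ _ (\int[leb]_(t in `[(y / 2)%R, (3 / 2 * y)%R]) (cst (L%:E * energy k (line F)) t))%E).
  apply: ge0_le_integral => //.
  - by move=> t _; apply: integral_ge0 => s _; exact: E0.
  - apply: measurable_funTS; have := @measurable_int_x R _ mE E0 [set` `[x - y / 2, x + y / 2]].
    by apply; exact: measurable_itv.
  move=> t; rewrite /= in_itv/= => /andP[t1 t2].
  apply: (@le_trans _ _ (line F t)).
    apply: ge0_subset_integral => //.
      exact: (measurableT_comp mE (pair2_measurable t)).
    by move=> s _; exact: E0.
  have t0 : 0 < t by lra.
  apply: le_trans (line_le_energy k K0 (measurable_line hF) (line_ge0 F) (submean_line hF) t0) _.
  by rewrite lee_wpmul2r// lee_fin; apply: line_bound_decr.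
rewrite integral_cst//= lebesgue_measure_itv/= lte_fin.
have -> : y / 2 < 3 / 2 * y by lra.
rewrite -EFinB (_ : 3 / 2 * y - y / 2 = y); last by field.
by rewrite EFinM [(y%:E * _)%E]muleC -muleA [(energy _ _ * _)%E]muleC muleA.
Qed.

End function_energy.

(** * Point evaluations, translations and completeness *)

Section hspace_interface.
Variables (R : realType) (k : hspace_kind R).
Local Notation leb := (@lebesgue_measure R).
Local Notation mR := (measurableTypeR R).
Local Notation C := R[i].
Implicit Types (F G : uhp R -> C^o).

(** The real number behind the [R[i]]-valued norm. For a function of infinite norm it is 0 by the
    default of [fine], so it is informative on members of the space. *)
Definition nH F : R := fine (hspace_norm k F).

Lemma nH_ge0 F : 0 <= nH F.
Proof. by rewrite fine_ge0// hspace_norm_ge0. Qed.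

Lemma hspace_holomorphic (F : hspace k) : holomorphic F.
Proof. by have := hspaceP F; rewrite inE => -[]. Qed.
Arguments hspace_holomorphic F : clear implicits.

Lemma hspace_normEfin (F : hspace k) : hspace_norm k F = (nH F)%:E.
Proof.
have := hspaceP F; rewrite inE => -[_ Foo].
by rewrite fineK// ge0_fin_numE// hspace_norm_ge0.
Qed.

Lemma norm_hspace (F : hspace k) : `|F| = (nH F)%:C.
Proof. by []. Qed.

Lemma line_energy_ge0 F : (0 <= energy k (line F))%E.
Proof. by apply: energy_ge0; exact: line_ge0. Qed.

Lemma energy_hspace (F : hspace k) : (energy k (line F) <= ((nH F) ^+ 2)%:E)%E.
Proof.
apply/energy_le_hspace_norm; [exact: hspace_holomorphic|exact: nH_ge0|].
by rewrite hspace_normEfin.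
Qed.

Lemma hspace_of_energy G (A : R) : holomorphic G -> 0 <= A ->
  (energy k (line G) <= (A ^+ 2)%:E)%E ->
  exists2 G' : hspace k, (G' : uhp R -> C^o) = G & nH G' <= A.
Proof.
move=> hG A0 /(energy_le_hspace_norm k hG A0) h.
have Gin : G \in in_hspace k by rewrite inE; split => //; apply: le_lt_trans h _; rewrite ltry.
exists (HSpace Gin) => //; rewrite -lee_fin -hspace_normEfin//.
Qed.

Lemma hspace_dominated (F : hspace k) G (c : R) : holomorphic G -> 0 <= c ->
  (forall y : R, 0 < y -> (line G y <= (c ^+ 2)%:E * line F y)%E) ->
  exists2 G' : hspace k, (G' : uhp R -> C^o) = G & nH G' <= c * nH F.
Proof.
move=> hG c0 h; apply: hspace_of_energy => //; first by rewrite mulr_ge0// nH_ge0.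
have hF := hspace_holomorphic F.
apply: (@le_trans _ _ ((c ^+ 2)%:E * energy k (line F))%E).
  by apply: energy_le => //; rewrite ?exprn_ge0//; [exact: (measurable_line hG)|exact: (measurable_line hF)|exact: line_ge0|exact: line_ge0].
by rewrite exprMn (EFinM (c ^+ 2)) lee_wpmul2l ?lee_fin ?exprn_ge0// energy_hspace.
Qed.

Lemma hspace_pt_dominated (F : hspace k) G (c : R) : holomorphic G -> 0 <= c ->
  (forall w, normc (G w) <= c * normc (F w)) ->
  exists2 G' : hspace k, (G' : uhp R -> C^o) = G & nH G' <= c * nH F.
Proof.
move=> hG c0 h; apply: hspace_dominated => // y y0.
have m H : holomorphic H -> measurable_fun setT (fun x : mR => (mod2 H (x, y))%:E).
  move=> hH; apply/measurable_EFinP.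
  exact: (measurableT_comp (measurable_mod2 hH) (pair2_measurable y)).
have hF := hspace_holomorphic F.
rewrite /line -ge0_integralZl//; last 3 first.
- exact: (m _ hF).
- by move=> x _; rewrite lee_fin mod2_ge0.
- by rewrite lee_fin exprn_ge0.
apply: ge0_le_integral => //.
- by move=> x _; rewrite lee_fin mod2_ge0.
- exact: (m _ hG).
- by apply: emeasurable_funM => //; exact: (m _ hF).
move=> x _; rewrite -EFinM lee_fin /mod2 -exprMn.
rewrite lerXn2r ?nnegrE ?mulr_ge0 ?normc_ge0//=.
by rewrite !(@uhp_ext_in _ _ (x +i* y) y0).
Qed.

Lemma eval_bound (F : hspace k) (z : C) (y0 : R) : 0 < y0 -> y0 <= complex.Im z ->
  normc (uhp_ext F z) <= Num.sqrt (pt_bound k y0) * nH F.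
Proof.
move=> y00 yz; have z0 : 0 < complex.Im z by apply: lt_le_trans yz.
have pb := pt_bound_ge0 k (ltW y00).
rewrite -(@ler_pXn2r _ 2) ?nnegrE ?normc_ge0 ?mulr_ge0 ?sqrtr_ge0 ?nH_ge0//.
rewrite exprMn sqr_sqrtr// -lee_fin.
have := mod2_le_energy k (complex.Re z) (hspace_holomorphic F) z0.
rewrite /mod2 /= (_ : complex.Re z +i* complex.Im z = z); last by case: (z).
move=> /le_trans; apply; apply: (@le_trans _ _ ((pt_bound k y0)%:E * ((nH F) ^+ 2)%:E)%E); last by rewrite -EFinM.
apply: lee_pmul; rewrite ?lee_fin ?line_energy_ge0 ?energy_hspace//.
- exact/pt_bound_ge0/ltW.
- exact: pt_bound_decr.
Qed.

Lemma line_hspace (F : hspace k) (y0 y : R) : 0 < y0 -> y0 <= y ->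
  (line F y <= (line_bound k (submean_cst R) y0 * nH F ^+ 2)%:E)%E.
Proof.
move=> y00 yy; have hF := hspace_holomorphic F.
have K0 := submean_cst_ge0 R.
have y0' : 0 < y by apply: lt_le_trans yy.
apply: (le_trans (line_le_energy k K0 (measurable_line hF) (line_ge0 F) (submean_line hF) y0')).
rewrite EFinM; apply: lee_pmul; rewrite ?lee_fin ?line_energy_ge0 ?energy_hspace//.
- exact: line_bound_ge0.
- exact: line_bound_decr.
Qed.

Definition uhp_shift (v : C) F : uhp R -> C^o := fun w => uhp_ext F (uval w + v).

Lemma uhp_ext_shift v F (z : C) : 0 < complex.Im z ->
  uhp_ext (uhp_shift v F) z = uhp_ext F (z + v).
Proof. by move=> z0; rewrite (uhp_ext_in _ z0). Qed.

Lemma holomorphic_shift v F : 0 <= complex.Im v -> holomorphic F ->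
  holomorphic (uhp_shift v F).
Proof.
move=> v0 /holomorphicE hF; apply/holomorphicE => z z0.
have [l fl] : cderivable (uhp_ext F) (z + v) by apply: hF; rewrite ImD ltr_wpDr.
exists l; apply: cder_ext (cder_shift fl).
exists (complex.Im z) => // h hz; rewrite uhp_ext_shift//.
have := ler_Im_normc h; rewrite ler_norml ImD => /andP[? _]; lra.
Qed.

Lemma line_shift v F (y : R) : holomorphic F -> 0 < y -> 0 <= complex.Im v ->
  line (uhp_shift v F) y = line F (complex.Im v + y).
Proof.
move=> hF y0 v0.
have m : measurable_fun setT (fun x : mR => (mod2 F (x, complex.Im v + y))%:E).
  apply/measurable_EFinP.
  exact: (measurableT_comp (measurable_mod2 hF) (pair2_measurable _)).
rewrite /line -(ge0_integral_shift (complex.Re v) measurableT m) ?preimage_setT; last first.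
  by move=> x _; rewrite lee_fin mod2_ge0.
apply: eq_integral => x _; rewrite /mod2 uhp_ext_shift//=.
congr ((normc (uhp_ext F _) ^+ 2)%:E); case: v {v0 m} => a b /=.
by apply/eqP; rewrite eq_complex /= ![_ + x]addrC ![_ + y]addrC !eqxx.
Qed.

(** A single [K] serves all [v]; applied to multiples of [w0] it bounds all powers of the
    translation at once. *)
Lemma hspace_shift : exists2 K : R, 0 <= K & forall (v : C) (F : hspace k),
  0 <= complex.Im v ->
  exists2 G : hspace k, (G : uhp R -> C^o) = uhp_shift v F & nH G <= K * nH F.
Proof.
have [K K0 KP] := energy_shift k (submean_cst_ge0 R).
exists (Num.sqrt K); rewrite ?sqrtr_ge0// => v F v0.
have hF := hspace_holomorphic F.
have hS := holomorphic_shift v0 hF.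
apply: hspace_of_energy => //; first by rewrite mulr_ge0 ?sqrtr_ge0 ?nH_ge0.
have := KP (line F) (complex.Im v) (measurable_line hF) (line_ge0 F) (submean_line hF) v0.
rewrite exprMn sqr_sqrtr// EFinM => h.
apply: (@le_trans _ _ (K%:E * energy k (line F))%E); last first.
  by rewrite lee_wpmul2l ?lee_fin// energy_hspace.
apply: le_trans h; rewrite -[leRHS]mul1e; apply: energy_le => //.
- exact: (measurable_line hS).
- apply: (measurableT_comp (measurable_line hF)).
  exact: measurable_funD.
- exact: line_ge0.
- by move=> y; exact: line_ge0.
- by move=> y y0; rewrite mul1e line_shift.
Qed.

Lemma holomorphicB F G : holomorphic F -> holomorphic G -> holomorphic (F - G).
Proof.
move=> hF hG; have := @holomorphic_lincomb R (-1) G F hG hF.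
by rewrite scaleN1r addrC.
Qed.

Lemma line_fatou (Fn : nat -> uhp R -> C^o) F (y : R) : 0 < y -> holomorphic F ->
  (forall n, holomorphic (Fn n)) -> (forall w, ccvg (fun n => Fn n w) (F w)) ->
  (line F y <= limn_einf (fun n => line (Fn n) y))%E.
Proof.
move=> y0 hF hFn Fcv.
have m H : holomorphic H -> measurable_fun setT (fun x : mR => (mod2 H (x, y))%:E).
  move=> hH; apply/measurable_EFinP.
  exact: (measurableT_comp (measurable_mod2 hH) (pair2_measurable y)).
apply: (@le_trans _ _ (\int[leb]_x limn_einf (fun n => (mod2 (Fn n) (x, y))%:E))%E); last first.
  apply: (fatou leb measurableT (f := fun n x => (mod2 (Fn n) (x, y))%:E)).
    by move=> n; exact: (m _ (hFn n)).
  by move=> n x _; rewrite lee_fin mod2_ge0.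
rewrite le_eqVlt; apply/orP; left; apply/eqP; apply: eq_integral => x _.
have cv : mod2 (Fn n) (x, y) @[n --> \oo] --> mod2 F (x, y).
  suff cv1 : normc (uhp_ext (Fn n) (x +i* y)) @[n --> \oo] --> normc (uhp_ext F (x +i* y)).
    exact: (cvgM cv1 cv1).
  apply/cvgrPdist_le => e e0.
  have [N P] := Fcv (@Uhp R (x +i* y) y0) e e0.
  exists N => // n /= Nn; rewrite distrC; apply: le_trans (ler_dist_normc _ _) _.
  by rewrite !(@uhp_ext_in _ _ (x +i* y) y0) P.
have cvE : (mod2 (Fn n) (x, y))%:E @[n --> \oo] --> (mod2 F (x, y))%:E.
  by apply: cvg_EFin; [exact: nearW|exact: cv].
by have [-> _] := cvg_limn_einf_sup cvE.
Qed.

Lemma hspace_fatou (Fn : nat -> uhp R -> C^o) F (A : R) : 0 <= A -> holomorphic F ->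
  (forall n, holomorphic (Fn n)) -> (forall w, ccvg (fun n => Fn n w) (F w)) ->
  (forall n, energy k (line (Fn n)) <= (A ^+ 2)%:E)%E ->
  exists2 G : hspace k, (G : uhp R -> C^o) = F & nH G <= A.
Proof.
move=> A0 hF hFn Fcv eA; apply: hspace_of_energy => //.
apply: (energy_fatou (Mn := fun n => line (Fn n))) => //.
- exact: (measurable_line hF).
- by move=> n; exact: (measurable_line (hFn n)).
- exact: line_ge0.
- by move=> n y; exact: line_ge0.
- by move=> y y0; exact: line_fatou.
Qed.

(** Point evaluations are bounded, so a Cauchy sequence converges pointwise. It is bounded on a
    square around each point, so the limit is holomorphic by [cderivable_limit], and [hspace_fatou]
    turns the Cauchy condition into convergence in norm. *)
Lemma hspace_complete (u : nat -> hspace k) :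
  (forall e : R, 0 < e -> exists N, forall m n, (N <= m)%N -> (N <= n)%N ->
     nH (u m - u n) <= e) ->
  exists l : hspace k, forall e : R, 0 < e -> exists N, forall n, (N <= n)%N ->
     nH (u n - l) <= e.
Proof.
move=> uc.
have pc (w : uhp R) : exists l, ccvg (fun n => u n w) l.
  apply: ccauchy_cvg => e e0.
  have w0 := uvalP w.
  pose B := Num.sqrt (pt_bound k (complex.Im (uval w))).
  have B0 : 0 <= B by exact: sqrtr_ge0.
  have [N P] := uc (e / (B + 1)) (ltac:(rewrite divr_gt0//; lra)).
  exists N => m n mN nN; have := eval_bound (u m - u n) w0 (lexx _).
  rewrite uhp_extE -/B => /le_trans; apply.
  have := P m n mN nN; rewrite ler_pdivlMr; last lra.
  have := nH_ge0 (u m - u n); nra.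
have [l lP] := choice pc.
have [N1 P1] := uc 1 ltr01.
pose A := nH (u N1) + 1.
have uA n : (N1 <= n)%N -> nH (u n) <= A.
  move=> nN; have : (nH (u n))%:C <= (nH (u n - u N1))%:C + (nH (u N1))%:C.
    by rewrite -!norm_hspace -{1}(subrK (u N1) (u n)) ler_normD.
  rewrite -rmorphD lecR => /le_trans; apply; rewrite /A addrC lerD2l.
  exact: P1.
have cvN w : ccvg (fun n => u (N1 + n)%N w) (l w).
  by move=> e e0; have [N P] := lP w e e0; exists N => n Nn; apply: P; rewrite (leq_trans Nn)// leq_addl.
have hl : holomorphic (l : uhp R -> C^o).
  apply/holomorphicE => z z0.
  pose rho := complex.Im z / 2.
  have r0 : 0 < rho by rewrite divr_gt0.
  apply: (@cderivable_limit R (fun n => uhp_ext (u (N1 + n)%N)) _ z rho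
    (Num.sqrt (pt_bound k rho) * A)) => //.
  - by move=> n; apply: holomorphic_sq; [exact: hspace_holomorphic|rewrite /rho; lra].
  - move=> n x y _; rewrite ler_distl => /andP[h _].
    apply: (le_trans (@eval_bound (u (N1 + n)%N) (x +i* y) rho r0 _)).
      by move: h; rewrite /= /rho; lra.
    by rewrite ler_wpM2l ?sqrtr_ge0// uA// leq_addr.
  - move=> h hr; have zh : 0 < complex.Im (z + h).
      have := ler_Im_normc h; rewrite ler_norml ImD => /andP[? _].
      by move: hr; rewrite /rho; lra.
    rewrite (uhp_ext_in _ zh) => e /(cvN (Uhp zh))[N P]; exists N => n /P.
    by rewrite (uhp_ext_in _ zh).
(* Fatou's lemma for [u n - u (N + m)] as [m] tends to infinity. *)
have lim e : 0 < e -> forall N, (forall m n, (N <= m)%N -> (N <= n)%N -> nH (u m - u n) <= e) ->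
    forall n, (N <= n)%N -> exists2 G : hspace k, (G : uhp R -> C^o) = (u n : uhp R -> C^o) - l & nH G <= e.
  move=> e0 N P n Nn.
  have := @hspace_fatou (fun m => hspace_fun (u n - u (N + m)%N)) ((u n : uhp R -> C^o) - l) e (ltW e0).
  apply.
  - exact: (holomorphicB (hspace_holomorphic _) hl).
  - by move=> m; exact: hspace_holomorphic.
  - move=> w d d0; have [N' P'] := lP w d d0; exists N' => m Nm.
    rewrite (_ : _ - _ = - (u (N + m)%N w - l w)); last first.
      have E (a b c : C) : (a - b) - (a - c) = - (b - c) by ring.
      exact: E.
    by rewrite normc_opp P'// (leq_trans Nm)// leq_addl.
  - move=> m; apply: (le_trans (energy_hspace _)); rewrite lee_fin.
    by rewrite lerXn2r ?nnegrE ?nH_ge0 ?(ltW e0)// P// leq_addr.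
have [G GE _] := lim 1 ltr01 N1 P1 N1 (leqnn _).
(* So far [l] is only a function; it is a member of the space as the difference of [u N1] and
   [G = u N1 - l]. *)
have LE : (((u N1 - G)%R : hspace k) : uhp R -> C^o) = l.
  apply/funext => w; have Gw : G w = u N1 w - l w by rewrite GE.
  transitivity (u N1 w - G w) => //; rewrite Gw.
  have E (a b : C) : a - (a - b) = b by ring.
  exact: E.
exists (u N1 - G) => e e0; have [N P] := uc e e0; exists N => n Nn.
have [G' G'E h] := lim e e0 N P n Nn.
rewrite (_ : u n - (u N1 - G) = G')//.
by apply/val_inj; rewrite /= G'E -LE.
Qed.

End hspace_interface.
Arguments hspace_holomorphic {R k} F.

(** * The residue theorem on a strip *)

Section strip.
Variable R : realType.
Local Notation leb := (@lebesgue_measure R).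
Local Notation mR := (measurableTypeR R).
Local Notation C := R[i].
Implicit Types (f g K : C -> C) (p r : C) (a b c d x y A B : R).

(** The integrable weight against which the decay of all kernels is measured. *)
Definition lorentz x : R := (1 + x ^+ 2)^-1.

Lemma lorentz_gt0 x : 0 < lorentz x.
Proof. by rewrite invr_gt0; have := sqr_ge0 x; lra. Qed.

Lemma continuous_lorentz : continuous lorentz.
Proof. exact: continuous_oneDsqrV. Qed.

Lemma integrable_lorentz : leb.-integrable setT (EFin \o lorentz).
Proof.
apply/integrableP; split.
  by apply/measurable_EFinP; exact: continuous_measurable_fun continuous_lorentz.
under eq_integral do rewrite /= (ger0_norm (ltW (lorentz_gt0 _))).
rewrite (ge0_symfun_integralT (fun x => ltW (lorentz_gt0 x)) continuous_lorentz); last first.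
  by move=> x; rewrite /lorentz /= sqrrN.
rewrite (_ : [set x | 0 <= x] = [set` `[0, +oo[]); last first.
  by apply/seteqP; split=> x /=; rewrite in_itv/= andbT.
by rewrite (integral0y_oneDsqr R) -EFinM ltry.
Qed.

Lemma Rintegral_lim (h : mR -> R) : leb.-integrable setT (EFin \o h) ->
  forall e : R, 0 < e -> exists N, forall n, (N <= n)%N ->
    `|\int[leb]_(x in `[- n%:R, n%:R]) h x - \int[leb]_x h x| <= e.
Proof.
move=> ih e e0.
pose hn n : mR -> \bar R := (EFin \o h) \_ [set` `[- (n%:R : R), n%:R]].
have mn n : measurable ([set` `[- (n%:R : R), n%:R]] : set mR) by exact: measurable_itv.
have mh : measurable_fun setT (EFin \o h) by exact: measurable_int ih.
have mhn n : measurable_fun setT (hn n).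
  exact: ((measurable_restrictT (EFin \o h) (mn n)).1 (measurable_funTS mh)).
have cv x : [set: mR] x -> hn n x @[n --> \oo] --> (EFin \o h) x.
  move=> _; apply: cvg_near_cst; exists (Num.truncn `|x|).+1 => // n /= xn.
  rewrite /hn /patch mem_set// /= in_itv /= -ler_norml.
  apply: ltW; apply: lt_le_trans (truncnS_gt _) _.
  by rewrite ler_nat.
have ig : leb.-integrable [set: mR] (fun x => `|(EFin \o h) x|%E) by exact: integrable_abse.
have bd n x : [set: mR] x -> (`|hn n x| <= `|(EFin \o h) x|)%E.
  by move=> _; rewrite /hn /patch; case: ifP => // _; rewrite abse0.
have := @dominated_cvg _ mR R leb setT measurableT hn (EFin \o h)
  (fun x => `|(EFin \o h) x|%E) mhn cv (fun x _ => isT) ig bd.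
have E n : (\int[leb]_x hn n x = (\int[leb]_(x in `[- n%:R, n%:R]) h x)%:E)%E.
  rewrite /hn -integral_mkcond /Rintegral fineK//.
  apply: integrable_fin_num => //.
  exact: (integrableS measurableT (mn n) (@subsetT _ _) ih).
under eq_fun do rewrite E.
have -> : (\int[leb]_x (EFin \o h) x = (\int[leb]_x h x)%:E)%E.
  by rewrite /Rintegral fineK//; exact: integrable_fin_num.
move/fine_cvgP => [_ /cvgrPdist_le /(_ e e0) [N _ P]].
by exists N => n /P /=; rewrite distrC.
Qed.

Lemma cint_lim (g0 : R -> C) : cintegrable (setT : set mR) g0 ->
  ccvg (fun n => cint `[- n%:R, n%:R] g0) (cint setT g0).
Proof.
move=> [h1 h2] e e0; have e2 : 0 < e / 2 by lra.
have [N1 P1] := Rintegral_lim h1 e2; have [N2 P2] := Rintegral_lim h2 e2.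
exists (maxn N1 N2) => n; rewrite geq_max => /andP[/P1 {}P1 /P2 {}P2].
apply: le_trans (ler_normc_ReIm _) _; rewrite !ReIm /=; lra.
Qed.

Lemma lorentz_small A e : 0 <= A -> 0 < e ->
  exists N, forall n, (N <= n)%N -> A * lorentz n%:R <= e.
Proof.
move=> A0 e0; exists (Num.truncn (A / e)).+1 => n Nn.
have h : A / e <= n%:R.
  by apply/ltW/(lt_le_trans (truncnS_gt _)); rewrite ler_nat.
have n1 : (1 : R) <= n%:R by rewrite ler1n (leq_trans _ Nn).
rewrite /lorentz ler_pdivrMr; last by have := sqr_ge0 (n%:R : R); lra.
move: h; rewrite ler_pdivrMr// => h.
apply: le_trans h _; rewrite mulrC ler_pM2l// expr2; nra.
Qed.

Lemma residue_mul g K r : ccont g 0 ->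
  (forall e : R, 0 < e -> exists2 d : R, 0 < d & forall h, h != 0 ->
    normc h < d -> normc (h * K h - r) <= e) ->
  forall e : R, 0 < e -> exists2 d : R, 0 < d & forall h, h != 0 ->
    normc h < d -> normc (h * (g h * K h) - g 0 * r) <= e.
Proof.
move=> gc Kr e e0.
have r1 : 0 < normc r + 1 by have := normc_ge0 r; lra.
have g1 : 0 < normc (g 0) + 1 by have := normc_ge0 (g 0); lra.
have e2 : 0 < e / 2 by lra.
have [d1 d10 P1] := gc _ (divr_gt0 e2 r1).
have [d2 d20 P2] := Kr _ (divr_gt0 e2 g1).
have [d3 d30 P3] := Kr _ ltr01.
exists (Num.min d1 (Num.min d2 d3)); first by rewrite !lt_min d10 d20.
move=> h h0; rewrite !lt_min => /and3P[/P1 {}P1 /(P2 _ h0) {}P2 /(P3 _ h0) {}P3].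
have hK : normc (h * K h) <= normc r + 1.
  have := ler_normcD (h * K h - r) r; rewrite subrK; lra.
rewrite (_ : _ - _ = (g h - g 0) * (h * K h) + g 0 * (h * K h - r)); last by ring.
apply: le_trans (ler_normcD _ _) _; rewrite !normcM.
have -> : e = e / 2 + e / 2 by field.
move: P1; rewrite add0r => /ltW; rewrite ler_pdivlMr// => P1.
move: P2; rewrite ler_pdivlMr// => P2.
apply: lerD.
  apply: le_trans P1; rewrite -normcM; exact: (ler_wpM2l (normc_ge0 _) hK).
apply: le_trans P2; rewrite mulrC; apply: (ler_wpM2l (normc_ge0 _)); lra.
Qed.

(** The residue theorem on [[-n, n] x [c, d]] with [n] tending to infinity. The vertical sides have
    a fixed length, and [K] is small on them. Inside the strip the decay of [K] is assumed for
    [X <= |x|] because of the pole; on the two boundary lines it holds everywhere and gives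
    integrability. *)
Lemma strip_residue g K r A B c d (X : R) :
  c < 0 -> 0 < d -> 0 <= A ->
  (forall x y, c <= y <= d -> cderivable g (x +i* y)) ->
  (forall x y, c <= y <= d -> normc (g (x +i* y)) <= B) ->
  (forall x y, c <= y <= d -> x +i* y != 0 -> cderivable K (x +i* y)) ->
  (forall e : R, 0 < e -> exists2 d : R, 0 < d & forall h, h != 0 ->
    normc h < d -> normc (h * K h - r) <= e) ->
  (forall x y, c <= y <= d -> X <= `|x| -> normc (K (x +i* y)) <= A * lorentz x) ->
  (forall x, normc (K (x +i* c)) <= A * lorentz x) ->
  (forall x, normc (K (x +i* d)) <= A * lorentz x) ->
  cint setT (fun x => g (x +i* c) * K (x +i* c)) -
  cint setT (fun x => g (x +i* d) * K (x +i* d)) = g 0 * r * wind R.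
Proof.
move=> c0 d0 A0 gd gB Kd Kr KX Kc Kdd.
pose f z := g z * K z.
have fd x y : c <= y <= d -> x +i* y != 0 -> cderivable f (x +i* y).
  by move=> yy xy; have [l gl] := gd x y yy; have [m Km] := Kd x y yy xy;
     exists (l * K (x +i* y) + g (x +i* y) * m); exact: cderM.
have cc : c <= c <= d by apply/andP; lra.
have dd : c <= d <= d by apply/andP; lra.
have B0 : 0 <= B by exact: le_trans (normc_ge0 _) (gB 0 c cc).
have iL (y : R) : c <= y <= d -> y != 0 ->
    (forall x, normc (K (x +i* y)) <= A * lorentz x) ->
    cintegrable (setT : set mR) (fun x => f (x +i* y)).
  move=> yy y0 Ky.
  have rc x : rcont (fun t => f (t +i* y)) x.
    by apply: ccont_h; apply/cderivable_ccont/fd => //; rewrite complex_neq0// y0 orbT.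
  apply: (@cintegrable_le _ _ _ (fun x => (B * A) * lorentz x)) => //.
  - exact: measurable_rcont_Re.
  - exact: measurable_rcont_Im.
  - have := @integrableZl _ mR R leb setT measurableT (B * A) _ integrable_lorentz.
    by apply: eq_integrable => //= x _; rewrite EFinM.
  - move=> x _; rewrite /f normcM -mulrA; apply: ler_pM; rewrite ?normc_ge0//.
    exact: gB.
have L1 := cint_lim (iL c cc (ltr0_neq0 c0) Kc).
have L2 := cint_lim (iL d dd (lt0r_neq0 d0) Kdd).
have L := ccvgD L1 (ccvgZ (-1) L2).
apply/eqP; rewrite -subr_eq0 -normc_eq0 eq_le normc_ge0 andbT.
apply/ler_addgt0Pr => e e0; rewrite add0r.
have e2 : 0 < e / 2 by lra.
have [N1 P1] := L _ e2.
pose D := d - c.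
have D0 : 0 < D by rewrite /D; lra.
(* Each vertical side contributes at most [2 * D * B * A * lorentz n]. *)
have D4 : 0 <= 4 * D * B * A by rewrite !mulr_ge0// ltW.
have [N2 P2] := lorentz_small D4 e2.
pose N3 := (Num.truncn X).+1.
pose n := (N1 + (N2 + N3))%N.
have n1 : (N1 <= n)%N by rewrite /n leq_addr.
have n2 : (N2 <= n)%N by rewrite /n addnCA leq_addr.
have n3 : X <= n%:R.
  by apply/ltW/(lt_le_trans (truncnS_gt _)); rewrite ler_nat /n addnA leq_addl.
have n0 : (0 : R) < n%:R by rewrite ltr0n /n /N3 !addnS.
have nn : (- n%:R : R) < 0 by lra.
have res : rint f (- n%:R) n%:R c d = g 0 * r * wind R.
  apply: (@residue_rint _ _ 0) => /=.
  - by apply/andP.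
  - by apply/andP.
  - by move=> x y _ yy xy; exact: fd.
  - have g0c : ccont g 0.
      by apply/cderivable_ccont; have := gd 0 0; apply; apply/andP; lra.
    move=> e' e'0; have [d' d'0 P] := residue_mul g0c Kr e'0.
    by exists d' => // h h0 hd; rewrite add0r; exact: P.
have sideP (x : R) : X <= `|x| -> lorentz x = lorentz n%:R -> x != 0 ->
    normc (cint `[c, d] (fun y => f (x +i* y))) <= 2 * (d - c) * (A * lorentz n%:R * B).
  move=> xX xl x0; apply: cint_itv_le; first lra.
    move=> y yy; apply: ccont_v; apply/cderivable_ccont/fd => //.
    by rewrite complex_neq0// x0.
  move=> y yy; rewrite /f normcM mulrC; apply: ler_pM; rewrite ?normc_ge0//.
    by rewrite -xl; exact: KX.
  exact: gB.
have V1 := sideP n%:R; rewrite ger0_norm in V1; last exact: ltW.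
have {}V1 := V1 n3 erefl (lt0r_neq0 n0).
have V2 := sideP (- n%:R); rewrite normrN ger0_norm in V2; last exact: ltW.
have lN : lorentz (- n%:R) = lorentz n%:R by rewrite /lorentz sqrrN.
have {lN}V2 := V2 n3 lN (ltr0_neq0 nn).
move: (P1 n n1) (P2 n n2) => Q1 Q2.
rewrite -res /rint.
set U1 := cint `[- n%:R, n%:R] (fun x => f (x +i* c)) in Q1 *.
set U2 := cint `[- n%:R, n%:R] (fun x => f (x +i* d)) in Q1 *.
set W1 := cint _ (fun y => f (n%:R +i* y)) in V1 *.
set W2 := cint _ (fun y => f (- n%:R +i* y)) in V2 *.
set T1 := cint setT (fun x => f (x +i* c)) in Q1 *.
set T2 := cint setT (fun x => f (x +i* d)) in Q1 *.
rewrite (_ : _ - _ = - (U1 + -1 * U2 - (T1 + -1 * T2)) + - 'i * (W1 - W2)); last first.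
  by rewrite /T1 /T2 /f; ring.
apply: le_trans (ler_normcD _ _) _; rewrite normc_opp normcM normc_opp.
have -> : normc ('i : C) = 1 by rewrite /normc /= expr0n /= add0r expr1n sqrtr1.
rewrite mul1r; apply: le_trans (lerD Q1 (ler_normcB _ _)) _.
apply: le_trans (lerD (lexx _) (lerD V1 V2)) _.
rewrite [leRHS](_ : e = e / 2 + e / 2); last by field.
apply: lerD => //; apply: le_trans Q2; rewrite /D.
by rewrite le_eqVlt; apply/orP; left; apply/eqP; ring.
Qed.

End strip.

(** * Convolution along horizontal lines *)

Section averaging.
Variable R : realType.
Local Notation leb := (@lebesgue_measure R).
Local Notation mR := (measurableTypeR R).
Local Notation C := R[i].
Local Notation lam := (\int[leb]_x lorentz x).

Lemma lorentz_mass_ge0 : 0 <= lam.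
Proof. by apply: Rintegral_ge0 => x _; exact/ltW/lorentz_gt0. Qed.

Lemma integrable_lorentz_mul (f : mR -> R) (B : R) : measurable_fun setT f ->
  (forall x, `|f x| <= B) -> leb.-integrable setT (fun x => (lorentz x * f x)%:E).
Proof.
move=> mf fB.
apply: (@le_integrable _ mR R leb setT measurableT _ (fun x => (B * lorentz x)%:E)).
- apply/measurable_EFinP; apply: measurable_funM => //.
  exact: continuous_measurable_fun (@continuous_lorentz R).
- move=> x _ /=; rewrite lee_fin normrM (gtr0_norm (lorentz_gt0 x)) mulrC.
  rewrite (le_trans _ (ler_norm _))// ler_wpM2r//; exact/ltW/lorentz_gt0.
- have := @integrableZl _ mR R leb setT measurableT B _ (@integrable_lorentz R).
  by apply: eq_integrable => //= x _; rewrite EFinM.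
Qed.

(** The integral of [lorentz * (f - m) ^+ 2] is nonnegative for [m = I / (lam + 1)]. The denominator
    [lam + 1] is positive as soon as [lam >= 0]. *)
Lemma lorentz_cauchy_schwarz (f : mR -> R) (B : R) : measurable_fun setT f ->
  (forall x, 0 <= f x) -> (forall x, f x <= B) ->
  (\int[leb]_x (lorentz x * f x)) ^+ 2 <=
  (lam + 1) * \int[leb]_x (lorentz x * f x ^+ 2).
Proof.
move=> mf f0 fB.
have i1 : leb.-integrable setT (EFin \o (fun x => lorentz x * f x)).
  by apply: (@integrable_lorentz_mul _ B) => // x; rewrite ger0_norm.
have i2 : leb.-integrable setT (EFin \o (fun x => lorentz x * f x ^+ 2)).
  apply: (@integrable_lorentz_mul _ (B ^+ 2)); first exact: measurable_funX.
  move=> x; rewrite ger0_norm ?exprn_ge0// lerXn2r ?nnegrE//.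
  exact: le_trans (f0 x) (fB x).
have i3 := @integrable_lorentz R.
set I := \int[leb]_x (lorentz x * f x); set Q := \int[leb]_x (lorentz x * f x ^+ 2).
have L0 := lorentz_mass_ge0.
pose m := I / (lam + 1).
have i4 : leb.-integrable setT (EFin \o (fun x => 2 * m * (lorentz x * f x))).
  have := @integrableZl _ mR R leb setT measurableT (2 * m) _ i1.
  by apply: eq_integrable => //= x _; rewrite -EFinM.
have i5 : leb.-integrable setT (EFin \o (fun x => m ^+ 2 * lorentz x)).
  have := @integrableZl _ mR R leb setT measurableT (m ^+ 2) _ i3.
  by apply: eq_integrable => //= x _; rewrite -EFinM.
have h : 2 * m * I <= Q + m ^+ 2 * lam.
  rewrite -!RintegralZl// -RintegralD//.
  apply: le_Rintegral => //.
    by have := @integrableD _ mR R leb setT measurableT _ _ i2 i5.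
  move=> x _; have l0 := lorentz_gt0 x.
  have := mulr_ge0 (ltW l0) (sqr_ge0 (f x - m)); nra.
have E (i q l : R) : 0 <= l ->
    2 * (i / (l + 1)) * i <= q + (i / (l + 1)) ^+ 2 * l -> i ^+ 2 <= (l + 1) * q.
  move=> l0; set t := i / (l + 1).
  have -> : i = t * (l + 1) by rewrite /t divfK// lt0r_neq0//; lra.
  by have := sqr_ge0 t; nra.
exact: E L0 h.
Qed.

Variable k : hspace_kind R.
Variables (J : R -> C) (A : R).
Hypotheses (Jc : forall x, rcont J x) (A0 : 0 <= A).
Hypothesis JA : forall x, normc (J x) <= A * lorentz x.

Definition avg (F : uhp R -> C^o) (z : C) : C :=
  cint setT (fun x => J x * uhp_ext F (z + x%:C)).

Lemma rcontM (f g : R -> C) x : rcont f x -> rcont g x -> rcont (fun t => f t * g t) x.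
Proof.
move=> fc gc e e0.
have f1 : 0 < normc (f x) + 1 by have := normc_ge0 (f x); lra.
have g1 : 0 < normc (g x) + 1 by have := normc_ge0 (g x); lra.
have e2 : 0 < e / 2 by lra.
have [d1 d10 P1] := fc _ (divr_gt0 e2 g1).
have [d2 d20 P2] := gc _ (divr_gt0 e2 f1).
have [d3 d30 P3] := gc _ ltr01.
exists (Num.min d1 (Num.min d2 d3)); first by rewrite !lt_min d10 d20.
move=> y; rewrite !lt_min => /and3P[/P1 {}P1 /P2 {}P2 /P3 {}P3].
have gy : normc (g y) <= normc (g x) + 1.
  have := ler_normcD (g y - g x) (g x); rewrite subrK; lra.
rewrite (_ : _ - _ = (f y - f x) * g y + f x * (g y - g x)); last by ring.
apply: le_lt_trans (ler_normcD _ _) _; rewrite !normcM.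
move: P1; rewrite ltr_pdivlMr// => P1; move: P2; rewrite ltr_pdivlMr// => P2.
have h1 := ler_wpM2l (normc_ge0 (f y - f x)) gy.
have h2 : normc (f x) * normc (g y - g x) <= normc (g y - g x) * (normc (f x) + 1).
  by rewrite mulrC; apply: (ler_wpM2l (normc_ge0 _)); lra.
lra.
Qed.

Lemma rcont_hline (F : uhp R -> C^o) z x : holomorphic F -> 0 < complex.Im z ->
  rcont (fun t => uhp_ext F (z + t%:C)) x.
Proof.
move=> /holomorphicE hF z0 e e0.
have zx : 0 < complex.Im (z + x%:C) by rewrite ImD /= addr0.
have [d d0 P] := cderivable_ccont (hF _ zx) e0.
exists d => // y yd; rewrite (_ : z + y%:C = z + x%:C + (y - x)%:C); last first.
  by rewrite rmorphB /=; ring.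
by apply: P; rewrite normc_real.
Qed.

Lemma cintegrable_avg (F : hspace k) z : 0 < complex.Im z ->
  cintegrable (setT : set mR) (fun x => J x * uhp_ext F (z + x%:C)).
Proof.
move=> z0.
have rc x : rcont (fun x => J x * uhp_ext F (z + x%:C)) x.
  by apply: rcontM => //; exact: rcont_hline (hspace_holomorphic F) z0.
pose B := Num.sqrt (pt_bound k (complex.Im z)) * nH k F.
apply: (@cintegrable_le _ _ _ (fun x => (B * A) * lorentz x)) => //.
- exact: measurable_rcont_Re.
- exact: measurable_rcont_Im.
- have := @integrableZl _ mR R leb setT measurableT (B * A) _ (@integrable_lorentz R).
  by apply: eq_integrable => //= x _; rewrite EFinM.
- move=> x _; rewrite normcM mulrC -mulrA; apply: ler_pM; rewrite ?normc_ge0//.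
  by apply: eval_bound => //; rewrite ImD /= addr0.
Qed.

(** In place of differentiation under the integral sign, the second-difference estimate is
    integrated against [J]. It is uniform in [x] because the bound on [F] depends only on the
    height. *)
Lemma avg_holomorphic (F : hspace k) z : 0 < complex.Im z -> cderivable (avg F) z.
Proof.
(* The square of half-side [2 * rho] around [z + x] stays at heights at least [2 * rho]. *)
move=> z0; pose rho := complex.Im z / 4.
have r0 : 0 < rho by rewrite divr_gt0.
pose B := Num.sqrt (pt_bound k (2 * rho)) * nH k F.
pose M := 64 / normc (wind R) / (2 * rho) ^+ 2 * B.
apply: (@cderivable_of_second_difference R _ z rho (2 * (A * M * lam))) => //.
move=> h l hr lr.
have Im_ge (v : C) : normc v <= rho -> 0 < complex.Im (z + v).
  move=> vr; have := ler_Im_normc v; rewrite ler_norml ImD => /andP[? _].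
  by move: vr; rewrite /rho; lra.
pose D x := J x * (l * (uhp_ext F ((z + x%:C) + h) - uhp_ext F (z + x%:C)) -
                   h * (uhp_ext F ((z + x%:C) + l) - uhp_ext F (z + x%:C))).
have i0 := cintegrable_avg F z0.
have i1 := cintegrable_avg F (Im_ge h hr).
have i2 := cintegrable_avg F (Im_ge l lr).
have iB v : cintegrable (setT : set mR) (fun x => J x * uhp_ext F (z + v + x%:C)) ->
   cintegrable (setT : set mR) (fun x => J x * uhp_ext F (z + v + x%:C) - J x * uhp_ext F (z + x%:C)).
  by move=> iv; exact: cintegrableB.
have DE : l * (avg F (z + h) - avg F z) - h * (avg F (z + l) - avg F z) = cint setT D.
  rewrite /avg -!cintB// -!cintZ//; try exact: iB.
  rewrite -cintB//; try by apply: cintegrableZ => //; exact: iB.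
  apply: eq_cint => x _; rewrite /D ![z + _ + x%:C]addrAC; ring.
rewrite DE.
have iD : cintegrable (setT : set mR) D.
  have := cintegrableB measurableT (cintegrableZ l measurableT (iB _ i1))
    (cintegrableZ h measurableT (iB _ i2)).
  apply: eq_cintegrable => // x _; rewrite /D ![z + _ + x%:C]addrAC; ring.
pose N := normc h * normc l * normc (h - l).
have N0 : 0 <= N by rewrite !mulr_ge0 ?normc_ge0.
apply: (le_trans (cint_le measurableT iD (B := fun x => A * M * N * lorentz x) _ _)).
- have := @integrableZl _ mR R leb setT measurableT (A * M * N) _ (@integrable_lorentz R).
  by apply: eq_integrable => //= x _; rewrite EFinM.
- move=> x _; rewrite /D normcM (_ : A * M * N * lorentz x = A * lorentz x * (M * N)); last by ring.
  apply: ler_pM; rewrite ?normc_ge0//.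
  apply: (@second_difference R (uhp_ext F) (z + x%:C) (2 * rho) B).
  + by rewrite mulr_gt0.
  + apply: holomorphic_sq; first exact: hspace_holomorphic.
    by rewrite ImD /= /rho; lra.
  + move=> s t _; rewrite ler_distl => /andP[ht _].
    apply: eval_bound; first by rewrite mulr_gt0.
    by move: ht; rewrite ImD /= /rho; lra.
  + by rewrite (_ : 2 * rho / 2 = rho)//; field.
  + by rewrite (_ : 2 * rho / 2 = rho)//; field.
- rewrite RintegralZl//; last exact: integrable_lorentz.
  by rewrite /N le_eqVlt; apply/orP; left; apply/eqP; ring.
Qed.

(** Young's inequality for an integrable kernel and a square integrable function: Cauchy-Schwarz
    with weight [lorentz], then Tonelli's theorem and translation invariance. The 4 is the square of
    the factor of [cint_le]. *)
Lemma avg_line (F : hspace k) (G : uhp R -> C^o) (y : R) : 0 < y ->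
  (forall z, 0 < complex.Im z -> uhp_ext G z = avg F z) -> holomorphic G ->
  (line G y <= (4 * A ^+ 2 * (lam + 1) * lam)%:E * line F y)%E.
Proof.
move=> y0 GE hG; have hF := hspace_holomorphic F.
have L0 := lorentz_mass_ge0.
pose c := 4 * A ^+ 2 * (lam + 1).
have c0 : 0 <= c by rewrite !mulr_ge0 ?exprn_ge0// addr_ge0.
pose H (p : mR * mR) : \bar R := (lorentz p.1 * mod2 F (p.2 + p.1, y))%:E.
have H0 p : (0 <= H p)%E by rewrite lee_fin mulr_ge0 ?mod2_ge0// ltW// lorentz_gt0.
have mH : measurable_fun setT H.
  apply/measurable_EFinP; apply: measurable_funM.
    apply: measurableT_comp => //.
    exact: continuous_measurable_fun (@continuous_lorentz R).
  apply: (measurableT_comp (measurable_mod2 hF)).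
  apply/measurable_fun_pairP; split; last exact: measurable_cst.
  exact: measurable_funD.
have mline (x : R) : measurable_fun setT (fun t : mR => mod2 F (x + t, y)).
  apply: (measurableT_comp (measurable_mod2 hF)).
  apply/measurable_fun_pairP; split; last exact: measurable_cst.
  exact: measurable_funD.
have pt x : ((mod2 G (x, y))%:E <= c%:E * \int[leb]_t H (t, x))%E.
  have z0 : 0 < complex.Im (x +i* y) by [].
  pose f (t : mR) := normc (uhp_ext F ((x +i* y) + t%:C)).
  have fE t : f t ^+ 2 = mod2 F (x + t, y).
    rewrite /f /mod2 /=; congr (normc (uhp_ext F _) ^+ 2).
    by apply/eqP; rewrite eq_complex !ReIm /= addr0 !eqxx.
  have mf : measurable_fun setT f.
    rewrite (_ : f = Num.sqrt \o (fun t => mod2 F (x + t, y))).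
      apply: measurableT_comp => //; apply: continuous_measurable_fun.
      exact: sqrt_continuous.
    by apply/funext => t /=; rewrite -fE sqrtr_sqr ger0_norm// normc_ge0.
  have f0 t : 0 <= f t by exact: normc_ge0.
  pose B := Num.sqrt (pt_bound k y) * nH k F.
  have fB t : f t <= B by apply: eval_bound => //; rewrite ImD /= addr0.
  have := lorentz_cauchy_schwarz mf f0 fB.
  set I := \int[leb]_x (lorentz x * f x); set Q := \int[leb]_x (lorentz x * f x ^+ 2) => IQ.
  have i1 : leb.-integrable setT (EFin \o (fun x => lorentz x * f x)).
    by apply: (@integrable_lorentz_mul _ B) => // t; rewrite ger0_norm.
  have i2 : leb.-integrable setT (EFin \o (fun x => lorentz x * f x ^+ 2)).
    apply: (@integrable_lorentz_mul _ (B ^+ 2)); first exact: measurable_funX.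
    move=> t; rewrite ger0_norm ?exprn_ge0// lerXn2r ?nnegrE//.
    exact: le_trans (f0 t) (fB t).
  have GI : normc (uhp_ext G (x +i* y)) <= 2 * (A * I).
    rewrite GE// /avg /I -RintegralZl//.
    apply: (cint_le measurableT (cintegrable_avg F z0) (B := fun t => A * (lorentz t * f t))).
      have := @integrableZl _ mR R leb setT measurableT A _ i1.
      by apply: eq_integrable => //= t _; rewrite -EFinM.
    by move=> t _; rewrite normcM mulrA; apply: ler_wpM2r; rewrite ?normc_ge0.
  have QE : (\int[leb]_t H (t, x) = Q%:E)%E.
    rewrite /Q /Rintegral fineK; last exact: integrable_fin_num.
    by apply: eq_integral => t _; rewrite /H /= fE.
  rewrite QE -EFinM lee_fin /mod2 /=.
  have I0 : 0 <= I.
    by apply: Rintegral_ge0 => t _; rewrite mulr_ge0// ltW// lorentz_gt0.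
  apply: (@le_trans _ _ ((2 * (A * I)) ^+ 2)).
    by rewrite lerXn2r ?nnegrE ?normc_ge0 ?mulr_ge0.
  rewrite (_ : (2 * (A * I)) ^+ 2 = 4 * A ^+ 2 * I ^+ 2); last by ring.
  have a0 : 0 <= 4 * A ^+ 2 by rewrite mulr_ge0// exprn_ge0.
  by rewrite /c -(mulrA (4 * A ^+ 2)); exact: (ler_wpM2l a0 IQ).
have mHx : measurable_fun setT (fun x : mR => \int[leb]_t H (t, x))%E.
  exact: measurable_int_x.
apply: (@le_trans _ _ (\int[leb]_x (c%:E * \int[leb]_t H (t, x)))%E).
  apply: ge0_le_integral => //.
  - by move=> x _; rewrite lee_fin mod2_ge0.
  - apply/measurable_EFinP.
    exact: (measurableT_comp (measurable_mod2 hG) (pair2_measurable y)).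
  - exact: emeasurable_funM.
rewrite ge0_integralZl//; last by move=> x _; exact: integral_ge0.
rewrite (EFinM c) -muleA lee_wpmul2l ?lee_fin//.
rewrite (tonelli_itv mH H0 measurableT measurableT).
have ml : measurable_fun setT (fun x : mR => (mod2 F (x, y))%:E).
  apply/measurable_EFinP.
  exact: (measurableT_comp (measurable_mod2 hF) (pair2_measurable y)).
have lE (t : R) : (\int[leb]_x H (t, x) = (lorentz t)%:E * line F y)%E.
  rewrite /H; under eq_integral do rewrite EFinM /=.
  rewrite ge0_integralZl//; last 3 first.
  - apply/measurable_EFinP; apply: (measurableT_comp (measurable_mod2 hF)).
    apply/measurable_fun_pairP; split; last exact: measurable_cst.
    exact: measurable_funD.
  - by move=> x _; rewrite lee_fin mod2_ge0.
  - by rewrite lee_fin ltW// lorentz_gt0.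
  congr (_ * _)%E; rewrite /line -(ge0_integral_shift t measurableT ml) ?preimage_setT.
    by apply: eq_integral => x _; rewrite addrC.
  by move=> x _; rewrite lee_fin mod2_ge0.
under eq_integral do rewrite lE.
have Lf : (\int[leb]_t (lorentz t)%:E = lam%:E)%E.
  by rewrite /Rintegral fineK//; exact: (integrable_fin_num measurableT (@integrable_lorentz R)).
under eq_integral do rewrite muleC.
rewrite ge0_integralZl//; last 3 first.
- by apply/measurable_EFinP; exact: continuous_measurable_fun (@continuous_lorentz R).
- by move=> t _; rewrite lee_fin ltW// lorentz_gt0.
- exact: line_ge0.
by rewrite Lf muleC.
Qed.

Lemma avg_hspace : exists2 K : R, 0 <= K & forall F : hspace k,
  exists2 G : hspace k, (forall z, 0 < complex.Im z -> uhp_ext G z = avg F z) &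
    nH k G <= K * nH k F.
Proof.
have L0 := lorentz_mass_ge0.
pose c := 4 * A ^+ 2 * (lam + 1) * lam.
have c0 : 0 <= c by rewrite !mulr_ge0 ?exprn_ge0// addr_ge0.
exists (Num.sqrt c) => [|F]; first exact: sqrtr_ge0.
pose G : uhp R -> C^o := fun w => avg F (uval w).
have GE z : 0 < complex.Im z -> uhp_ext G z = avg F z by move=> z0; rewrite (uhp_ext_in _ z0).
have hG : holomorphic G.
  apply/holomorphicE => z z0; have [l lP] := avg_holomorphic F z0.
  exists l; apply: cder_ext lP; exists (complex.Im z) => // h hz; rewrite GE//.
  have := ler_Im_normc h; rewrite ler_norml ImD => /andP[? _]; lra.
have [G' G'E G'n] := hspace_dominated (F := F) hG (sqrtr_ge0 c)
  (fun y y0 => ltac:(rewrite sqr_sqrtr//; exact: (avg_line y0 GE hG))).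
by exists G' => // z z0; rewrite G'E GE.
Qed.

End averaging.

(** * The resolvent off the spiral *)

Section bounded_segment.
Variable R : realType.
Local Notation C := R[i].

Lemma rcont_bounded (f : R -> C) (p q : R) : p <= q ->
  (forall x, p <= x <= q -> rcont f x) ->
  exists2 B : R, 0 <= B & forall x, p <= x <= q -> normc (f x) <= B.
Proof.
move=> pq fc.
have cf : {within `[p, q], continuous (fun x => normc (f x))}.
  apply: continuous_in_subspaceT => x; rewrite inE /= in_itv/= => xpq.
  apply/cvgrPdist_lt => e e0; have [d d0 P] := fc x xpq e e0.
  apply/nbhs_ballP; exists d => // y; rewrite /ball/= distrC => /P.
  by rewrite distrC; apply: le_lt_trans; exact: ler_dist_normc.
have [c _ cP] := EVT_max pq cf.
by exists (normc (f c)); [exact: normc_ge0|move=> x xpq; apply: cP; rewrite in_itv].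
Qed.

End bounded_segment.

Section simple_pole.
Variable R : realType.
Local Notation C := R[i].

Lemma simple_pole (E : C -> C) (nu : C) : nu != 0 -> E 0 = 0 -> cder E 0 nu ->
  forall e : R, 0 < e -> exists2 d : R, 0 < d & forall h, h != 0 ->
    normc h < d -> normc (h * (E h)^-1 - nu^-1) <= e.
Proof.
move=> nu0 E0 dE e e0.
have n0 : 0 < normc nu by rewrite normc_gt0.
have n2 : 0 < normc nu ^+ 2 by rewrite exprn_gt0.
(* The first bound keeps [normc (E h)] above [normc nu * normc h / 2]; given this, the second one
   makes the quotient at most [e]. *)
pose e' := Num.min (normc nu / 2) (e * normc nu ^+ 2 / 2).
have e'0 : 0 < e' by rewrite lt_min !divr_gt0// mulr_gt0.
have [d d0 P] := dE _ e'0; exists d => // h h0 /P.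
rewrite add0r E0 subr0 => hE.
have hn : 0 < normc h by rewrite normc_gt0.
have e1 : e' <= normc nu / 2 by rewrite ge_min lexx.
have e2 : e' <= e * normc nu ^+ 2 / 2 by rewrite ge_min lexx orbT.
have El : normc nu * normc h / 2 <= normc (E h).
  have := ler_normcB2 (nu * h) (E h - nu * h).
  rewrite normcM (_ : nu * h + _ = E h); last by ring.
  by have := ler_wpM2r (ltW hn) e1; lra.
have E00 : 0 < normc (E h) by apply: lt_le_trans El; rewrite divr_gt0// mulr_gt0.
have Eh : E h != 0 by rewrite -normc_gt0.
have quot (u v w : C) : u != 0 -> v != 0 -> w / v - u^-1 = - (v - u * w) / (v * u).
  by move=> ? ?; field; apply/andP.
rewrite quot//.
rewrite normcM normc_opp normcV normcM ler_pdivrMr ?mulr_gt0//.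
apply: (le_trans hE).
have h1 := ler_wpM2r (ltW hn) e2.
have h2 := ler_wpM2l (ltW (mulr_gt0 e0 n0)) El.
apply: (le_trans h1); apply: le_trans (_ : e * normc nu * normc (E h) <= _); last first.
  by rewrite -mulrA ler_pM2l// mulrC.
by apply: le_trans h2; rewrite le_eqVlt; apply/orP; left; apply/eqP; field.
Qed.

End simple_pole.

Section complex_logarithm.
Variable R : realType.
Local Notation C := R[i].

Lemma Re_iM (t : R) : complex.Re ('i * t%:C) = 0.
Proof. by rewrite !ReIm /= mul0r mulr0 subr0. Qed.

Lemma Im_iM (t : R) : complex.Im ('i * t%:C) = t.
Proof. by rewrite !ReIm /= mul0r mul1r add0r. Qed.

Lemma imaginaryE (z : C) : complex.Re z = 0 -> z = 'i * (complex.Im z)%:C.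
Proof. by move=> z0; apply/eqP; rewrite eq_complex Re_iM Im_iM z0 !eqxx. Qed.

Lemma cexp_iM (t : R) : cexp ('i * t%:C) = cos t +i* sin t.
Proof. by rewrite /cexp Re_iM Im_iM expR0 mul1r. Qed.

(** The condition [0 <= t] matches the half-line that parametrizes the spiral; it is met by [acos x]
    or [2 pi - acos x] according to the sign of [y]. *)
Lemma cexp_polar (z : C) : normc z = 1 -> exists2 t : R, 0 <= t & cexp ('i * t%:C) = z.
Proof.
case: z => x y nz.
have xy : x ^+ 2 + y ^+ 2 = 1 by have := normc_sqr (x +i* y); rewrite nz expr1n.
have x1 : -1 <= x <= 1 by have := sqr_ge0 y; rewrite -ler_norml -(@expr_le1 _ 2)// real_normK ?num_real//; lra.
have cx : cos (acos x) = x by rewrite acosK// in_itv.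
have sx : sin (acos x) = `|y| by rewrite sin_acos// -xy addrC addKr sqrtr_sqr.
have [y0|y0] := leP 0 y.
  by exists (acos x); [exact: acos_ge0|rewrite cexp_iM cx sx ger0_norm].
exists (pi *+ 2 - acos x).
  by have := acos_lepi x1; have := @pi_ge0 R; rewrite mulr2n; lra.
rewrite cexp_iM addrC cosD2pi sinD2pi cosN sinN cx sx ltr0_norm// opprK//.
Qed.

Lemma cexp_surj (z : C) : z != 0 -> exists u, cexp u = z.
Proof.
move=> z0; have nz : 0 < normc z by rewrite normc_gt0.
have nz0 : (normc z)%:C != 0 :> C by rewrite -normc_eq0 normc_real normr_eq0 gt_eqF.
have n1 : normc (z / (normc z)%:C) = 1.
  by rewrite normcM normcV normc_real gtr0_norm// divff// gt_eqF.
have [t _ tE] := cexp_polar n1; exists ((ln (normc z))%:C + 'i * t%:C).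
rewrite cexpD tE /cexp /= lnK// cos0 sin0.
by rewrite (_ : 1 +i* 0 = 1)// mulr1 mulrC divfK.
Qed.

Lemma cexp_Mint (z : C) (n : int) : cexp z = 1 -> cexp (n%:~R * z) = 1.
Proof.
move=> z1; rewrite mulrzl; case: n => n; first by rewrite -pmulrn cexpMn z1 expr1n.
by rewrite NegzE mulrNz cexpN -pmulrn cexpMn z1 expr1n invr1.
Qed.

Lemma cexp_2pi : cexp ('i * (pi *+ 2)%:C) = 1 :> C.
Proof.
by rewrite cexp_iM cos2pi sin2pi.
Qed.

Lemma cexp_eq1 (t : R) : - pi <= t <= pi -> cexp ('i * t%:C) = 1 -> t = 0.
Proof.
move=> tp /eqP; rewrite cexp_iM.
rewrite eq_complex /= => /andP[/eqP ct _].
have h : `|t| = 0.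
  have p0 := @pi_ge0 R.
  apply: (@cos_inj R); rewrite ?in_itv/= ?lexx ?normr_ge0 ?ler_norml//.
  by rewrite cos0; have [t0|t0] := ger0P t; rewrite ?cosN.
by apply/eqP; rewrite -normr_eq0 h.
Qed.

End complex_logarithm.

(** * The kernel of the resolvent *)

Section kernel.
Variable R : realType.
Local Notation C := R[i].
Variables (w0 mu : C).
Let a := complex.Re w0.
Let b := complex.Im w0.
Hypothesis b0 : 0 < b.
Let w00 : w0 != 0.
Proof. by apply: contraTneq b0; rewrite /b => ->; rewrite ltxx. Qed.

(** The frequency for which [cexp (freq * s)] has period [w0]. *)
Definition freq : C := (pi *+ 2)%:C * 'i / w0.

Lemma freqM : freq * w0 = 'i * (pi *+ 2)%:C.
Proof. by rewrite /freq divfK// mulrC. Qed.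

Lemma cexp_freq : cexp (freq * w0) = 1.
Proof. by rewrite freqM cexp_2pi. Qed.

Lemma freq_neq0 : freq != 0.
Proof.
apply/eqP => f0; have := freqM; rewrite f0 mul0r => /esym/(congr1 (@complex.Im R)).
rewrite Im_iM mulr2n /=; have := @pi_gt0 R; lra.
Qed.

Lemma Re_freq : 0 < complex.Re freq.
Proof.
have p0 := @pi_gt0 R.
have H (f w : C) T : f * w = 'i * T%:C ->
    complex.Re f * (complex.Re w ^+ 2 + complex.Im w ^+ 2) = T * complex.Im w.
  move=> E; have := congr1 (@complex.Re R) E; have := congr1 (@complex.Im R) E.
  rewrite Re_iM Im_iM !ReIm => <- h.
  have -> : complex.Re f * (complex.Re w ^+ 2 + complex.Im w ^+ 2) =
    (complex.Re f * complex.Re w - complex.Im f * complex.Im w) * complex.Re w +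
    (complex.Re f * complex.Im w + complex.Im f * complex.Re w) * complex.Im w by ring.
  by rewrite h mul0r add0r.
have := H _ _ _ freqM; rewrite -/a -/b mulr2n => h3.
have h1 := sqr_ge0 a; have h2 : 0 < b ^+ 2 by rewrite exprn_gt0.
have : 0 < complex.Re freq * (a ^+ 2 + b ^+ 2) by rewrite h3 mulr_gt0//; lra.
by rewrite pmulr_lgt0//; lra.
Qed.

(** The modulus forces [freq * s = i t] with [t] real, that is [s = (t / 2 pi) w0], and the bound on
    [Im s] gives [|t| <= pi]. Hence 0 is the only pole of [kern] in the closed strip of height
    [b]. *)
Lemma cexp_freq_eq1 (s : C) : `|complex.Im s| <= b / 2 -> cexp (freq * s) = 1 -> s = 0.
Proof.
move=> sb s1.
pose u := freq * s.
have uE : s = u * w0 / ('i * (pi *+ 2)%:C).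
  by rewrite -freqM /u; field; rewrite w00 freq_neq0.
have Ru : complex.Re u = 0.
  have := congr1 (@normc R) s1; rewrite normc_cexp normc1 => h.
  by apply: expR_inj; rewrite h expR0.
pose t := complex.Im u.
have ut : u = 'i * t%:C by exact: imaginaryE.
have p0 := @pi_gt0 R.
have sE : s = (t / (pi *+ 2))%:C * w0.
  have i0 : ('i : C) != 0 by exact: neq0Ci.
  have T0 : (pi *+ 2)%:C != 0 :> C by rewrite -normc_eq0 normc_real normr_eq0 mulr2n; lra.
  have E (i t' w T : C) : i != 0 -> T != 0 -> i * t' * w / (i * T) = t' / T * w.
    by move=> ? ?; field; apply/andP.
  by rewrite uE ut rmorphM /= fmorphV; exact: E.
have t0 : t = 0.
  apply: cexp_eq1; last by rewrite -ut.
  move: sb; rewrite sE !ReIm /= mul0r addr0 -/b normrM (gtr0_norm b0).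
  rewrite mulrC ler_pM2l// normrM normfV (@gtr0_norm _ (pi *+ 2)); last by rewrite mulr2n; lra.
  rewrite ler_pdivrMr; last by rewrite mulr2n; lra.
  rewrite -ler_norml mulr2n => h; apply: (le_trans h).
  by rewrite le_eqVlt; apply/orP; left; apply/eqP; field.
by rewrite sE t0 !mul0r.
Qed.

(* The poles are the integer multiples of w0, and translation by - w0 multiplies
   kern by e^(- mu w0). *)
Definition kern (s : C) : C := cexp (mu * s) / (cexp (freq * s) - 1).

Lemma kern_den_neq0 s : `|complex.Im s| <= b / 2 -> s != 0 -> cexp (freq * s) - 1 != 0.
Proof.
by move=> sb; apply: contra_neq => /eqP; rewrite subr_eq0 => /eqP; exact: cexp_freq_eq1.
Qed.

Lemma cder_kern_den s : cder (fun s => cexp (freq * s) - 1) s (freq * cexp (freq * s)).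
Proof.
by have := cderB (cder_cexp_lin freq s) (cder_cst 1 s); rewrite subr0.
Qed.

Lemma cderivable_kern s : `|complex.Im s| <= b / 2 -> s != 0 -> cderivable kern s.
Proof.
move=> sb s0; eexists; apply: (cderM (cder_cexp_lin mu s)).
by apply: cderV; [exact: cder_kern_den|exact: kern_den_neq0].
Qed.

Lemma kernBw0 s : kern (s - w0) = cexp (- (mu * w0)) * kern s.
Proof.
by rewrite /kern !mulrBr !cexpD (cexpN (freq * _)) cexp_freq invr1 mulr1 mulrAC mulrC mulrA.
Qed.

Lemma kern_residue (e : R) : 0 < e -> exists2 d : R, 0 < d & forall h, h != 0 ->
  normc h < d -> normc (h * kern h - freq^-1) <= e.
Proof.
move=> e0; have E0 : cexp (freq * 0) - 1 = 0 :> C by rewrite mulr0 cexp0 subrr.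
have dE : cder (fun s => cexp (freq * s) - 1) 0 freq.
  by have := cder_kern_den 0; rewrite mulr0 cexp0 mulr1.
have gc : ccont (fun s => cexp (mu * s)) 0.
  by apply: cderivable_ccont; eexists; exact: cder_cexp_lin.
have [d d0 P] := residue_mul gc (simple_pole freq_neq0 E0 dE) e0.
by exists d => // h h0 hd; have := P h h0 hd; rewrite mulr0 cexp0 mul1r.
Qed.

Hypotheses (mu0 : 0 < complex.Re mu) (mu1 : complex.Re mu < complex.Re freq).

(** The modulus of [kern] behaves like [e^(Re mu x)] as [x -> -oo] and like
    [e^((Re mu - Re freq) x)] as [x -> +oo], so the two hypotheses on [Re mu] give exponential decay
    at rate [de], which dominates [lorentz]. *)
Lemma kern_decay : exists A X : R, 0 <= A /\ forall x y : R, `|y| <= b / 2 -> X <= `|x| ->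
  normc (kern (x +i* y)) <= A * lorentz x.
Proof.
pose m := complex.Re mu; pose be := complex.Re freq.
pose c1 := `|complex.Im mu| * (b / 2); pose c2 := `|complex.Im freq| * (b / 2).
have c20 : 0 <= c2 by rewrite mulr_ge0// divr_ge0// ltW.
have Re_le (v : C) x y : `|y| <= b / 2 ->
    `|complex.Re (v * (x +i* y)) - complex.Re v * x| <= `|complex.Im v| * (b / 2).
  move=> yb; rewrite !ReIm /= (_ : _ - _ = - (complex.Im v * y)); last by ring.
  by rewrite normrN normrM ler_wpM2l.
pose de := Num.min m (be - m).
have de0 : 0 < de by rewrite lt_min mu0 subr_gt0.
pose A0 := 2 * expR (c1 + c2).
(* Beyond this abscissa the real part of [freq * s] is at least 1 or at most -1, so
   [cexp (freq * s)] has modulus at least 2 or at most [1 / 2] and the denominator of [kern] is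
   bounded below. The factor [1 + 4 / de ^+ 2] is the price of passing from exponential decay to
   [lorentz]. *)
exists (A0 * (1 + 4 / de ^+ 2)), ((c2 + 1) / be).
have A00 : 0 < A0 by rewrite mulr_gt0// expR_gt0.
split.
  by rewrite mulr_ge0 ?(ltW A00)// addr_ge0// divr_ge0// exprn_ge0// ltW.
move=> x y yb xX.
have suff1 : normc (kern (x +i* y)) <= A0 * expR (- (de * `|x|)).
  have := Re_le mu x y yb; rewrite -/c1 -/m => /ler_normlP[_ h1].
  have /ler_normlP[h2 h3] := Re_le freq x y yb; rewrite -/c2 -/be in h2 h3.
  rewrite /kern normcM normcV normc_cexp.
  move: xX; rewrite ler_pdivrMr ?Re_freq// -/be => xX.
  have e12 : 2 <= expR (1 : R) by have := @expR_ge1Dx R 1; lra.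
  have d1 : de <= m by rewrite ge_min lexx.
  have d2 : de <= be - m by rewrite ge_min lexx orbT.
  set s := x +i* y in h1 h2 h3 *.
  (* To be used with [t = Re (freq * s)] on the right, where the exponential dominates the
     denominator, and with [t = 0] on the left, where the denominator is close to -1. *)
  have key (t : R) : (normc (cexp (freq * s) - 1))^-1 <= 2 * expR (- t) ->
      complex.Re (mu * s) - t <= c1 + c2 - de * `|x| ->
      expR (complex.Re (mu * s)) / normc (cexp (freq * s) - 1) <=
      A0 * expR (- (de * `|x|)).
    move=> t1 t2; have := ler_wpM2l (expR_ge0 (complex.Re (mu * s))) t1.
    move=> /le_trans; apply; rewrite mulrCA -expRD /A0 -mulrA -expRD ler_pM2l//.
    by rewrite ler_expR.
  have [x0|x0] := leP 0 x.
    rewrite ger0_norm// in xX d1 d2 key *.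
    apply: (key (complex.Re (freq * s))).
      have E2 : 2 <= normc (cexp (freq * s)).
        by rewrite normc_cexp; apply: (le_trans e12); rewrite ler_expR; lra.
      have := ler_normcB2 (cexp (freq * s)) (- 1); rewrite normc_opp normc1 => h.
      rewrite expRN -normc_cexp -[2]invrK -invfM lef_pV2 ?posrE; lra.
    by have := ler_wpM2r x0 d2; lra.
  rewrite ltr0_norm// in xX key *.
  apply: (key 0).
    have E2 : normc (cexp (freq * s)) <= 2^-1.
      rewrite normc_cexp; apply: (@le_trans _ _ (expR (- 1))); first by rewrite ler_expR; lra.
      by rewrite expRN lef_pV2 ?posrE//; lra.
    have := ler_normcB2 (- 1) (cexp (freq * s)); rewrite normc_opp normc1 (addrC (-1)) => h.
    rewrite oppr0 expR0 mulr1 -[leRHS]invrK lef_pV2 ?posrE; lra.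
  have nx : 0 <= - x by lra.
  by have := ler_wpM2r nx d1; lra.
apply: le_trans suff1 _; rewrite -mulrA ler_pM2l//.
set t := de * `|x|; have t0 : 0 <= t by rewrite mulr_ge0// ltW.
(* The square of [1 + t / 2 <= expR (t / 2)]. *)
have et : 1 + t ^+ 2 / 4 <= expR t.
  rewrite (_ : t = t / 2 + t / 2); last by field.
  rewrite expRD; have := @expR_ge1Dx R (t / 2); nra.
have d2 : 0 < de ^+ 2 by rewrite exprn_gt0.
have tE : 1 + x ^+ 2 <= (1 + 4 / de ^+ 2) * (1 + t ^+ 2 / 4).
  rewrite /t exprMn real_normK ?num_real//.
  have Q (d q : R) : d != 0 -> (1 + 4 / d) * (1 + d * q / 4) = 1 + q + (d * q / 4 + 4 / d).
    by move=> ?; field.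
  rewrite Q ?gt_eqF// lerDl; apply: addr_ge0; apply: divr_ge0 => //; last exact: ltW.
  by apply: mulr_ge0; [exact: ltW|exact: sqr_ge0].
have K0 : 0 <= 1 + 4 / de ^+ 2 by rewrite addr_ge0// divr_ge0// ltW.
have p0 : 0 < 1 + x ^+ 2 by have := sqr_ge0 x; lra.
rewrite expRN /lorentz ler_pdivlMr// mulrC ler_pdivrMr ?expR_gt0//.
exact: (le_trans tE (ler_wpM2l K0 et)).
Qed.

(** These lines avoid the pole, so compactness covers the bounded range of [x] that [kern_decay]
    leaves open; on it [lorentz] is at least [(1 + Y ^+ 2)^-1]. *)
Lemma kern_line y : `|y| = b / 2 -> exists2 A : R, 0 <= A &
  forall x : R, normc (kern (x +i* y)) <= A * lorentz x.
Proof.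
move=> yb; have [A [X [A0 AX]]] := kern_decay.
pose Y := `|X|; have Y0 : - Y <= Y by have := normr_ge0 X; rewrite -/Y; lra.
have y0 : y != 0 by rewrite -normr_eq0 yb gt_eqF// divr_gt0.
have rc x : - Y <= x <= Y -> rcont (fun x => kern (x +i* y)) x.
  move=> _; apply: ccont_h; apply/cderivable_ccont/cderivable_kern; rewrite ?yb//.
  by rewrite complex_neq0// y0 orbT.
have [B B0 BP] := rcont_bounded Y0 rc.
exists (A + B * (1 + Y ^+ 2)).
  by rewrite addr_ge0// mulr_ge0// addr_ge0// sqr_ge0.
move=> x; have l0 := ltW (lorentz_gt0 x).
have Y2 := sqr_ge0 Y.
have [Yx|xY] := leP Y `|x|.
  apply: (le_trans (AX x y _ _)); rewrite ?yb//.
    by apply: le_trans Yx; exact: ler_norm.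
  by rewrite ler_wpM2r// lerDl mulr_ge0// addr_ge0.
apply: (le_trans (BP x _)); first by rewrite -ler_norml ltW.
apply: (@le_trans _ _ (B * (1 + Y ^+ 2) * lorentz x)); last by rewrite ler_wpM2r// lerDr.
rewrite -mulrA -[leLHS]mulr1 ler_wpM2l// /lorentz ler_pdivlMr; last by have := sqr_ge0 x; lra.
have xY2 : x ^+ 2 <= Y ^+ 2.
  by rewrite -(real_normK (num_real x)) lerXn2r ?nnegrE ?normr_ge0 ?(ltW xY).
by rewrite mul1r lerD2l.
Qed.

Lemma kern_bound : exists A X : R, [/\ 0 <= A,
  forall x y : R, - (b / 2) <= y <= b / 2 -> X <= `|x| -> normc (kern (x +i* y)) <= A * lorentz x,
  forall x : R, normc (kern (x +i* (- (b / 2)))) <= A * lorentz x &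
  forall x : R, normc (kern (x +i* (b / 2))) <= A * lorentz x].
Proof.
have b2 : 0 < b / 2 by rewrite divr_gt0.
have [A1 [X [A10 P1]]] := kern_decay.
have [|A2 A20 P2] := @kern_line (- (b / 2)); first by rewrite normrN gtr0_norm.
have [|A3 A30 P3] := @kern_line (b / 2); first by rewrite gtr0_norm.
exists (A1 + A2 + A3), X; split; first lra.
- move=> x y yb xX; apply: (le_trans (P1 x y _ xX)); first by rewrite ler_norml.
  by rewrite ler_wpM2r ?(ltW (lorentz_gt0 x))//; lra.
- by move=> x; apply: (le_trans (P2 x)); rewrite ler_wpM2r ?(ltW (lorentz_gt0 x))//; lra.
- by move=> x; apply: (le_trans (P3 x)); rewrite ler_wpM2r ?(ltW (lorentz_gt0 x))//; lra.
Qed.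

End kernel.

(** From a logarithm [u] of [z] one gets the exponent [- u / w0]. Multiples of [freq w0] can be
    subtracted freely, which brings the real part into [[0, Re (freq w0)[]. The value 0 would make
    [mu] imaginary and put [z] on the curve excluded by the last hypothesis, which runs over all
    real [t]. *)
Lemma kernel_exponent (R : realType) (w0 z : R[i]) : 0 < complex.Im w0 -> z != 0 ->
  (forall t : R, z != cexp ('i * w0 * t%:C)) ->
  exists mu, [/\ cexp (- (mu * w0)) = z, 0 < complex.Re mu &
    complex.Re mu < complex.Re (freq w0)].
Proof.
move=> b0 z0 zt.
have w00 : w0 != 0 by apply: contraTneq b0 => ->; rewrite ltxx.
have f0 := Re_freq b0.
have [u uz] := cexp_surj z0.
pose mu1 := - (u / w0).
pose n := Num.floor (complex.Re mu1 / complex.Re (freq w0)).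
pose mu := mu1 - n%:~R * freq w0.
have muz : cexp (- (mu * w0)) = z.
  rewrite /mu /mu1 (_ : - _ = u + n%:~R * (freq w0 * w0)); last by field.
  by rewrite cexpD cexp_Mint ?mulr1// cexp_freq.
have Rmu : complex.Re mu = complex.Re mu1 - n%:~R * complex.Re (freq w0).
  have nE : n%:~R = (n%:~R : R)%:C :> R[i] by rewrite rmorph_int.
  have H (v w : R[i]) (m : R) : complex.Re (v - m%:C * w) = complex.Re v - m * complex.Re w.
    by rewrite !ReIm /=; ring.
  by rewrite /mu nE H.
have /andP[n1 n2] := floor_itv (complex.Re mu1 / complex.Re (freq w0)).
rewrite ler_pdivlMr// in n1; rewrite ltr_pdivrMr// in n2.
exists mu; split => //; last by rewrite Rmu; move: n2; rewrite -/n intrD mulrDl mul1r; lra.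
rewrite lt_neqAle; apply/andP; split; last by rewrite Rmu; move: n1; rewrite -/n; lra.
apply/eqP => /esym R0.
have /eqP := zt (- complex.Im mu); apply; rewrite -muz {1}(imaginaryE R0).
by congr cexp; rewrite rmorphN /=; ring.
Qed.

(** * Translations as linear operators, and the resolvent *)

Section translation_operator.
Variables (R : realType) (k : hspace_kind R).
Local Notation C := R[i].
Implicit Types (F G : hspace k) (v z : C).

Lemma hspace_ext F G : (forall z, 0 < complex.Im z -> uhp_ext F z = uhp_ext G z) -> F = G.
Proof.
by move=> h; apply/val_inj/funext => w; have := h (uval w) (uvalP w); rewrite !uhp_extE.
Qed.

Lemma uhp_ext_hspaceD F G z : uhp_ext (F + G : hspace k) z = uhp_ext F z + uhp_ext G z.
Proof. by rewrite /uhp_ext; case: insubP => [w _ _|_] //=; rewrite addr0. Qed.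

Lemma uhp_ext_hspaceZ (c : C) F z : uhp_ext (c *: F : hspace k) z = c * uhp_ext F z.
Proof. by rewrite /uhp_ext; case: insubP => [w _ _|_] //=; rewrite mulr0. Qed.

Lemma uhp_ext_hspaceB F G z : uhp_ext (F - G : hspace k) z = uhp_ext F z - uhp_ext G z.
Proof. by rewrite -[- G]scaleN1r uhp_ext_hspaceD uhp_ext_hspaceZ mulN1r. Qed.

Lemma nHD F G : nH k (F + G : hspace k) <= nH k F + nH k G.
Proof.
by have := @Defs.hnormD R k F G; rewrite /hnorm -rmorphD lecR.
Qed.

Lemma nHZ (c : C) F : nH k (c *: F : hspace k) = normc c * nH k F.
Proof.
by have := @Defs.hnormZ R k c F; rewrite /hnorm normc_norm -rmorphM => -[].
Qed.

Lemma nHN F : nH k (- F : hspace k) = nH k F.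
Proof. by rewrite -scaleN1r nHZ normc_opp normc1 mul1r. Qed.

Lemma nHB F G : nH k (F - G : hspace k) <= nH k F + nH k G.
Proof. by rewrite -[nH k G]nHN nHD. Qed.

Lemma nH0 : nH k (0 : hspace k) = 0.
Proof. by rewrite -(scale0r 0) nHZ normc0 mul0r. Qed.

Lemma nH_eq0 F : nH k F = 0 -> F = 0.
Proof. by move=> F0; apply/eqP; rewrite -normr_eq0 norm_hspace F0. Qed.

(** The default 0 for [Im v < 0] makes [trans v] linear for every [v], so that it carries a
    canonical linear structure without a side condition. *)
Lemma trans_exists v F : exists G : hspace k,
  if 0 <= complex.Im v then (G : uhp R -> C^o) = uhp_shift v F else G = 0.
Proof.
have [v0|v0] := leP 0 (complex.Im v); last by exists 0.
by have [K _ /(_ v F v0)[G GE _]] := hspace_shift k; exists G.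
Qed.

Definition trans v F : hspace k := sval (cid (trans_exists v F)).

Lemma transE v F z : 0 <= complex.Im v -> 0 < complex.Im z ->
  uhp_ext (trans v F) z = uhp_ext F (z + v).
Proof.
move=> v0 z0; rewrite /trans; case: cid => G /=; rewrite v0 => ->.
exact: uhp_ext_shift.
Qed.

Lemma trans_out v F : complex.Im v < 0 -> trans v F = 0.
Proof. by move=> v0; rewrite /trans; case: cid => G /=; rewrite lt_geF. Qed.

Lemma trans_linear v : linear (trans v).
Proof.
move=> c F G; have [v0|v0] := leP 0 (complex.Im v); last first.
  by rewrite !trans_out// scaler0 addr0.
apply: hspace_ext => z z0; rewrite transE// !uhp_ext_hspaceD !uhp_ext_hspaceZ !transE//.
Qed.

HB.instance Definition _ v := GRing.isLinear.Build _ _ _ _ (trans v) (@trans_linear v).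

Lemma trans_bound : exists2 K : R, 0 <= K & forall v F, nH k (trans v F) <= K * nH k F.
Proof.
have [K K0 KP] := hspace_shift k; exists K => // v F.
have [v0|v0] := leP 0 (complex.Im v); last first.
  by rewrite trans_out// nH0 mulr_ge0// nH_ge0.
have [G GE GK] := KP v F v0.
suff -> : trans v F = G by [].
by apply: hspace_ext => z z0; rewrite transE// GE uhp_ext_shift.
Qed.

End translation_operator.

Section resolvent.
Variables (R : realType) (k : hspace_kind R).
Local Notation leb := (@lebesgue_measure R).
Local Notation mR := (measurableTypeR R).
Local Notation C := R[i].
Implicit Types (F G : hspace k) (v z : C).

Lemma cint_shift (c : R) (h : R -> C) : cintegrable (setT : set mR) h ->
  cint setT (fun x => h (c + x)) = cint setT h.
Proof.
move=> [h1 h2]; rewrite /cint /Rintegral.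
have H (f : R -> R) : leb.-integrable setT (EFin \o f) ->
    (\int[leb]_x (f (c + x))%:E = \int[leb]_x (f x)%:E)%E.
  move=> i; have := integral_shift c measurableT (measurable_int _ i).
  by rewrite preimage_setT.
by rewrite (H _ h1) (H _ h2).
Qed.

Lemma cintegrable_shift (c : R) (h : R -> C) : cintegrable (setT : set mR) h ->
  cintegrable (setT : set mR) (fun x => h (c + x)).
Proof.
move=> [h1 h2]; split.
  by have := integrable_shift c measurableT h1; rewrite preimage_setT.
by have := integrable_shift c measurableT h2; rewrite preimage_setT.
Qed.

Variables (w0 la : C).
Let b := complex.Im w0.
Hypotheses (b0 : 0 < b) (la0 : la != 0).
Hypothesis la_spiral : forall t : R, la != cexp ('i * w0 * t%:C).

(* With b = Im w0, S F (z) = int kern (x - i b/2) F (z + w0 + x - i b/2) dx; raising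
   the line of integration by i b crosses the pole at 0 and turns S F into
   la^-1 C S F. *)
Lemma resolvent_kernel : exists (c : C) (S : hspace k -> hspace k) (K : R),
  [/\ c != 0, 0 <= K,
   linear S, forall F, nH k (S F) <= K * nH k F &
   (forall F, S (trans w0 F) = trans w0 (S F)) /\
   (forall F, trans w0 (S F) - la *: S F = c *: trans w0 F)].
Proof.
have [mu [muE mu0 mu1]] := kernel_exponent b0 la0 la_spiral.
have [A [X [A0 PX Plow Phigh]]] := kern_bound b0 mu0 mu1.
pose J x : C := kern w0 mu (x +i* (- (b / 2))).
have b2 : 0 < b / 2 by rewrite divr_gt0.
have Jc x : rcont J x.
  apply: ccont_h; apply/cderivable_ccont/(cderivable_kern _ b0).
    by rewrite /= normrN gtr0_norm.
  by rewrite complex_neq0// oppr_eq0 (gt_eqF b2) orbT.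
have [K K0 KP] := avg_hspace k Jc A0 Plow.
have /choice[S0 S0P] : forall F, exists G : hspace k,
    (forall z, 0 < complex.Im z -> uhp_ext G z = avg J F z) /\ nH k G <= K * nH k F.
  by move=> F; have [G h1 h2] := KP F; exists G.
have [Kt Kt0 KtP] := trans_bound k.
(* With this shift the integration line of [S F] at [z] is the lower edge of a strip of height [b]
   centred at [z + w0], so crossing the pole produces [F (z + w0)], the value of [trans w0 F] at
   [z]. *)
pose v := w0 - 'i * (b / 2)%:C.
have v0 : 0 <= complex.Im v by rewrite /v ImD ImN Im_iM; move: b2; rewrite -/b; lra.
pose S F := S0 (trans v F).
have SE F z : 0 < complex.Im z ->
    uhp_ext (S F) z = cint setT (fun x => J x * uhp_ext F (z + x%:C + v)).
  move=> z0; have [-> // _] := S0P (trans v F); apply: eq_cint => x _.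
  by rewrite transE// ImD /= addr0.
have Si F z : 0 < complex.Im z ->
    cintegrable (setT : set mR) (fun x => J x * uhp_ext F (z + x%:C + v)).
  move=> z0; have := cintegrable_avg Jc Plow (trans v F) z0.
  by apply: eq_cintegrable => // x _; rewrite transE// ImD /= addr0.
have Slin : linear S.
  move=> c F G; apply: hspace_ext => z z0.
  rewrite uhp_ext_hspaceD uhp_ext_hspaceZ !SE// -cintZ//; last exact: Si.
  rewrite -cintD//; [|exact: cintegrableZ (Si _ _ z0)|exact: Si].
  by apply: eq_cint => x _; rewrite uhp_ext_hspaceD uhp_ext_hspaceZ; ring.
have w00 : 0 <= complex.Im w0 by exact: ltW.
have Scomm F : S (trans w0 F) = trans w0 (S F).
  apply: hspace_ext => z z0.
  have zw : 0 < complex.Im (z + w0) by rewrite ImD addr_gt0.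
  rewrite transE// !SE//; apply: eq_cint => x _.
  rewrite transE//; first by congr (_ * uhp_ext F _); ring.
  by rewrite (ImD _ v) ImD /= addr0 ltr_wpDr.
pose r := (freq w0)^-1 * wind R.
have r0 : r != 0 by rewrite mulf_neq0 ?wind_neq0// invr_neq0// freq_neq0.
(* The strip gives [S F - la^-1 * trans w0 (S F) = r * trans w0 F] at every point; multiplication by
   [- la] puts it into the required form. *)
exists (- la * r), S, (K * Kt); split => //.
- by rewrite mulf_neq0// oppr_eq0.
- exact: mulr_ge0.
- move=> F; have [_ h] := S0P (trans v F); apply: (le_trans h).
  by rewrite -mulrA ler_wpM2l.
split => // F; apply: hspace_ext => z z0.
have zw : 0 < complex.Im (z + w0) by rewrite ImD addr_gt0.
rewrite uhp_ext_hspaceB !uhp_ext_hspaceZ !transE// !SE//.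
pose p := z + w0.
have Ip : complex.Im p = complex.Im z + b by rewrite /p ImD.
pose g s := uhp_ext F (s + p).
pose B := Num.sqrt (pt_bound k (complex.Im z)) * nH k F.
have gd x y : - (b / 2) <= y <= b / 2 -> cderivable g (x +i* y).
  move=> yb; have [l lP] : cderivable (uhp_ext F) (x +i* y + p).
    apply: (holomorphicE F).1; first exact: hspace_holomorphic.
    by rewrite ImD Ip /=; lra.
  by exists l; exact: cder_shift.
have gB x y : - (b / 2) <= y <= b / 2 -> normc (g (x +i* y)) <= B.
  move=> yb; apply: eval_bound => //.
  by rewrite ImD Ip /=; lra.
have Kd x y : - (b / 2) <= y <= b / 2 -> x +i* y != 0 -> cderivable (kern w0 mu) (x +i* y).
  by move=> yb xy; apply: cderivable_kern => //=; rewrite ler_norml.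
have nb2 : - (b / 2) < 0 by rewrite oppr_lt0.
have := strip_residue nb2 b2 A0 gd gB Kd (kern_residue mu b0) PX Plow Phigh.
set T := cint setT (fun x => J x * uhp_ext F (z + w0 + x%:C + v)).
set U := cint setT (fun x => J x * uhp_ext F (z + x%:C + v)).
have -> : cint setT (fun x => g (x +i* (- (b / 2))) * kern w0 mu (x +i* (- (b / 2)))) = U.
  apply: eq_cint => x _; rewrite mulrC; congr (_ * uhp_ext F _).
  by apply/eqP; rewrite eq_complex /v /p !ReIm /=; apply/andP; split; apply/eqP; ring.
have -> : cint setT (fun x => g (x +i* (b / 2)) * kern w0 mu (x +i* (b / 2))) = la^-1 * T.
  (* Translation by [- w0] maps the upper line to the lower one but also moves it horizontally by
     [- Re w0], which the integral does not notice. *)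
  rewrite /T -(cint_shift (- complex.Re w0) (Si F _ zw)) -cintZ//; last first.
    exact: cintegrable_shift (Si F _ zw).
  apply: eq_cint => x _; rewrite /J.
  have := kernBw0 mu b0 (x +i* (b / 2)); rewrite muE.
  rewrite (_ : x +i* (b / 2) - w0 = (- complex.Re w0 + x) +i* (- (b / 2))); last first.
    by apply/eqP; rewrite eq_complex !ReIm /= -/b; apply/andP; split; apply/eqP; field.
  move=> ->.
  have E (l u t : C) : l != 0 -> l^-1 * (l * u * t) = t * u by move=> ?; field.
  rewrite E//; congr (uhp_ext F _ * _).
  by apply/eqP; rewrite eq_complex /v /p !ReIm /= -/b; apply/andP; split; apply/eqP; field.
rewrite /g add0r -/p => h.
rewrite (_ : uhp_ext F p * _ * _ = uhp_ext F p * r) in h; last by rewrite /r mulrA.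
have E (t u l f rr : C) : l != 0 -> u - l^-1 * t = f * rr -> t - l * u = - l * rr * f.
  by move=> l0 H; rewrite -mulrA [rr * f]mulrC -H; field.
exact: E h.
Qed.

(** Write [C] for [trans w0]. By [resolvent_kernel], [C G] is the image of [c^-1 *: S G] under
    [C - la], and [la *: G] is [C G] minus the image of [G]. This determines the preimage. *)
Lemma resolvent_surj : exists2 K : R, 0 <= K &
  forall G, exists2 F, trans w0 F - la *: F = G & nH k F <= K * nH k G.
Proof.
have [c [S [K [c0 K0 Sl SK [_ SE]]]]] := resolvent_kernel.
exists ((normc la)^-1 * (normc c^-1 * K + 1)).
  by rewrite mulr_ge0 ?invr_ge0 ?normc_ge0// addr_ge0// mulr_ge0// normc_ge0.
move=> G; exists (la^-1 *: (c^-1 *: S G - G)).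
  rewrite !linearZ/= scalerA mulfV// scale1r linearB linearZ /=.
  have -> : trans w0 (S G) = la *: S G + c *: trans w0 G by rewrite -SE addrC subrK.
  rewrite (scalerDr c^-1) (scalerA c^-1 c) mulVf// scale1r addrK !scalerA.
  have E (x y : C) : y != 0 -> y^-1 * x * y = x by move=> ?; field.
  by rewrite E// subKr.
rewrite nHZ normcV -mulrA ler_wpM2l ?invr_ge0 ?normc_ge0// mulrDl mul1r.
apply: (le_trans (nHB _ _)); rewrite lerD2r nHZ -mulrA ler_wpM2l ?normc_ge0//.
Qed.

(** Since [S] commutes with [trans w0], the function [S F] is in the kernel of [trans w0 - la] as
    well, so [c *: trans w0 F = (c * la) *: F] is 0. *)
Lemma resolvent_inj F : trans w0 F = la *: F -> F = 0.
Proof.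
have [c [S [K [c0 K0 Sl SK [SC SE]]]]] := resolvent_kernel.
move=> TF; have S0 : S 0 = 0 by have := Sl (-1) 0 0; rewrite scaler0 addr0 scaleN1r addNr.
have SZ a G : S (a *: G) = a *: S G by have := Sl a G 0; rewrite !addr0 S0 addr0.
have := SE F; rewrite -SC TF SZ subrr => /esym/eqP.
by rewrite scalerA scaler_eq0 mulf_eq0 (negPf c0) (negPf la0) => /eqP.
Qed.

End resolvent.

(** * Neumann series and the open mapping theorem *)

Section geometric_convergence.
Variables (R : realType) (k : hspace_kind R).
Local Notation C := R[i].
Implicit Types (F G : hspace k) (v : C).

Lemma geometric_small (q x B : R) : 0 <= q < 1 -> (forall n, x <= B * q ^+ n) -> x <= 0.
Proof.
move=> /andP[q0 q1] h.
have qn : q ^+ n @[n --> \oo] --> (0 : R).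
  by apply: cvg_expr; rewrite ger0_norm.
have : B * q ^+ n @[n --> \oo] --> B * 0 by apply: cvgMr.
rewrite mulr0 => cB.
rewrite -(cvg_lim _ cB)//; apply: limr_ge; first by apply: cvgP cB.
exact: nearW.
Qed.

(** The common source of limits for the Neumann series, for Baire's argument and for the successive
    approximations of the open mapping theorem; it rests on [hspace_complete]. *)
Lemma geometric_limit (u : nat -> hspace k) (e : nat -> R) (q : R) : 0 <= q < 1 ->
  (forall n, 0 <= e n) -> (forall n, e n.+1 <= q * e n) ->
  (forall n, nH k (u n.+1 - u n) <= e n) ->
  exists l : hspace k, forall n, nH k (u n - l) <= e n / (1 - q).
Proof.
move=> /[dup] q01 /andP[q0 q1] e0 eq h.
have q10 : 0 < 1 - q by lra.
have enm n m : e (n + m)%N <= q ^+ m * e n.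
  elim: m => [|m IH]; first by rewrite addn0 expr0 mul1r.
  by rewrite addnS exprS -mulrA (le_trans (eq _))// ler_wpM2l.
have hm n m : nH k (u (n + m)%N - u n) <= e n / (1 - q) * (1 - q ^+ m).
  elim: m => [|m IH]; first by rewrite addn0 !subrr nH0 mulr0.
  rewrite addnS (_ : _ - _ = (u (n + m).+1 - u (n + m)%N) + (u (n + m)%N - u n)); last by rewrite addrA subrK.
  apply: (le_trans (nHD _ _)); apply: (le_trans (lerD (le_trans (h _) (enm _ _)) IH)).
  rewrite le_eqVlt; apply/orP; left; apply/eqP; rewrite [in RHS]exprS; field.
  by rewrite gt_eqF.
have hm' n m : nH k (u (n + m)%N - u n) <= e n / (1 - q).
  apply: (le_trans (hm n m)); rewrite ler_piMr ?divr_ge0// ?(ltW q10)//.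
  by rewrite gerDl oppr_le0 exprn_ge0.
have [l lP] : exists l : hspace k, forall d : R, 0 < d -> exists N, forall n, (N <= n)%N ->
     nH k (u n - l) <= d.
  apply: hspace_complete => d d0.
  have [N PN] : exists N, e 0%N / (1 - q) * q ^+ N <= d / 2.
    apply: contrapT => H.
    have : d / 2 <= 0.
      apply: (@geometric_small q _ (e 0%N / (1 - q))) => // n; rewrite leNgt; apply/negP => hn.
      by apply: H; exists n; exact: ltW.
    lra.
  exists N => m n Nm Nn.
  rewrite (_ : u m - u n = (u m - u N) - (u n - u N)); last by rewrite opprB addrA subrK.
  apply: (le_trans (nHB _ _)).
  have := hm' N (m - N)%N; have := hm' N (n - N)%N; rewrite !subnKC//.
  have eN : e N / (1 - q) <= d / 2.
    apply: le_trans PN; rewrite mulrAC ler_wpM2r ?invr_ge0 ?(ltW q10)// mulrC.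
    exact: enm 0%N N.
  have E (a b c r : R) : a <= c -> b <= c -> c <= r / 2 -> b + a <= r by lra.
  by move=> h1 h2; exact: E h1 h2 eN.
exists l => n; apply/ler_addgt0Pr => d /lP[N P].
rewrite (_ : u n - l = (u (n + N)%N - l) - (u (n + N)%N - u n)); last first.
  by rewrite opprB [RHS]addrC addrA subrK.
apply: (le_trans (nHB _ _)); rewrite addrC; apply: lerD; first exact: hm'.
by apply: P; rewrite leq_addl.
Qed.

Lemma transS v n F : 0 <= complex.Im v -> trans v (trans (v *+ n) F) = trans (v *+ n.+1) F.
Proof.
move=> v0; have vn m : 0 <= complex.Im (v *+ m).
  elim: m => [|m IH]; first by rewrite mulr0n.
  by rewrite mulrS ImD addr_ge0.
apply: hspace_ext => z z0; rewrite !transE//.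
  by rewrite mulrS addrA.
by rewrite ImD ltr_wpDr.
Qed.

Lemma trans0 F : trans 0 F = F.
Proof. by apply: hspace_ext => z z0; rewrite transE// addr0. Qed.

(** The powers of [trans v] are the operators [trans (v *+ j)], all bounded by the same [K], so the
    series converges for [1 < normc la] even if the norm of [trans v] is larger than 1. *)
Lemma neumann_surj v (la : C) : 0 <= complex.Im v -> 1 < normc la ->
  exists2 K : R, 0 <= K & forall G, exists2 F, trans v F - la *: F = G & nH k F <= K * nH k G.
Proof.
move=> v0 la1; have la0 : la != 0 by rewrite -normc_gt0; lra.
have [K K0 KP] := trans_bound k.
pose q := (normc la)^-1.
have q0 : 0 < q by rewrite invr_gt0; lra.
have q1 : q < 1 by rewrite invf_lt1//; lra.
have q01 : 0 <= q < 1 by rewrite ltW.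
have q10 : 0 < 1 - q by lra.
exists (q * K / (1 - q)) => [|G]; first by apply: divr_ge0; [apply: mulr_ge0 => //; exact: ltW|exact: ltW].
(* Partial sums of the expansion of [(trans v - la)^-1 G] in powers of [la^-1]; applying
   [trans v - la] telescopes them in [Du]. *)
pose u n : hspace k := - \sum_(j < n) la^-1 ^+ j.+1 *: trans (v *+ j) G.
have uS n : u n.+1 - u n = - (la^-1 ^+ n.+1 *: trans (v *+ n) G).
  by rewrite /u big_ord_recr /= opprD [- _ - _]addrC addrK.
have nla n : normc (la^-1 ^+ n) = q ^+ n by rewrite normcX normcV.
have A0 : 0 <= q * K * nH k G by rewrite !mulr_ge0 ?nH_ge0// ltW.
have uq n : nH k (u n.+1 - u n) <= q * K * nH k G * q ^+ n.
  rewrite uS nHN nHZ nla; apply: (le_trans (ler_wpM2l _ (KP _ _))); first by rewrite exprn_ge0 ?(ltW q0).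
  by rewrite exprS le_eqVlt; apply/orP; left; apply/eqP; ring.
have [l lP'] : exists l : hspace k, forall n, nH k (u n - l) <= q * K * nH k G * q ^+ n / (1 - q).
  apply: geometric_limit => //.
    by move=> n; rewrite mulr_ge0 ?exprn_ge0 ?(ltW q0).
  by move=> n; rewrite exprS le_eqVlt; apply/orP; left; apply/eqP; ring.
have lP n : nH k (u n - l) <= q * K * nH k G / (1 - q) * q ^+ n.
  by rewrite mulrAC; exact: lP'.
have Du n : trans v (u n) - la *: u n = G - la^-1 ^+ n *: trans (v *+ n) G.
  elim: n => [|n IH].
    by rewrite /u big_ord0 oppr0 linear0 scaler0 subrr mulr0n trans0 expr0 scale1r subrr.
  rewrite -(subrK (u n) (u n.+1)) uS linearD scalerDr opprD addrACA IH.
  rewrite linearN linearZ /= transS// scalerN opprK scalerA exprS mulrA mulfV// mul1r.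
  by rewrite [- _ + _]addrC [LHS]addrC addrA subrK.
pose D F := trans v F - la *: F.
have DB X Y : D (X - Y) = D X - D Y.
  by rewrite /D linearB scalerBr /= !opprD !opprK addrACA.
have DK X : nH k (D X) <= (K + normc la) * nH k X.
  by apply: (le_trans (nHB _ _)); rewrite nHZ mulrDl lerD2r.
exists l.
  apply/eqP; rewrite -subr_eq0; apply/eqP/nH_eq0.
  apply/eqP; rewrite eq_le nH_ge0 andbT.
  apply: (@geometric_small q _ ((K + normc la) * (q * K * nH k G / (1 - q)) + K * nH k G)) => // n.
  rewrite -/(D l) -(subKr (u n) l) DB {1}/D Du addrAC [G - _]addrC addrK.
  apply: (le_trans (nHB _ _)); rewrite nHN nHZ nla mulrDl addrC.
  apply: lerD; last by rewrite mulrC ler_wpM2r ?exprn_ge0 ?(ltW q0).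
  by apply: (le_trans (DK _)); rewrite -mulrA ler_wpM2l// addr_ge0// normc_ge0.
have := lP 0%N; rewrite /u big_ord0 oppr0 add0r nHN expr0 mulr1 => /le_trans; apply.
by rewrite mulrAC.
Qed.

(** Otherwise [trans (v *+ n) F = la ^+ n *: F] would grow geometrically, against the uniform bound
    on translations. *)
Lemma neumann_inj v (la : C) F : 0 <= complex.Im v -> 1 < normc la ->
  trans v F = la *: F -> F = 0.
Proof.
move=> v0 la1 TF; have [K K0 KP] := trans_bound k.
have Tn n : trans (v *+ n) F = la ^+ n *: F.
  elim: n => [|n IH]; first by rewrite mulr0n trans0 expr0 scale1r.
  by rewrite -transS// IH linearZ /= TF scalerA exprSr.
have l0 : 0 < normc la by lra.
apply: nH_eq0; apply/eqP; rewrite eq_le nH_ge0 andbT.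
apply: (@geometric_small (normc la)^-1 _ (K * nH k F)).
  by rewrite invr_ge0 (ltW l0) invf_lt1.
move=> n; have := KP (v *+ n) F; rewrite Tn nHZ normcX => h.
by rewrite exprVn ler_pdivlMr ?exprn_gt0// mulrC.
Qed.

End geometric_convergence.

(** * Continuity, closed range and invertibility *)

Section bounded_below.
Variables (R : realType) (k : hspace_kind R).
Local Notation C := R[i].
Implicit Types (X Y F G : hspace k).

Lemma closed_nH (A : set (hspace k)) Y : closed A ->
  (forall e : R, 0 < e -> exists2 X, A X & nH k (Y - X) < e) -> A Y.
Proof.
move=> cA h; rewrite ((closure_id A).1 cA) => B /nbhs_ballP[e /= e0 Be].
have [e' eE] : exists e' : R, e = e'%:C by apply/complex_realP; rewrite gtr0_real.
move: e0 Be; rewrite {}eE ltcR => e0 Be.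
have [X AX XY] := h _ e0; exists X; split=> //.
by apply: Be; rewrite -ball_normE /= norm_hspace ltcR.
Qed.

Lemma bounded_continuous (T : {linear hspace k -> hspace k}) (K : R) :
  (forall F, nH k (T F) <= K * nH k F) -> continuous T.
Proof.
move=> TK X B /nbhs_ballP[e /= e0 Be].
have [e' eE] : exists e' : R, e = e'%:C by apply/complex_realP; rewrite gtr0_real.
move: e0 Be; rewrite {}eE ltcR => e0 Be.
have K1 : 0 < `|K| + 1 by have := normr_ge0 K; lra.
apply/nbhs_ballP; exists (e' / (`|K| + 1))%:C => /=; first by rewrite ltcR divr_gt0.
move=> Y; rewrite -ball_normE /= norm_hspace ltcR => XY.
apply: Be; rewrite -ball_normE /= -linearB norm_hspace ltcR; move: XY.
rewrite ltr_pdivlMr// => h; apply: le_lt_trans (TK _) _; apply: le_lt_trans h.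
rewrite mulrC ler_wpM2l ?nH_ge0//; have := ler_norm K; lra.
Qed.

Variable D : hspace k -> hspace k.
Hypothesis DL : linear D.

Let D0 : D 0 = 0.
Proof. by have := DL (-1) 0 0; rewrite scaler0 addr0 scaleN1r addNr. Qed.

Let DZ (a : C) X : D (a *: X) = a *: D X.
Proof. by have := DL a X 0; rewrite !addr0 D0 addr0. Qed.

Let DD X Y : D (X + Y) = D X + D Y.
Proof. by have := DL 1 X Y; rewrite !scale1r. Qed.

Let DB X Y : D (X - Y) = D X - D Y.
Proof. by rewrite DD -scaleN1r DZ scaleN1r. Qed.

Section open_mapping.
Variable M : R.
Hypothesis DM : forall F, nH k (D F) <= M * nH k F.
Hypothesis Dinj : forall F, D F = 0 -> F = 0.
Hypothesis Dcl : closed (range D).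

(* Baire's argument in the closed range: one of the sets D {F : |F| <= n} is dense
   in a ball. *)
Let baire : exists (n : nat) (X : hspace k) (r : R), 0 < r /\ forall Y, nH k (D Y - D X) <= r ->
  forall e : R, 0 < e -> exists2 F : hspace k, nH k F <= n%:R & nH k (D Y - D F) <= e.
Proof.
apply: contrapT => H.
(* If no ball works, then within [r / 4] of [D X] there is a [D Y] that keeps distance [2 * r'], for
   some [r' <= r / 4], from the images of all [F] of norm at most [n]. The condition on the radius
   is put under the existential for the sake of [choice]. *)
have step (nXr : nat * hspace k * R) : exists Yr : hspace k * R, 0 < nXr.2 ->
    [/\ 0 < Yr.2, Yr.2 <= 4^-1 * nXr.2, nH k (D Yr.1 - D nXr.1.2) <= nXr.2 / 4 &
      forall F, nH k F <= nXr.1.1%:R -> 2 * Yr.2 <= nH k (D Yr.1 - D F)].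
  case: nXr => -[n X] r /=.
  have [r0|r0] := ltP 0 r; last by exists (0, 0).
  apply: contrapT => H1; apply: H; exists n, X, (r / 4); split; first by rewrite divr_gt0.
  move=> Y YX e e0; apply: contrapT => H2; apply: H1.
  exists (Y, Num.min (r / 4) (e / 2)) => _ /=; split => //.
  - by rewrite lt_min !divr_gt0.
  - by rewrite ge_min [4^-1 * r]mulrC lexx.
  move=> F Fn; rewrite leNgt; apply/negP => h; apply: H2; exists F => //.
  have m2 : Num.min (r / 4) (e / 2) <= e / 2 by rewrite ge_min lexx orbT.
  have E (a b c : R) : a <= c / 2 -> b < 2 * a -> b <= c by lra.
  exact: E m2 h.
have [nx nxP] := choice step.
pose fix s n : hspace k * R := if n is m.+1 then nx (m, (s m).1, (s m).2) else (0, 1).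
have s0 n : 0 < (s n).2.
  by elim: n => [|n IH] //=; have [] := nxP (n, (s n).1, (s n).2) IH.
have q01 : 0 <= (4^-1 : R) < 1 by apply/andP; lra.
have [l lP] : exists l : hspace k, forall n, nH k (D (s n).1 - l) <= (s n).2 / 4 / (1 - 4^-1).
  apply: (@geometric_limit _ _ (fun n => D (s n).1) (fun n => (s n).2 / 4) 4^-1) => //.
  - by move=> n; rewrite divr_ge0// ltW.
  - move=> n; have [_ h _ _] := nxP (n, (s n).1, (s n).2) (s0 n).
    by rewrite mulrA ler_wpM2r.
  - by move=> n; have [_ _ h _] := nxP (n, (s n).1, (s n).2) (s0 n).
have sn n : (s n).2 <= 4^-1 ^+ n.
  elim: n => [|n IH]; first by rewrite expr0.
  have [_ h _ _] := nxP (n, (s n).1, (s n).2) (s0 n).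
  by apply: (le_trans h); rewrite exprS ler_wpM2l.
have [F _ Fl] : range D l.
  apply: (closed_nH Dcl) => e e0.
  have [n ne] : exists n, 4^-1 ^+ n < e.
    apply: contrapT => H1.
    have : e <= 0.
      apply: (@geometric_small R 4^-1 _ 1) => // n; rewrite mul1r leNgt; apply/negP => h.
      by apply: H1; exists n.
    lra.
  exists (D (s n).1); first by exists (s n).1.
  rewrite -opprB nHN; apply: le_lt_trans ne; apply: le_trans (lP n) _.
  have E (a b : R) : 0 < a -> a <= b -> a / 4 / (1 - 4^-1) <= b.
    by rewrite (_ : (1 - 4^-1)^-1 = 4 / 3); [lra|field].
  exact: E (s0 n) (sn n).
(* The limit [l = D F] lies within a third of the radius of stage [n.+2] from its centre. That
   centre was chosen with bound [n.+1 >= nH k F], hence at distance at least twice the radius from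
   [D F]. *)
pose n := Num.truncn (nH k F).
have nF : nH k F <= n.+1%:R by apply/ltW/truncnS_gt.
have [_ _ _ /(_ F nF)] := nxP (n.+1, (s n.+1).1, (s n.+1).2) (s0 n.+1).
have := lP n.+2; rewrite -Fl => h1 h2; have := s0 n.+2.
have E (a b : R) : b <= a / 4 / (1 - 4^-1) -> 2 * a <= b -> 0 < a -> False.
  by rewrite (_ : (1 - 4^-1)^-1 = 4 / 3); [lra|field].
exact: E h1 h2.
Qed.

(** Differences of approximants move the ball of [baire] to the origin. By scaling, each [D X] is
    approximated up to half its norm by some [D F] with [F] of size at most [K * nH k (D X)], and
    iterating this correction exhausts [X]. *)
Lemma closed_range_bounded_below : exists K : R, forall X, nH k X <= K * nH k (D X).
Proof.
have [n [X0 [r [r0 B]]]] := baire.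
have near0 Y (e : R) : nH k (D Y) <= r -> 0 < e ->
    exists2 F : hspace k, nH k F <= 2 * n%:R & nH k (D Y - D F) <= e.
  move=> Yr e0; have e2 : 0 < e / 2 by rewrite divr_gt0.
  have [|F1 F1n F1e] := B (X0 + Y) _ _ e2.
    by rewrite DD [D X0 + _]addrC addrK.
  have [|F2 F2n F2e] := B X0 _ _ e2; first by rewrite subrr nH0 ltW.
  exists (F1 - F2).
    by apply: (le_trans (nHB _ _)); rewrite mulr_natl mulr2n lerD.
  rewrite DB (_ : _ - _ = (D (X0 + Y) - D F1) - (D X0 - D F2)).
    by apply: (le_trans (nHB _ _)); rewrite [leRHS]splitr lerD.
  rewrite DD -(addrA (D X0)) (addrC (D X0)) (opprB (D X0)) addrACA subrr addr0.
  by rewrite opprB addrA addrAC.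
(* [D X] is scaled to norm [r], approximated up to [r / 2] by the image of an [F] of norm at most
   [2 * n], and scaled back. *)
pose K := 4 * n%:R / r.
have half X : exists F : hspace k, nH k F <= K * nH k (D X) /\ nH k (D X - D F) <= 2^-1 * nH k (D X).
  have [D00|Dn0] := eqVneq (nH k (D X)) 0.
    by exists 0; rewrite D0 subr0 D00 nH0 !mulr0.
  have Dp : 0 < nH k (D X) by rewrite lt_neqAle eq_sym Dn0 nH_ge0.
  pose c := r / nH k (D X); have c0 : 0 < c by rewrite divr_gt0.
  have cc : c%:C != 0 :> C by rewrite -normc_eq0 normc_real normr_eq0 gt_eqF.
  have nc : normc (c%:C) = c by rewrite normc_real gtr0_norm.
  have cD : c * nH k (D X) = r by rewrite divfK.
  have [||F Fn Fe] := near0 (c%:C *: X) (r / 2).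
  - by rewrite DZ nHZ nc cD.
  - by rewrite divr_gt0.
  exists (c%:C^-1 *: F); split.
    rewrite nHZ normcV nc mulrC ler_pdivrMr// -mulrA [nH k _ * c]mulrC cD /K divfK ?gt_eqF//.
    by apply: (le_trans Fn); rewrite ler_wpM2r// ler_nat.
  have -> : D X - D (c%:C^-1 *: F) = c%:C^-1 *: (D (c%:C *: X) - D F).
    by rewrite !DZ scalerBr scalerA mulVf// scale1r.
  rewrite nHZ normcV nc mulrC ler_pdivrMr//.
  by rewrite -mulrA [nH k _ * c]mulrC cD mulrC.
have [h hP] := choice half.
exists (2 * K) => X.
(* What is left of [X] after [j] corrections. Its image is halved each time, so the limit [l]
   satisfies [D l = 0] and vanishes by injectivity; the distance from [x 0 = X] to [l] is then the
   norm of [X]. *)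
pose fix x j := if j is i.+1 then x i - h (x i) else X.
have xS j : nH k (D (x j.+1)) <= 2^-1 * nH k (D (x j)).
  by rewrite /= DB; have [] := hP (x j).
have K0 : 0 <= K by rewrite divr_ge0 ?mulr_ge0 ?(ltW r0).
have q01 : 0 <= (2^-1 : R) < 1 by apply/andP; lra.
have [l lP] : exists l : hspace k, forall j, nH k (x j - l) <= K * nH k (D (x j)) / (1 - 2^-1).
  apply: (@geometric_limit _ _ x (fun j => K * nH k (D (x j))) 2^-1) => //.
  - by move=> j; rewrite mulr_ge0 ?nH_ge0.
  - by move=> j; rewrite mulrCA ler_wpM2l.
  - by move=> j; rewrite /= addrAC subrr add0r nHN; have [] := hP (x j).
have xj j : nH k (D (x j)) <= nH k (D X) * 2^-1 ^+ j.
  elim: j => [|j IH]; first by rewrite expr0 mulr1.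
  by apply: (le_trans (xS j)); rewrite exprS mulrCA ler_wpM2l.
have l0 : l = 0.
  apply/Dinj/nH_eq0/eqP; rewrite eq_le nH_ge0 andbT.
  apply: (@geometric_small R 2^-1 _ (nH k (D X) * (`|M| * K * 2 + 1))) => // j.
  rewrite -(subKr (x j) l) DB.
  apply: (le_trans (nHB _ _)).
  have h1 := DM (x j - l); have h2 := lP j; have h3 := xj j.
  have E (a b c p m t q : R) : 0 <= c -> 0 <= t -> a <= p * q -> b <= m * c ->
      c <= t * a / (1 - 2^-1) -> a + b <= p * (`|m| * t * 2 + 1) * q.
    rewrite (_ : (1 - 2^-1)^-1 = 2); last by field.
    move=> c0 t0 ap bc ca; have h4 := ler_wpM2r c0 (ler_norm m).
    have h5 := ler_wpM2l (normr_ge0 m) ca.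
    have h6 := ler_wpM2l (mulr_ge0 (normr_ge0 m) t0) ap.
    rewrite (_ : p * _ * q = `|m| * t * (p * q) * 2 + p * q); last by ring.
    by lra.
  exact: E (nH_ge0 _ _) K0 h3 h1 h2.
have := lP 0%N; rewrite l0 subr0 /=.
have E (a b : R) : a <= b / (1 - 2^-1) -> a <= 2 * b.
  by rewrite (_ : (1 - 2^-1)^-1 = 2); [lra|field].
by move=> /E; rewrite mulrA.
Qed.

End open_mapping.

(** Uniqueness makes the chosen solution linear in [G], and the estimate makes it continuous. *)
Lemma invertible_of_solvable (K : R) :
  (forall G, exists2 F : hspace k, D F = G & nH k F <= K * nH k G) ->
  (forall F, D F = 0 -> F = 0) -> invertible_op D.
Proof.
move=> surj inj.
have /choice[S0 S0P] : forall G, exists F : hspace k, D F = G /\ nH k F <= K * nH k G.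
  by move=> G; have [F h1 h2] := surj G; exists F.
have injD X Y : D X = D Y -> X = Y.
  by move=> XY; apply/eqP; rewrite -subr_eq0; apply/eqP/inj; rewrite DB XY subrr.
have S0L : linear S0.
  by move=> a F G; apply: injD; rewrite DL !(S0P _).1.
pose S : {linear hspace k -> hspace k} :=
  HB.pack S0 (GRing.isLinear.Build _ _ _ _ S0 S0L).
exists S; split.
- by apply: (@bounded_continuous _ K) => F; have [] := S0P F.
- by move=> F; apply: injD; have [] := S0P (D F).
- by move=> F; have [] := S0P F.
Qed.

Lemma invertible_fredholm : invertible_op D -> fredholm D.
Proof.
move=> [S [_ DS SD]]; split.
- exists 0%N, (fun=> 0) => v /= Dv; exists (fun=> 0); rewrite big_ord0.
  by rewrite -(DS v) Dv linear0.
- rewrite (_ : range D = setT); first exact: closedT.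
  by apply/seteqP; split=> // v _; exists (S v).
- exists 0%N, (fun=> 0) => v; exists v; first by exists (S v).
  by exists (fun=> 0); rewrite big_ord0 addr0.
Qed.

End bounded_below.

(** * Approximate eigenvectors and injectivity *)

Section test_functions.
Variables (R : realType) (k : hspace_kind R).
Local Notation leb := (@lebesgue_measure R).
Local Notation mR := (measurableTypeR R).
Local Notation C := R[i].
Local Notation lam := (\int[leb]_x lorentz x).

Lemma measurable_lorentzX n : measurable_fun setT (fun y : mR => (lorentz y ^+ n)%:E).
Proof.
apply/measurable_EFinP; apply: measurable_funX.
exact: continuous_measurable_fun (@continuous_lorentz R).
Qed.

Lemma lorentz_le1 (y : R) : lorentz y <= 1.
Proof. by rewrite /lorentz invf_le1; have := sqr_ge0 y; lra. Qed.

Lemma energy_lorentzX : exists (n : nat) (B : R), 0 <= B /\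
  (energy k (fun y : mR => (lorentz y ^+ n)%:E) <= B%:E)%E.
Proof.
case: k => [|al al1] /=.
  exists 0%N, 1; split => //; apply: ge_ereal_sup => _ [y /= y0 <-].
  by rewrite expr0.
have a0 : 0 < al + 1 by lra.
(* For [y >= 1] the factor [lorentz y ^+ n] absorbs [y ^ al], since [al <= 2 * n], and one more
   factor [lorentz y] remains for integrability. For [y <= 1] the weight alone is integrable. *)
pose n := (Num.truncn `|al|).+1.
have L0 := lorentz_mass_ge0 R.
exists n.+1, ((al + 1)^-1 + lam); split; first by rewrite addr_ge0// invr_ge0 ltW.
have M0 (y : R) m : 0 <= lorentz y ^+ m by rewrite exprn_ge0// ltW// lorentz_gt0.
have mM := @measurable_lorentzX n.+1.
have mMp (D : set mR) : measurable_fun D (fun y : mR => (lorentz y ^+ n.+1)%:E * (y `^ al)%:E)%E.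
  by apply: emeasurable_funM; [exact: measurable_funTS|exact: measurable_powRE].
have p0 (y : R) : (0 <= (lorentz y ^+ n.+1)%:E * (y `^ al)%:E)%E.
  by rewrite -EFinM lee_fin mulr_ge0// powR_ge0.
have m1 : measurable ([set` `]0%R, 1%R]] : set mR) by exact: measurable_itv.
have m2 : measurable ([set` `]1%R, +oo[] : set mR) by exact: measurable_itv.
have U : [set` `]0%R, +oo[] = [set` `]0%R, 1%R]] `|` [set` `]1%R, +oo[] :> set mR.
  apply/seteqP; split=> t /=; rewrite !in_itv/= ?andbT.
    by move=> t0; have [tB|tB] := leP t 1; [left|right]; rewrite ?t0.
  by case=> [/andP[//]|]; apply: lt_trans.
rewrite U ge0_integral_setU//; last first.
  by apply/disj_setPS => t /= []; rewrite !in_itv/= andbT => /andP[_ h1] h2; lra.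
rewrite EFinD; apply: leeD.
  apply: (@le_trans _ _ (\int[leb]_(y in `]0%R, 1%R]) (y `^ al)%:E)%E).
    apply: ge0_le_integral => //.
    - exact: measurable_powRE.
    - move=> y; rewrite /= in_itv /= => /andP[y0 y1].
      by rewrite -EFinM lee_fin ler_piMl ?powR_ge0// exprn_ile1 ?lorentz_le1 ?(ltW (lorentz_gt0 _)).
  by have := integral_powR_near0 al1 ltr01; rewrite powR1 div1r.
apply: (@le_trans _ _ (\int[leb]_(y in `]1%R, +oo[) (lorentz y)%:E)%E).
  apply: ge0_le_integral => //.
  - by apply/measurable_EFinP/measurable_funTS; exact: continuous_measurable_fun (@continuous_lorentz R).
  - move=> y; rewrite /= in_itv /= andbT => y1.
    rewrite -EFinM lee_fin exprS -mulrA ler_piMr ?(ltW (lorentz_gt0 _))//.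
    have y2 : 0 < 1 + y ^+ 2 by have := sqr_ge0 y; lra.
    rewrite /lorentz exprVn ler_pdivrMl ?exprn_gt0// mulr1.
    apply: (@le_trans _ _ (y `^ (2 * n)%:R)).
      rewrite ler_powR ?(ltW y1)// (le_trans (ler_norm _))// (le_trans (ltW (truncnS_gt _)))//.
      by rewrite ler_nat leq_pmull.
    rewrite powR_mulrn; last lra.
    by rewrite exprM lerXn2r ?nnegrE ?sqr_ge0 ?(ltW y2)// lerDr.
apply: (@le_trans _ _ (\int[leb]_y (lorentz y)%:E)%E).
  apply: ge0_subset_integral => //.
    by apply/measurable_EFinP; exact: continuous_measurable_fun (@continuous_lorentz R).
  by move=> t _; rewrite lee_fin ltW// lorentz_gt0.
by rewrite /Rintegral fineK//; exact: (integrable_fin_num measurableT (@integrable_lorentz R)).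
Qed.

(** The squared modulus of [z + i] is at least [1 + x ^+ 2] and at least [1 + y ^+ 2], so the
    squared function is at most [lorentz x * lorentz y ^+ n]. One factor is integrated over lines;
    the others are left for the Bergman weight. *)
Lemma bump_hspace : exists (N : nat) (H : hspace k),
  forall z, 0 < complex.Im z -> uhp_ext H z = (z + 'i)^-1 ^+ N.
Proof.
have [n [B [B0 nB]]] := energy_lorentzX.
have L0 := lorentz_mass_ge0 R.
pose N := n.+1.
pose G : uhp R -> C^o := fun w => (uval w + 'i)^-1 ^+ N.
have GE z : 0 < complex.Im z -> uhp_ext G z = (z + 'i)^-1 ^+ N.
  by move=> z0; rewrite (uhp_ext_in _ z0).
have hG : holomorphic G.
  apply/holomorphicE => z z0; eexists; apply: (@cder_ext _ (fun z => (z + 'i)^-1 ^+ N)).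
    exists (complex.Im z) => // h hz; rewrite GE//.
    have := ler_Im_normc h; rewrite ler_norml ImD => /andP[? _]; lra.
  apply/cderX/cderV; first by apply: cderD; [exact: cder_id|exact: cder_cst].
  apply/eqP => /(congr1 (@complex.Im R)); rewrite ImD /= => h; lra.
have ln (y : R) : 0 < y -> (line G y <= lam%:E * (lorentz y ^+ n)%:E)%E.
  move=> y0; have Lf : (\int[leb]_t (lorentz t)%:E = lam%:E)%E.
    by rewrite /Rintegral fineK//; exact: (integrable_fin_num measurableT (@integrable_lorentz R)).
  rewrite -Lf -ge0_integralZr//; last 3 first.
  - by apply/measurable_EFinP; exact: continuous_measurable_fun (@continuous_lorentz R).
  - by move=> t _; rewrite lee_fin ltW// lorentz_gt0.
  - by rewrite lee_fin exprn_ge0// ltW// lorentz_gt0.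
  apply: ge0_le_integral => //.
  - by move=> x _; rewrite lee_fin mod2_ge0.
  - apply/measurable_EFinP.
    exact: (measurableT_comp (measurable_mod2 hG) (pair2_measurable y)).
  - apply/measurable_EFinP; apply: measurable_funM => //.
    exact: continuous_measurable_fun (@continuous_lorentz R).
  move=> x _; rewrite -EFinM lee_fin /mod2 /= GE// normcX normcV -exprM mulnC exprM.
  have -> : (normc (x +i* y + 'i))^-1 ^+ 2 = (x ^+ 2 + (y + 1) ^+ 2)^-1.
    by rewrite exprVn normc_sqr ReD ImD /= addr0.
  have x2 := sqr_ge0 x; have y2 := sqr_ge0 y.
  have yy : 1 + y ^+ 2 <= (y + 1) ^+ 2 by nra.
  have p0 : 0 < x ^+ 2 + (y + 1) ^+ 2 by lra.
  set p := x ^+ 2 + (y + 1) ^+ 2 in p0 *.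
  have px : 1 + x ^+ 2 <= p by rewrite /p; lra.
  have py : 1 + y ^+ 2 <= p by rewrite /p; lra.
  have pi : 0 <= p^-1 by rewrite invr_ge0 ltW.
  rewrite exprS; apply: ler_pM; rewrite ?exprn_ge0//.
    by rewrite /lorentz lef_pV2 ?posrE; lra.
  rewrite lerXn2r ?nnegrE// ?(ltW (lorentz_gt0 _))// /lorentz lef_pV2 ?posrE; lra.
have mP := measurable_lorentzX n.
have eG : (energy k (line G) <= (Num.sqrt (lam * B) ^+ 2)%:E)%E.
  rewrite sqr_sqrtr; last exact: mulr_ge0.
  apply: (@le_trans _ _ (lam%:E * energy k (fun y : mR => (lorentz y ^+ n)%:E))%E).
    apply: energy_le => //.
    - exact: measurable_line.
    - exact: line_ge0.
    - by move=> y; rewrite lee_fin exprn_ge0// ltW// lorentz_gt0.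
  by rewrite EFinM lee_wpmul2l ?lee_fin.
have [H HG _] := hspace_of_energy hG (sqrtr_ge0 _) eG.
by exists N, H => z z0; rewrite HG GE.
Qed.

End test_functions.

Lemma Re_itM (R : realType) (t : R) (z : R[i]) :
  complex.Re ('i * t%:C * z) = - (t * complex.Im z).
Proof. by rewrite !ReIm /=; ring. Qed.

Section approximate_eigenvectors.
Variables (R : realType) (k : hspace_kind R) (w0 : R[i]).
Local Notation C := R[i].
Hypothesis w00 : 0 <= complex.Im w0.

Let den_neq0 (et : R) z : 0 < et -> 0 < complex.Im z -> et%:C * z + 'i != 0.
Proof.
move=> e0 z0; apply/eqP => /(congr1 (@complex.Im R)); rewrite !ReIm /=.
have := mulr_gt0 e0 z0; lra.
Qed.

(** For [et <= 1] and height [y > 0] one has [et * |z + i| <= |et * z + i|], and the exponential has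
    modulus at most 1. So the function is dominated by [et ^ -N] times that of [bump_hspace]. *)
Lemma test_hspace : exists N : nat, forall et t : R, 0 < et <= 1 -> 0 <= t ->
  exists F : hspace k, forall z, 0 < complex.Im z ->
    uhp_ext F z = cexp ('i * t%:C * z) * (et%:C * z + 'i)^-1 ^+ N.
Proof.
have [N [H HE]] := bump_hspace k; exists N => et t /andP[e0 e1] t0.
pose G : uhp R -> C^o := fun w => cexp ('i * t%:C * uval w) * (et%:C * uval w + 'i)^-1 ^+ N.
have GE z : 0 < complex.Im z -> uhp_ext G z = cexp ('i * t%:C * z) * (et%:C * z + 'i)^-1 ^+ N.
  by move=> z0; rewrite (uhp_ext_in _ z0).
have hG : holomorphic G.
  apply/holomorphicE => z z0; eexists.
  apply: (@cder_ext _ (fun z => cexp ('i * t%:C * z) * (et%:C * z + 'i)^-1 ^+ N)).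
    exists (complex.Im z) => // h hz; rewrite GE//.
    have := ler_Im_normc h; rewrite ler_norml ImD => /andP[? _]; lra.
  apply: cderM; first exact: cder_cexp_lin.
  apply/cderX/cderV; last exact: den_neq0.
  by apply: cderD; [exact/cderZ/cder_id|exact: cder_cst].
have et0 : 0 <= et^-1 ^+ N by rewrite exprn_ge0// invr_ge0 ltW.
have dom w : normc (G w) <= et^-1 ^+ N * normc (H w).
  have z0 := uvalP w; rewrite -(uhp_extE H) HE// /G.
  rewrite normcM normc_cexp !normcX !normcV -exprMn -invfM.
  rewrite -[leRHS]mul1r ler_pM ?expR_ge0 ?exprn_ge0 ?invr_ge0 ?normc_ge0//.
    by rewrite -expR0 ler_expR Re_itM oppr_le0 mulr_ge0// ltW.
  rewrite lerXn2r ?nnegrE ?invr_ge0 ?mulr_ge0 ?normc_ge0 ?(ltW e0)//.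
  have d0 : 0 < normc (uval w + 'i).
    by have := den_neq0 ltr01 z0; rewrite mul1r -normc_gt0.
  rewrite lef_pV2 ?posrE ?mulr_gt0//; last by rewrite normc_gt0 den_neq0.
  rewrite -(@ler_pXn2r _ 2) ?nnegrE ?mulr_ge0 ?normc_ge0 ?(ltW e0)//.
  rewrite exprMn !normc_sqr !ReIm /= !mul0r !subr0 !addr0 mulrDr -!exprMn.
  by rewrite lerD2l lerXn2r ?nnegrE; nra.
have [F FG _] := hspace_pt_dominated hG et0 dom.
by exists F => z z0; rewrite FG GE.
Qed.

(** The [N]-th power of this is the multiplier by which translation by [w0] acts on a test function,
    apart from the constant exponential factor. *)
Let ratio (et : R) z : C := (et%:C * z + 'i) / (et%:C * (z + w0) + 'i).

Let ratioB1 (et : R) z : 0 < et -> 0 < complex.Im z ->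
  normc (ratio et z - 1) <= et * normc w0.
Proof.
move=> e0 z0; have zw : 0 < complex.Im (z + w0) by rewrite ImD ltr_wpDr.
have d0 := den_neq0 e0 zw.
have E (e w v i : C) : e * (w + v) + i != 0 ->
    (e * w + i) / (e * (w + v) + i) - 1 = - (e * v) / (e * (w + v) + i).
  by move=> ?; field.
rewrite /ratio E// normcM normc_opp normcM normcV normc_real gtr0_norm//.
rewrite ler_piMr ?mulr_ge0 ?normc_ge0 ?(ltW e0)// invf_le1 ?normc_gt0//.
apply: le_trans (ler_Im_normc _); rewrite !ReIm /= mul0r addr0.
rewrite gtr0_norm; first by have := mulr_gt0 e0 zw; rewrite ImD; lra.
by have := mulr_gt0 e0 zw; rewrite ImD; lra.
Qed.

Let trans_test N (et t : R) (F : hspace k) z : 0 < et -> 0 < complex.Im z ->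
  (forall z, 0 < complex.Im z ->
    uhp_ext F z = cexp ('i * t%:C * z) * (et%:C * z + 'i)^-1 ^+ N) ->
  uhp_ext (trans w0 F) z = cexp ('i * t%:C * w0) * ratio et z ^+ N * uhp_ext F z.
Proof.
move=> e0 z0 FE; have zw : 0 < complex.Im (z + w0) by rewrite ImD ltr_wpDr.
have d0 := den_neq0 e0 z0.
rewrite transE// !FE// mulrDr cexpD /ratio expr_div_n exprVn.
rewrite (exprVn (et%:C * z + 'i)).
have dN : (et%:C * z + 'i) ^+ N != 0 by rewrite expf_neq0.
have E (x y c d : C) : d != 0 -> x * y * c = y * (d * c) * (x * d^-1).
  by move=> d1; field.
exact: E.
Qed.

Let test_neq0 N (et t : R) (F : hspace k) : 0 < et ->
  (forall z, 0 < complex.Im z ->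
    uhp_ext F z = cexp ('i * t%:C * z) * (et%:C * z + 'i)^-1 ^+ N) ->
  0 < nH k F.
Proof.
move=> e0 FE; rewrite lt_neqAle nH_ge0 andbT eq_sym; apply/eqP => /nH_eq0 F0.
have i0 : 0 < complex.Im ('i : C) by rewrite /= ltr01.
have := FE _ i0; rewrite F0.
have -> : uhp_ext (0 : hspace k) 'i = 0 by rewrite (uhp_ext_in _ i0).
move=> /esym/eqP; rewrite mulf_eq0 (negPf (cexp_neq0 _)) /=.
by rewrite expf_eq0 invr_eq0 (negPf (den_neq0 e0 i0)) andbF.
Qed.

Let subX1 (q : C) N : normc q <= 2 -> normc (q ^+ N - 1) <= (N * 2 ^ N)%:R * normc (q - 1).
Proof.
move=> q2; elim: N => [|N IH]; first by rewrite expr0 subrr normc0 mul0r.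
rewrite (_ : _ - 1 = q * (q ^+ N - 1) + (q - 1)); last by rewrite exprS; ring.
apply: (le_trans (ler_normcD _ _)); rewrite normcM.
have h := ler_pM (normc_ge0 _) (normc_ge0 _) q2 IH.
apply: (le_trans (lerD h (lexx _))).
rewrite (_ : _ + _ = (2 * (N * 2 ^ N)%:R + 1) * normc (q - 1)); last by ring.
rewrite ler_wpM2r ?normc_ge0// -(natrM _ 2) natr1 ler_nat.
by rewrite mulnCA -expnS ltn_pmul2r ?expn_gt0.
Qed.

Lemma approx_eigenvector (t0 : R) : 0 <= t0 -> forall K : R, exists F : hspace k,
  K * nH k (trans w0 F - cexp ('i * w0 * t0%:C) *: F) < nH k F.
Proof.
move=> t00 K; have [N H] := test_hspace.
set la := cexp _.
pose c := normc la * (N * 2 ^ N)%:R * normc w0.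
have c0 : 0 <= c by rewrite !mulr_ge0 ?normc_ge0.
(* The three summands give [et <= 1], [et * normc w0 <= 1], which bounds [ratio] by 2, and
   [et * (|K| * c) < 1]. *)
pose et := (1 + normc w0 + `|K| * c)^-1.
have et0 : 0 < et.
  by rewrite invr_gt0 -addrA ltr_pwDl// addr_ge0 ?normc_ge0// mulr_ge0.
have et1 : et * (1 + normc w0 + `|K| * c) = 1 by rewrite mulVf// -invr_eq0 gt_eqF.
have Kc0 : 0 <= `|K| * c by rewrite mulr_ge0.
have w0n := normc_ge0 w0.
have etle : et <= 1 by rewrite -et1 ler_peMr ?(ltW et0)//; lra.
have etw : et * normc w0 <= 1 by rewrite -et1 ler_wpM2l ?(ltW et0)//; lra.
have [|F FE] := H et t0 _ t00; first by rewrite et0.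
have nF := test_neq0 et0 FE.
exists F.
have D z : 0 < complex.Im z -> normc (uhp_ext (trans w0 F - la *: F : hspace k) z) <=
    et * c * normc (uhp_ext F z).
  move=> z0; rewrite uhp_ext_hspaceB uhp_ext_hspaceZ (trans_test et0 z0 FE).
  have -> : cexp ('i * t0%:C * w0) = la by rewrite /la mulrAC.
  have E (l q f : C) : l * q * f - l * f = l * (q - 1) * f by ring.
  rewrite E (normcM (la * _)) (normcM la) ler_wpM2r ?normc_ge0//.
  have r1 := ratioB1 et0 z0.
  have r2 : normc (ratio et z) <= 2.
    by have := ler_normcD (ratio et z - 1) 1; rewrite subrK normc1; lra.
  rewrite /c (_ : et * _ = normc la * ((N * 2 ^ N)%:R * (et * normc w0))); last by ring.
  rewrite ler_wpM2l ?normc_ge0//; apply: (le_trans (subX1 N r2)).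
  by rewrite ler_wpM2l.
have [||G GE Gn] := @hspace_pt_dominated R k F (trans w0 F - la *: F : hspace k) (et * c)
    (hspace_holomorphic _).
- by rewrite mulr_ge0// ltW.
- by move=> w; rewrite -(uhp_extE (trans w0 F - la *: F : hspace k)) -(uhp_extE F); apply: D; exact: uvalP.
rewrite GE in Gn.
apply: (@le_lt_trans _ _ (`|K| * (et * c * nH k F))).
  apply: (@le_trans _ _ (`|K| * nH k (trans w0 F - la *: F : hspace k))).
    by rewrite ler_wpM2r ?nH_ge0// ler_norm.
  by rewrite ler_wpM2l.
have E (x y z n : R) : x * (y * z * n) = y * (x * z) * n by ring.
rewrite E.
rewrite gtr_pMl// -et1 ltr_pM2l//; lra.
Qed.

Lemma approx_kernel : 0 < complex.Im w0 -> forall K : R, exists F : hspace k,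
  K * nH k (trans w0 F) < nH k F.
Proof.
move=> b0 K; have [N H] := test_hspace.
pose c := `|K| * (1 + normc w0) ^+ N.
have w0n := normc_ge0 w0.
have c0 : 0 <= c by rewrite mulr_ge0// exprn_ge0// addr_ge0.
(* The exponential then shrinks the test function by [expR (- c)], and [c < expR c] beats both [K]
   and the bound [(1 + normc w0) ^+ N] on the remaining factor. *)
pose t := c / complex.Im w0.
have t0 : 0 <= t by rewrite divr_ge0// ltW.
have tb : t * complex.Im w0 = c by rewrite divfK// gt_eqF.
have [|F FE] := H 1 t _ t0; first by rewrite ltr01 lexx.
have nF := test_neq0 ltr01 FE.
exists F.
pose d := expR (- c) * (1 + normc w0) ^+ N.
have d0 : 0 <= d by rewrite mulr_ge0 ?expR_ge0// exprn_ge0// addr_ge0.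
have D z : 0 < complex.Im z -> normc (uhp_ext (trans w0 F) z) <= d * normc (uhp_ext F z).
  move=> z0; rewrite (trans_test ltr01 z0 FE) normcM ler_wpM2r ?normc_ge0//.
  rewrite normcM normc_cexp Re_itM tb ler_wpM2l ?expR_ge0// normcX.
  rewrite lerXn2r ?nnegrE ?normc_ge0 ?addr_ge0//.
  have r1 := ratioB1 ltr01 z0.
  by have := ler_normcD (ratio 1 z - 1) 1; rewrite subrK normc1; lra.
have [|G GE Gn] := @hspace_pt_dominated R k F (trans w0 F) d
    (hspace_holomorphic _) d0.
  by move=> w; rewrite -(uhp_extE (trans w0 F)) -(uhp_extE F); apply: D; exact: uvalP.
rewrite GE in Gn.
apply: (@le_lt_trans _ _ (`|K| * (d * nH k F))).
  apply: (@le_trans _ _ (`|K| * nH k (trans w0 F))).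
    by rewrite ler_wpM2r ?nH_ge0// ler_norm.
  by rewrite ler_wpM2l.
have E (x y z n : R) : x * (y * z * n) = y * (x * z) * n by ring.
rewrite /d E.
rewrite gtr_pMl// expRN ltr_pdivrMl ?expR_gt0// mulr1.
by rewrite -/c; apply: lt_le_trans (expR_ge1Dx c); rewrite ltrDr ltr01.
Qed.

End approximate_eigenvectors.

(** * Absence of eigenvectors *)

Section injectivity.
Variables (R : realType) (k : hspace_kind R).
Local Notation leb := (@lebesgue_measure R).
Local Notation mR := (measurableTypeR R).
Local Notation C := R[i].
Local Notation lam := (\int[leb]_x lorentz x).
Implicit Types (F : hspace k) (z : C).

(** By periodicity the integrals over [[c, +oo[] and [[c + a, +oo[] agree; being finite, they can be
    cancelled, which leaves 0 for one period. *)
Lemma periodic_integral0 (h : mR -> R) (a c : R) : 0 < a -> measurable_fun setT h ->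
  (forall x, 0 <= h x) -> (forall x, h (a + x) = h x) ->
  (\int[leb]_x (h x)%:E < +oo)%E ->
  (\int[leb]_(x in `[c, (c + a)%R[) (h x)%:E = 0)%E.
Proof.
move=> a0 mh h0 ha hoo.
have mhE (D : set mR) : measurable_fun D (EFin \o h) by apply/measurable_EFinP; exact: measurable_funTS.
have m1 : measurable ([set` `[c, (c + a)%R[] : set mR) by exact: measurable_itv.
have m2 : measurable ([set` `[(c + a)%R, +oo[] : set mR) by exact: measurable_itv.
have m3 : measurable ([set` `[c, +oo[] : set mR) by exact: measurable_itv.
have hE x : (0 <= (h x)%:E)%E by rewrite lee_fin.
have U : [set` `[c, +oo[] = [set` `[c, (c + a)%R[] `|` [set` `[(c + a)%R, +oo[] :> set mR.
  apply/seteqP; split=> t /=; rewrite !in_itv/= ?andbT.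
    by move=> t0; have [tB|tB] := ltP t (c + a); [left|right]; rewrite ?t0.
  by case=> [/andP[]//|]; apply: le_trans; lra.
have S : (\int[leb]_(x in `[c, +oo[) (h x)%:E = \int[leb]_(x in `[(c + a)%R, +oo[) (h x)%:E)%E.
  have := ge0_integral_shift a m2 (mhE _) (fun x _ => hE x).
  rewrite (_ : +%R a @^-1` _ = [set` `[c, +oo[]); last first.
    by apply/seteqP; split=> t /=; rewrite !in_itv/= !andbT; lra.
  by move=> <-; apply: eq_integral => x _; rewrite /= ha.
have : (\int[leb]_(x in `[c, +oo[) (h x)%:E = \int[leb]_(x in `[c, (c + a)%R[) (h x)%:E +
    \int[leb]_(x in `[(c + a)%R, +oo[) (h x)%:E)%E.
  rewrite U ge0_integral_setU//.
  by apply/disj_setPS => t /= []; rewrite !in_itv/= andbT => /andP[_ h1] h2; lra.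
rewrite {1}S.
have fin : (\int[leb]_(x in `[(c + a)%R, +oo[) (h x)%:E)%E \is a fin_num.
  rewrite ge0_fin_numE ?integral_ge0//; apply: le_lt_trans hoo.
  by apply: ge0_subset_integral => //; exact: mhE.
set I := integral _ _ _ in fin *; set J := integral _ _ _.
move=> E; have := subee fin; rewrite {1}E addeK//.
Qed.

(** As [la] has modulus 1, [|F|] is periodic along horizontal lines, and it is square integrable
    there. So [|F|^2] has integral 0 over each period, and [mean_inequality] on a square narrower
    than a period gives [F = 0]. *)
Lemma eigen_real_inj F (w0 la : C) : w0 != 0 -> complex.Im w0 = 0 -> normc la = 1 ->
  trans w0 F = la *: F -> F = 0.
Proof.
move=> w00 Iw l1 TF; have hF := hspace_holomorphic F.
pose a := complex.Re w0.
have wE : w0 = a%:C by apply/eqP; rewrite eq_complex /= Iw !eqxx.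
have a0 : 0 < `|a|.
  by rewrite normr_gt0; apply: contra_neq w00; rewrite wE => ->.
have per x (y : R) : 0 < y -> mod2 F (a + x, y) = mod2 F (x, y).
  move=> y0; have z0 : 0 < complex.Im (x +i* y) by [].
  have wz : 0 <= complex.Im w0 by rewrite Iw.
  have := transE F wz z0; rewrite TF uhp_ext_hspaceZ => h.
  rewrite /mod2 /= (_ : (a + x) +i* y = x +i* y + w0); last first.
    by rewrite wE; apply/eqP; rewrite eq_complex !ReIm /= addrC addr0 !eqxx.
  by rewrite -h normcM l1 mul1r.
have per' x (y : R) : 0 < y -> mod2 F (`|a| + x, y) = mod2 F (x, y).
  move=> y0; have [_|_] := ger0P a; first exact: per.
  by rewrite -(per (- a + x) y y0) addNKr.
apply: hspace_ext => z z0.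
have y0 : 0 < complex.Im z by [].
(* The square of half-side [rho] must stay in the half-plane and be narrower than one period. *)
pose rho := Num.min (complex.Im z) `|a| / 4.
have r0 : 0 < rho by rewrite divr_gt0// lt_min y0.
have ry : rho < complex.Im z.
  by rewrite ltr_pdivrMr//; apply: le_lt_trans (_ : complex.Im z < _); [rewrite ge_min lexx|lra].
have ra : 2 * rho < `|a|.
  rewrite /rho; have : Num.min (complex.Im z) `|a| <= `|a| by rewrite ge_min lexx orbT.
  lra.
have := mean_inequality r0 (holomorphic_sq hF ry) (measurable_mod2 hF) (mod2_ge0 F).
move=> /(_ (fun x y _ _ => erefl)).
rewrite [X in (_ <= _ * X)%E]integral0_eq ?mule0.
  rewrite lee_fin => h.
  have -> : uhp_ext (0 : hspace k) z = 0 by rewrite (uhp_ext_in _ z0).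
  apply/eqP; rewrite -normc_eq0 -sqrf_eq0 eq_le h sqr_ge0//.
move=> y; rewrite /= in_itv /= => /andP[y1 y2].
have yp : 0 < y by lra.
apply/eqP; rewrite eq_le; apply/andP; split; last first.
  by apply: integral_ge0 => x _; rewrite lee_fin mod2_ge0.
have my : measurable_fun setT (fun x : mR => mod2 F (x, y)).
  exact: (measurableT_comp (measurable_mod2 hF) (pair2_measurable y)).
have fin : (\int[leb]_x (mod2 F (x, y))%:E < +oo)%E.
  by apply: le_lt_trans (line_hspace F yp (lexx y)) _; rewrite ltry.
rewrite -(periodic_integral0 (complex.Re z - rho) a0 my (fun x => mod2_ge0 F (x, y)) (fun x => per' x y yp) fin).
apply: ge0_subset_integral => //.
- by apply/measurable_EFinP/measurable_funTS.
- by move=> x _; rewrite lee_fin mod2_ge0.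
- by move=> x /=; rewrite !in_itv /= => /andP[x1 x2]; apply/andP; lra.
Qed.

(* e^(- i t z) F is w0-periodic and square integrable on horizontal lines, uniformly
   at height >= Im w0; a translate of it is then in the Hardy space, whose functions
   tend to 0 at infinite height. *)
Lemma eigen_upper_inj F (w0 : C) (t : R) : 0 < complex.Im w0 ->
  trans w0 F = cexp ('i * w0 * t%:C) *: F -> F = 0.
Proof.
move=> b0 TF; have hF := hspace_holomorphic F.
set la := cexp _ in TF.
have la0 : la != 0 by exact: cexp_neq0.
have w00 := ltW b0.
pose a := complex.Re w0; pose b := complex.Im w0.
pose G z := cexp (- ('i * t%:C * z)) * uhp_ext F z.
have Fw z : 0 < complex.Im z -> uhp_ext F (z + w0) = la * uhp_ext F z.
  by move=> z0; have := transE F w00 z0; rewrite TF uhp_ext_hspaceZ.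
have Gw z : 0 < complex.Im z -> G (z + w0) = G z.
  move=> z0; rewrite /G Fw// mulrDr opprD cexpD /la -(mulrA _ _ (cexp ('i * w0 * _) * _)).
  rewrite (mulrA (cexp (- ('i * t%:C * w0)))) -cexpD.
  by rewrite [X in cexp (X + _)](_ : _ = - ('i * w0 * t%:C)) ?addNr ?cexp0 ?mul1r// mulrAC.
have Gwn n z : 0 < complex.Im z -> G (z + w0 *+ n) = G z.
  move=> z0; elim: n => [|n IH]; first by rewrite mulr0n addr0.
  rewrite mulrSr addrA Gw// ImD ltr_wpDr//.
  by elim: {IH} n => [|n IH]; rewrite ?mulr0n// mulrS ImD addr_ge0.
have nG z : normc (G z) ^+ 2 = expR (t * complex.Im z) ^+ 2 * normc (uhp_ext F z) ^+ 2.
  by rewrite /G normcM normc_cexp ReN Re_itM opprK exprMn.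
pose ib : C := 'i * b%:C.
have Iib : complex.Im ib = b by exact: Im_iM.
(* The shift by [i b] keeps the heights above [b], where [line F] has the uniform bound of
   [line_hspace]. *)
pose H : uhp R -> C^o := fun w => G (uval w + ib).
have HE z : 0 < complex.Im z -> uhp_ext H z = G (z + ib).
  by move=> z0; rewrite (uhp_ext_in _ z0).
have hH : holomorphic H.
  apply/holomorphicE => z z0.
  have zb : 0 < complex.Im (z + ib) by rewrite ImD Iib addr_gt0.
  have [l lP] := (holomorphicE F).1 hF _ zb.
  have dG : cderivable G (z + ib).
    eexists; apply: cderM lP; apply: (@cder_ext _ (fun z => cexp (- ('i * t%:C) * z))).
      by exists 1 => // h _; rewrite mulNr.
    exact: cder_cexp_lin.
  have [m mP] := dG; exists m; apply: cder_ext (cder_shift mP).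
  exists (complex.Im z) => // h hz; rewrite HE//.
  have := ler_Im_normc h; rewrite ler_norml ImD => /andP[? _]; lra.
pose M := expR (`|t| * (2 * b)) ^+ 2 * (line_bound k (submean_cst R) b * nH k F ^+ 2).
have M0 : 0 <= M.
  rewrite mulr_ge0 ?sqr_ge0// mulr_ge0 ?sqr_ge0//.
  exact/line_bound_ge0/submean_cst_ge0.
have wn n : w0 *+ n = (n%:R * a) +i* (n%:R * b).
  elim: n => [|n IH]; first by rewrite mulr0n !mul0r.
  rewrite mulrSr IH -natr1; apply/eqP; rewrite eq_complex !ReIm /= !mulrDl !mul1r.
  by rewrite !eqxx.
have lineH (y : R) : 0 < y -> (line H y <= M%:E)%E.
  (* Subtracting [n] periods brings the height [y + b] to [y'] in [[b, 2 * b]], where the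
     exponential factor is bounded too. *)
  move=> y0; pose n := Num.truncn (y / b).
  have /andP[n1 n2] : n%:R <= y / b < n.+1%:R.
    by rewrite truncn_le ?divr_ge0 ?(ltW y0) ?(ltW b0)// truncnS_gt.
  move: n1 n2; rewrite ler_pdivlMr// ltr_pdivrMr// -natr1 => n1 n2.
  pose y' := y + b - n%:R * b.
  have y'1 : b <= y' by rewrite /y'; lra.
  have y'2 : y' <= 2 * b by rewrite /y'; move: n2; rewrite mulrDl mul1r; lra.
  have y'0 : 0 < y' by apply: lt_le_trans y'1.
  have mE x : mod2 H (x, y) = expR (t * y') ^+ 2 * mod2 F (- (n%:R * a) + x, y').
    rewrite /mod2 /= HE//.
    have -> : x +i* y + ib = (- (n%:R * a) + x) +i* y' + w0 *+ n.
      by rewrite wn /ib /y'; apply/eqP; rewrite eq_complex !ReIm /=; apply/andP; split; apply/eqP; ring.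
    by rewrite Gwn// nG.
  have my : measurable_fun setT (fun x : mR => (mod2 F (x, y'))%:E).
    apply/measurable_EFinP.
    exact: (measurableT_comp (measurable_mod2 hF) (pair2_measurable y')).
  have S := ge0_integral_shift (- (n%:R * a)) measurableT my (fun x _ => ltac:(rewrite lee_fin; exact: mod2_ge0)).
  rewrite preimage_setT in S.
  rewrite /line; under eq_integral do rewrite mE EFinM.
  have mx : measurable_fun setT (fun x : mR => (mod2 F (- (n%:R * a) + x, y'))%:E).
    apply/measurable_EFinP; apply: (measurableT_comp (measurable_mod2 hF)).
    apply/measurable_fun_pairP; split; last exact: measurable_cst.
    exact: measurable_funD.
  rewrite ge0_integralZl//; last first.
    by move=> x _; rewrite lee_fin mod2_ge0.
  rewrite S /M (EFinM (expR (`|t| * (2 * b)) ^+ 2)); apply: lee_pmul.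
  - by rewrite lee_fin sqr_ge0.
  - exact: line_ge0.
  - rewrite lee_fin lerXn2r ?nnegrE ?expR_ge0// ler_expR.
    apply: (le_trans (ler_wpM2r (ltW y'0) (ler_norm t))).
    by rewrite ler_wpM2l.
  - exact: line_hspace.
have eH : (energy Hardy (line H) <= (Num.sqrt M ^+ 2)%:E)%E.
  by rewrite sqr_sqrtr//=; apply: ge_ereal_sup => _ [y /= y0 <-]; exact: lineH.
have [H' H'E _] := hspace_of_energy hH (sqrtr_ge0 M) eH.
have G0 z : 0 < complex.Im z -> G (z + ib) = 0.
  move=> z0; apply/eqP; rewrite -normc_eq0 -sqrf_eq0.
  set p := normc _ ^+ 2; have p0 : 0 <= p by rewrite sqr_ge0.
  (* In the Hardy space [pt_bound] is inversely proportional to the height. After [n.+1] periods the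
     height is at least [n.+1 * b], while the value of [G] is unchanged, so [p] is at most
     [q / n.+1] for every [n]. *)
  pose q := submean_cst R * nH Hardy H ^+ 2 / b.
  have pn n : p * n.+1%:R <= q.
    have nb : 0 < n.+1%:R * b by rewrite mulr_gt0// ltr0n.
    have Iz : n.+1%:R * b <= complex.Im (z + w0 *+ n.+1) by rewrite ImD wn /= lerDr ltW.
    have Iz0 : 0 < complex.Im (z + w0 *+ n.+1) by apply: lt_le_trans Iz.
    have := eval_bound H' nb Iz; rewrite H'E HE// addrAC Gwn; last by rewrite ImD Iib addr_gt0.
    move=> h0; have : p <= (Num.sqrt (pt_bound Hardy (n.+1%:R * b)) * nH Hardy H) ^+ 2.
      by rewrite /p lerXn2r ?nnegrE ?normc_ge0// mulr_ge0 ?sqrtr_ge0 ?nH_ge0.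
    rewrite exprMn sqr_sqrtr ?pt_bound_ge0 ?(ltW nb)// /pt_bound /= mulr1 => h.
    rewrite -ler_pdivlMr ?ltr0n//; apply: (le_trans h).
    have E (S N m u : R) : m != 0 -> u != 0 -> S / (m * u) * N = S * N / u / m.
      by move=> ? ?; field; apply/andP.
    by rewrite E ?gt_eqF// ltr0n.
  rewrite eq_le p0 andbT leNgt; apply/negP => pp.
  have := pn (Num.truncn (q / p)); rewrite mulrC -ler_pdivlMr//.
  by rewrite leNgt truncnS_gt.
apply: hspace_ext => z z0.
have -> : uhp_ext (0 : hspace k) z = 0 by rewrite (uhp_ext_in _ z0).
have za : 0 < complex.Im (z + a%:C) by rewrite ImD /= addr0.
have := G0 _ za.
have -> : z + a%:C + ib = z + w0.
  by rewrite /ib; apply/eqP; rewrite eq_complex !ReIm /=; apply/andP; split; apply/eqP; rewrite -/a -/b; ring.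
move=> /eqP; rewrite Gw// mulf_eq0 (negPf (cexp_neq0 _)) /= => /eqP//.
Qed.

(* F vanishes above height Im w0, so the residue theorem for e^(- i t s) F (s + z)
   on a strip around s = 0 only sees the lower line, where the exponential decays as
   t -> +oo. *)
Lemma trans_inj F (w0 : C) : 0 < complex.Im w0 -> trans w0 F = 0 -> F = 0.
Proof.
move=> b0 TF; have hF := hspace_holomorphic F.
pose b := complex.Im w0.
have Fz z : b < complex.Im z -> uhp_ext F z = 0.
  move=> zb; have z0 : 0 < complex.Im (z - w0) by rewrite ImD ImN -/b; lra.
  by have := transE F (ltW b0) z0; rewrite TF subrK (uhp_ext_in _ z0).
apply: hspace_ext => z z0.
have -> : uhp_ext (0 : hspace k) z = 0 by rewrite (uhp_ext_in _ z0).
have [zb|zb] := ltP b (complex.Im z); first exact: Fz.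
(* The strip [[c, d]] around 0 keeps [s + z] in the half-plane, and on its upper line [s + z] is
   above height [b], where [F] vanishes. *)
pose y0 := complex.Im z; pose c := - (y0 / 2); pose d := b + 1; pose iM : C := 'i * y0%:C.
have IM : complex.Im iM = y0 by exact: Im_iM.
have RM : complex.Re iM = 0 by exact: Re_iM.
have yp : 0 < y0 by [].
have c0 : c < 0 by rewrite /c; lra.
have d0 : 0 < d by rewrite /d; have : 0 < b by []; lra.
(* The second factor provides the quadratic decay required by [strip_residue]; its zero [- i y0]
   lies below the strip. *)
pose E s := s * (s + iM); pose K s := (E s)^-1.
have iM0 : iM != 0 by rewrite -normc_gt0; apply: lt_le_trans (ler_Im_normc _); rewrite IM gtr0_norm.
have dE s : cder E s (1 * (s + iM) + s * (1 + 0)).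
  by apply: cderM; [exact: cder_id|apply: cderD; [exact: cder_id|exact: cder_cst]].
have sM x s : c <= s -> x +i* s + iM != 0.
  move=> cs; rewrite -normc_gt0; apply: lt_le_trans (ler_Im_normc _).
  by rewrite ImD IM /= normr_gt0 gt_eqF//; move: cs; rewrite /c; lra.
have Kd x s : c <= s <= d -> x +i* s != 0 -> cderivable K (x +i* s).
  move=> /andP[cs _] xs; eexists; apply: cderV (dE _) _.
  by rewrite mulf_neq0// sM.
have E0 : E 0 = 0 by rewrite /E mul0r.
have dE0 : cder E 0 iM by have := dE 0; rewrite mul1r mul0r add0r addr0.
have Kr (e : R) : 0 < e -> exists2 d : R, 0 < d & forall h, h != 0 ->
    normc h < d -> normc (h * K h - iM^-1) <= e by exact: simple_pole iM0 E0 dE0 e.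
pose q := y0 ^+ 2 / 4; have q0 : 0 < q by rewrite divr_gt0// exprn_gt0.
(* For [1 <= |x|] the modulus of [K] is at most [x ^ -2 <= 2 * lorentz x]. On the two boundary lines
   both factors of [E] have an imaginary part of modulus at least [y0 / 2], so that of [K] is at
   most [(x ^+ 2 + q)^-1 <= (1 + q^-1) * lorentz x]. *)
pose A := 2 + q^-1; have A0 : 0 <= A by rewrite addr_ge0// invr_ge0 ltW.
have nK x s p : 0 < p -> p <= normc (x +i* s) ^+ 2 -> p <= normc (x +i* s + iM) ^+ 2 ->
    normc (K (x +i* s)) <= p^-1.
  move=> p0 h1 h2; have h : p <= normc (E (x +i* s)).
    rewrite -(@ler_pXn2r _ 2) ?nnegrE ?normc_ge0 ?(ltW p0)// /E normcM exprMn expr2.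
    by apply: ler_pM; rewrite ?(ltW p0).
  by rewrite normcV lef_pV2 ?posrE//; apply: lt_le_trans h.
have inv_le (u v m : R) : 0 < u -> 0 < v -> v <= m * u -> u^-1 <= m * v^-1.
  by move=> u0 v0 h; rewrite ler_pdivlMr// mulrC ler_pdivrMr.
have l0 (x : R) : 0 < 1 + x ^+ 2 by have := sqr_ge0 x; lra.
have KX x s : c <= s <= d -> 1 <= `|x| -> normc (K (x +i* s)) <= A * lorentz x.
  move=> _ x1.
  have x2 : 1 <= x ^+ 2 by rewrite -[x ^+ 2]real_normK ?num_real// expr_ge1.
  apply: (@le_trans _ _ (x ^+ 2)^-1).
    by apply: nK; rewrite ?normc_sqr ?ReD ?RM /= ?addr0 ?lerDl ?sqr_ge0//; lra.
  apply: inv_le => //; first lra.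
  have : 0 <= q^-1 * x ^+ 2 by rewrite mulr_ge0 ?sqr_ge0// invr_ge0 ltW.
  by rewrite /A mulrDl; lra.
have KL s : y0 / 2 <= `|s| -> y0 / 2 <= s + y0 -> forall x, normc (K (x +i* s)) <= A * lorentz x.
  move=> s1 s2 x.
  have x2 := sqr_ge0 x; have x2q : 0 < x ^+ 2 + q by lra.
  have sq (u : R) : y0 / 2 <= `|u| -> q <= u ^+ 2.
    move=> h; rewrite -(real_normK (num_real u)) (_ : q = (y0 / 2) ^+ 2).
      by rewrite lerXn2r ?nnegrE// divr_ge0// ltW.
    by rewrite /q exprMn exprVn; congr (_ / _); ring.
  apply: (@le_trans _ _ (x ^+ 2 + q)^-1).
    apply: nK => //; rewrite normc_sqr ?ReD ?ImD ?RM ?IM /= ?addr0 lerD2l sq//.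
    by apply: le_trans s2 _; exact: ler_norm.
  apply: inv_le => //.
  have : 0 <= q^-1 * x ^+ 2 by rewrite mulr_ge0// invr_ge0 ltW.
  have : q^-1 * q = 1 by rewrite mulVf// gt_eqF.
  by rewrite /A mulrDl mulrDr; lra.
pose B := Num.sqrt (pt_bound k (y0 / 2)) * nH k F.
have B0 : 0 <= B by rewrite mulr_ge0 ?sqrtr_ge0 ?nH_ge0.
have Fd x s : c <= s <= d -> cderivable (fun u => uhp_ext F (u + z)) (x +i* s).
  move=> /andP[cs _]; have [l lP] : cderivable (uhp_ext F) (x +i* s + z).
    apply: (holomorphicE F).1 => //.
    by rewrite ImD /= -/y0; move: cs; rewrite /c; lra.
  by exists l; exact: cder_shift.
have FB x s : c <= s <= d -> normc (uhp_ext F (x +i* s + z)) <= B.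
  move=> /andP[cs _]; apply: eval_bound; first by rewrite divr_gt0.
  by rewrite ImD /= -/y0; move: cs; rewrite /c; lra.
have main (t : R) : 0 <= t ->
    normc (uhp_ext F z * iM^-1 * wind R) <= 2 * (B * expR (t * c) * A * lam).
  move=> t0; pose g s := cexp (- ('i * t%:C) * s) * uhp_ext F (s + z).
  have ng x s : normc (g (x +i* s)) = expR (t * s) * normc (uhp_ext F (x +i* s + z)).
    by rewrite /g normcM normc_cexp mulNr ReN Re_itM opprK.
  have gd x s : c <= s <= d -> cderivable g (x +i* s).
    move=> cs; have [l lP] := Fd x s cs; eexists.
    by apply: cderM lP; exact: cder_cexp_lin.
  have gB x s : c <= s <= d -> normc (g (x +i* s)) <= expR (t * d) * B.
    move=> cs; rewrite ng; apply: ler_pM; rewrite ?expR_ge0 ?normc_ge0 ?FB//.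
    by rewrite ler_expR ler_wpM2l//; case/andP: cs.
  have KLc : forall x, normc (K (x +i* c)) <= A * lorentz x.
    by apply: KL; rewrite /c ?normrN ?gtr0_norm; lra.
  have KLd : forall x, normc (K (x +i* d)) <= A * lorentz x.
    have yd : y0 <= d by rewrite /d; lra.
    by apply: KL; rewrite ?gtr0_norm; lra.
  have := strip_residue c0 d0 A0 gd gB Kd Kr KX KLc KLd.
  rewrite (_ : g 0 = uhp_ext F z); last by rewrite /g mulr0 cexp0 mul1r add0r.
  rewrite [X in _ - X](_ : _ = 0); last first.
    rewrite (_ : cint _ _ = cint (setT : set mR) (fun=> 0)).
      by rewrite /cint /Rintegral !integral0.
    apply: eq_cint => x _; rewrite /g Fz ?mulr0 ?mul0r//.
    by rewrite ImD /= /d -/y0; lra.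
  rewrite subr0 => <-.
  have cc : c <= c <= d by rewrite lexx ltW// (lt_trans c0).
  have bd (x : mR) : normc (g (x +i* c) * K (x +i* c)) <= B * expR (t * c) * A * lorentz x.
    rewrite normcM ng -mulrA; apply: ler_pM; rewrite ?mulr_ge0 ?expR_ge0 ?normc_ge0//.
    by rewrite mulrC ler_wpM2r ?expR_ge0// FB.
  have iL : leb.-integrable setT (EFin \o (fun x => B * expR (t * c) * A * lorentz x)).
    have := @integrableZl _ mR R leb setT measurableT (B * expR (t * c) * A) _ (@integrable_lorentz R).
    by apply: eq_integrable => //= x _; rewrite EFinM.
  have rc x : rcont (fun x => g (x +i* c) * K (x +i* c)) x.
    apply: rcontM.
      by apply: ccont_h; apply/cderivable_ccont/gd.
    apply: ccont_h; apply/cderivable_ccont/Kd => //.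
    by rewrite complex_neq0// (lt_eqF c0) orbT.
  have ig : cintegrable (setT : set mR) (fun x => g (x +i* c) * K (x +i* c)).
    apply: (cintegrable_le measurableT _ _ iL) => //.
    - exact: measurable_rcont_Re.
    - exact: measurable_rcont_Im.
  apply: (le_trans (cint_le measurableT ig iL _)) => //.
  by rewrite RintegralZl//; exact: integrable_lorentz.
have p0 : normc (uhp_ext F z * iM^-1 * wind R) <= 0.
  apply: (@geometric_small R (expR (- 1)) _ (2 * (B * A * lam))).
    by rewrite expR_ge0 /= -[ltRHS]expR0 ltr_expR; lra.
  (* This choice turns [expR (t * c)] into [expR (- 1) ^+ n], so that [geometric_small] applies. *)
  move=> n; pose t := n%:R / - c.
  have t0 : 0 <= t by rewrite divr_ge0// oppr_ge0 ltW.
  apply: (le_trans (main t t0)).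
  have -> : expR (t * c) = expR (- 1) ^+ n.
    have h (m u : R) : u != 0 -> m / - u * u = m * -1 by move=> ?; field.
    by rewrite -expRM_natl /t h// lt_eqF.
  by rewrite le_eqVlt; apply/orP; left; apply/eqP; ring.
apply/eqP; move: p0; rewrite -normc_eq0 !normcM !normcV.
have w0' : 0 < normc (wind R) by rewrite normc_gt0 wind_neq0.
have i0' : 0 < (normc iM)^-1 by rewrite invr_gt0 normc_gt0.
by rewrite pmulr_lle0// pmulr_lle0// => h; rewrite eq_le h normc_ge0.
Qed.

End injectivity.

(** * The spectrum *)

Section spiral.
Variables (R : realType) (w0 : R[i]).
Local Notation C := R[i].
Implicit Types (z : C) (t : R).

Let spiral : set C^o := [set cexp ('i%C * w0 * t%:C) | t in [set t : R | 0 <= t]].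

Lemma closure_normc (A : set C^o) z :
  closure A z <-> forall e : R, 0 < e -> exists2 x, A x & normc (z - x) < e.
Proof.
split=> [clA e e0|h B /nbhs_ballP[e /= e0 Be]].
  have [|x [Ax]] := clA (ball (z : C^o) e%:C).
    by apply: nbhsx_ballx; rewrite ltcR.
  by rewrite -ball_normE /= normc_norm ltcR; exists x.
have [e' eE] : exists e' : R, e = e'%:C by apply/complex_realP; rewrite gtr0_real.
move: e0 Be; rewrite {}eE ltcR => e0 Be.
have [x Ax xz] := h _ e0; exists x; split=> //.
by apply: Be; rewrite -ball_normE /= normc_norm ltcR.
Qed.

Let normc_spiral t : normc (cexp ('i%C * w0 * t%:C)) = expR (- (t * complex.Im w0)).
Proof. by rewrite mulrAC normc_cexp Re_itM. Qed.

Lemma circle_spiral z : w0 != 0 -> complex.Im w0 = 0 -> normc z = 1 -> spiral z.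
Proof.
move=> w00 Iw z1; pose a := complex.Re w0.
have wE : w0 = a%:C by apply/eqP; rewrite eq_complex /= Iw !eqxx.
have a0 : a != 0 by apply: contra_neq w00; rewrite wE => ->.
have [ap|an] := ltP 0 a.
  have [th th0 thz] := cexp_polar z1.
  exists (th / a) => /=; first by rewrite divr_ge0// ltW.
  by rewrite -thz wE -mulrA -rmorphM /= [a * _]mulrC divfK.
(* For [a < 0] the circle is run through clockwise; a nonnegative parameter is obtained from the
   argument of [z^-1]. *)
have zV : normc z^-1 = 1 by rewrite normcV z1 invr1.
have [th th0 thz] := cexp_polar zV.
exists (th / - a) => /=; first by rewrite divr_ge0// oppr_ge0.
rewrite -[RHS]invrK -thz -cexpN wE -mulrA -rmorphM /=; congr cexp.
have E (u v : R) : v != 0 -> v * (u / - v) = - u by move=> ?; field.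
by rewrite E// rmorphN mulrN.
Qed.

Lemma closure_spiral_real : w0 != 0 -> complex.Im w0 = 0 ->
  closure spiral = [set z : C | `|z| = 1].
Proof.
move=> w00 Iw; apply/seteqP; split=> z /=.
  move=> /closure_normc cz; rewrite normc_norm; congr (_%:C).
  apply/eqP; rewrite -subr_eq0 -normr_eq0 eq_le normr_ge0 andbT.
  apply/ler_addgt0Pr => e /cz[_ [t t0 <-] h]; rewrite add0r.
  have n1 : normc (cexp ('i%C * w0 * t%:C)) = 1 by rewrite normc_spiral Iw mulr0 oppr0 expR0.
  by rewrite -{1}n1; apply: (le_trans (ler_dist_normc _ _)); exact: ltW.
rewrite normc_norm => -[z1]; apply: subset_closure; exact: circle_spiral.
Qed.

Lemma closure_spiral_upper : 0 < complex.Im w0 ->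
  closure spiral = spiral `|` [set 0].
Proof.
move=> b0; pose b := complex.Im w0; apply/seteqP; split=> z; last first.
  move=> [|->]; first exact: subset_closure.
  (* The point at [t] has modulus [expR (- e^-1)], below [e] because [e^-1 < expR e^-1]. *)
  apply/closure_normc => e e0; pose t := e^-1 / b.
  have t0 : 0 <= t by rewrite divr_ge0 ?invr_ge0 ?(ltW e0) ?(ltW b0).
  exists (cexp ('i%C * w0 * t%:C)); first by exists t.
  rewrite sub0r normc_opp normc_spiral /t divfK ?gt_eqF//.
  rewrite expRN invf_plt ?posrE ?expR_gt0//.
  by apply: lt_le_trans (expR_ge1Dx _); rewrite ltrDr.
move=> /closure_normc cz; have [->|z0] := eqVneq z 0; [by right|left].
have r0 : 0 < normc z by rewrite normc_gt0.
have r1 : normc z <= 1.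
  apply/ler_addgt0Pr => e /cz[_ [t t0 <-] h].
  have := ler_normcD (z - cexp ('i%C * w0 * t%:C)) (cexp ('i%C * w0 * t%:C)).
  rewrite subrK => /le_trans; apply; rewrite addrC lerD ?(ltW h)//.
  by rewrite normc_spiral -[leRHS]expR0 ler_expR oppr_le0 mulr_ge0// ltW.
(* The modulus determines the parameter on the spiral, so [s] is the only candidate. *)
pose s := - ln (normc z) / b.
have s0 : 0 <= s by rewrite divr_ge0 ?(ltW b0)// oppr_ge0 ln_le0.
have sb : expR (- (s * b)) = normc z by rewrite /s divfK ?gt_eqF// opprK lnK.
exists s => //; apply/eqP; rewrite eq_sym -subr_eq0 -normc_eq0 eq_le normc_ge0 andbT.
apply/ler_addgt0Pr => e e0; rewrite add0r.
have e2 : 0 < e / 2 by rewrite divr_gt0.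
have [d d0 P] := cder_cont (cder_cexp_lin ('i%C * w0) s%:C) e2.
(* A point of the spiral whose modulus differs from that of [z] by less than [e1] has its parameter
   within [d] of [s], by monotonicity of the modulus; continuity then brings it close to the point
   at [s]. *)
pose e1 := Num.min (expR (- ((s - d) * b)) - normc z) (normc z - expR (- ((s + d) * b))).
have e10 : 0 < e1.
  rewrite lt_min !subr_gt0 -sb !ltr_expR !ltrN2 !ltr_pM2r//; apply/andP; split; lra.
have [|_ [t t0 <-] h] := cz (Num.min (e / 2) e1); first by rewrite lt_min e2.
move: h; rewrite lt_min => /andP[h1 h2].
rewrite -(subrK (cexp ('i%C * w0 * t%:C)) z) -addrA.
apply: (le_trans (ler_normcD _ _)); rewrite [leRHS](splitr e) lerD ?(ltW h1)//.
apply: ltW; have -> : t%:C = s%:C + (t - s)%:C :> C by rewrite -rmorphD /= addrC subrK.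
apply: P; rewrite normc_real.
have h3 : `|normc z - expR (- (t * b))| < e1.
  by rewrite -normc_spiral; apply: le_lt_trans (ler_dist_normc _ _) h2.
move: h3; rewrite ltr_norml lt_min => /andP[h3 h4].
rewrite ltr_norml; apply/andP; split; rewrite ltNge; apply/negP => h.
  have : expR (- ((s - d) * b)) <= expR (- (t * b)).
    by rewrite ler_expR lerN2 ler_wpM2r ?(ltW b0)//; lra.
  have : e1 <= expR (- ((s - d) * b)) - normc z by rewrite ge_min lexx.
  by move: h3; rewrite ltrNl; lra.
have : expR (- (t * b)) <= expR (- ((s + d) * b)).
  by rewrite ler_expR lerN2 ler_wpM2r ?(ltW b0)//; lra.
by case/andP: h4; lra.
Qed.

End spiral.

Section spectrum.
Variables (R : realType) (k : hspace_kind R) (w0 : R[i]).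
Local Notation C := R[i].
Implicit Types (F G : hspace k).
Hypotheses (w0_ge0 : 0 <= complex.Im w0) (w0_neq0 : w0 != 0).

Let D (la : C) F := trans w0 F - la *: F.

Let D_linear la : linear (D la).
Proof.
move=> c F G; rewrite /D linearP scalerDr opprD addrACA scalerBr !scalerA.
by rewrite [c * la]mulrC.
Qed.

Lemma not_fredholm_of la : (forall F, trans w0 F = la *: F -> F = 0) ->
  (forall K : R, exists F, K * nH k (D la F) < nH k F) -> ~ fredholm (D la).
Proof.
move=> inj app [_ cl _]; have [K K0 KP] := trans_bound k.
have DM F : nH k (D la F) <= (K + normc la) * nH k F.
  by apply: (le_trans (nHB _ _)); rewrite nHZ mulrDl lerD2r.
have Dinj F : D la F = 0 -> F = 0 by move/eqP; rewrite subr_eq0 => /eqP/inj.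
have [M MP] := closed_range_bounded_below (@D_linear la) DM Dinj cl.
by have [F] := app M; rewrite ltNge MP.
Qed.

Lemma not_fredholm_spiral (t : R) : 0 <= t ->
  ~ fredholm (D (cexp ('i * w0 * t%:C))).
Proof.
move=> t0; apply: not_fredholm_of => [F|]; last exact: approx_eigenvector.
have [b0|b0] := ltP 0 (complex.Im w0); first exact: eigen_upper_inj.
have Iw : complex.Im w0 = 0 by apply/eqP; rewrite eq_le b0.
by apply: eigen_real_inj => //; rewrite mulrAC normc_cexp Re_itM Iw mulr0 oppr0 expR0.
Qed.

Lemma not_fredholm0 : 0 < complex.Im w0 -> ~ fredholm (D 0).
Proof.
move=> b0; apply: not_fredholm_of => [F|K]; first by rewrite scale0r; exact: trans_inj.
by have [F FK] := approx_kernel k w0_ge0 b0 K; exists F; rewrite /D scale0r subr0.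
Qed.

Let invertible la (K : R) :
  (forall G, exists2 F, D la F = G & nH k F <= K * nH k G) ->
  (forall F, trans w0 F = la *: F -> F = 0) -> invertible_op (D la).
Proof.
move=> surj inj; apply: (@invertible_of_solvable R k _ (@D_linear la) K) => // F.
by move/eqP; rewrite subr_eq0 => /eqP/inj.
Qed.

Lemma invertible_gt1 la : 1 < normc la -> invertible_op (D la).
Proof.
move=> l1; have [K K0 KP] := neumann_surj k w0_ge0 l1.
by apply: invertible KP _ => F; exact: neumann_inj.
Qed.

Lemma transN F : complex.Im w0 = 0 -> trans w0 (trans (- w0) F) = F.
Proof.
move=> Iw; apply: hspace_ext => z z0.
by rewrite !transE ?subrKA ?addrK// ?ImN ?ImD Iw ?oppr0 ?addr0.
Qed.

Lemma transKN F : complex.Im w0 = 0 -> trans (- w0) (trans w0 F) = F.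
Proof.
move=> Iw; apply: hspace_ext => z z0.
by rewrite !transE ?subrK// ?ImN ?ImD ?ImN Iw ?oppr0 ?addr0.
Qed.

(** For real [w0] the inverse of [trans w0] is [trans (- w0)], and [trans w0 - la] is [- la] times
    [trans w0] applied after [trans (- w0) - la^-1], to which the Neumann series applies since
    [normc la^-1 > 1]. The value [la = 0] is separate. *)
Lemma invertible_lt1 la : complex.Im w0 = 0 -> normc la < 1 -> invertible_op (D la).
Proof.
move=> Iw l1; have Iw' : 0 <= complex.Im (- w0) by rewrite ImN Iw oppr0.
have [->|l0] := eqVneq la 0.
  have [K K0 KP] := trans_bound k.
  apply: (@invertible 0 K) => [G|F]; last first.
    by rewrite scale0r => h; rewrite -(transKN F Iw) h linear0.
  by exists (trans (- w0) G); rewrite /D ?scale0r ?subr0 ?transN.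
have lV : 1 < normc la^-1 by rewrite normcV invf_gt1 ?normc_gt0.
have [K K0 KP] := neumann_surj k Iw' lV.
have [M M0 MP] := trans_bound k.
apply: (@invertible la (K * (normc la^-1 * M))) => [G|F TF]; last first.
  apply: (neumann_inj Iw' lV); rewrite -{2}(transKN F Iw) TF linearZ /= scalerA mulVf//.
  by rewrite scale1r.
(* The right-hand side is chosen so that applying [trans w0] to the equation gives
   [F - la^-1 *: trans w0 F = - (la^-1 *: G)]. *)
have [F FE FK] := KP (- (la^-1 *: trans (- w0) G)); exists F.
  have h : F - la^-1 *: trans w0 F = - (la^-1 *: G).
    by have := congr1 (trans w0) FE; rewrite linearB linearN !linearZ /= !transN.
  have -> : D la F = - (la *: (F - la^-1 *: trans w0 F)).
    by rewrite /D scalerBr scalerA mulfV// scale1r opprB.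
  by rewrite h scalerN opprK scalerA mulfV// scale1r.
apply: (le_trans FK); rewrite nHN nHZ -!mulrA ler_wpM2l//.
by rewrite ler_wpM2l ?normc_ge0.
Qed.

Lemma invertible_off_spiral la : 0 < complex.Im w0 -> la != 0 ->
  (forall t : R, 0 <= t -> la != cexp ('i * w0 * t%:C)) -> invertible_op (D la).
Proof.
move=> b0 l0 lt; have [l1|l1] := ltP 1 (normc la); first exact: invertible_gt1.
(* The resolvent asks for all real [t]; the points with [t < 0] have modulus above 1, and
   [normc la <= 1] here. *)
have lt' t : la != cexp ('i * w0 * t%:C).
  have [t0|t0] := leP 0 t; first exact: lt.
  apply: contraTneq l1 => ->; rewrite -ltNge mulrAC normc_cexp Re_itM -[ltLHS]expR0 ltr_expR.
  by rewrite -mulNr mulr_gt0// oppr_gt0.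
have [K K0 KP] := resolvent_surj k b0 l0 lt'.
by apply: invertible KP _ => F; exact: resolvent_inj.
Qed.

End spectrum.

Theorem theoremA (R : realType) (k : hspace_kind R) (w0 : R[i])
    (Im_w0_ge0 : 0 <= complex.Im w0) (w0_neq0 : w0 != 0)
    (tau : uhp R -> uhp R)
    (tauE : forall w : uhp R, uval (tau w) = uval w + w0) :
  let spiral : set R[i]^o :=
    [set cexp ('i%C * w0 * t%:C) | t in [set t : R | 0 <= t]] in
  exists C : {linear hspace k -> hspace k},
    [/\ continuous C
      & forall (F : hspace k) (w : uhp R), C F w = F (tau w)] /\
    [/\ spectrum C = closure spiral,
        complex.Im w0 = 0 -> closure spiral = [set z : R[i] | `|z| = 1],
        0 < complex.Im w0 -> closure spiral = spiral `|` [set 0]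
      & ess_spectrum C = spectrum C].
Proof.
move=> spiral.
pose C : {linear hspace k -> hspace k} := trans w0.
have inv la : ~ closure spiral la -> invertible_op (fun v => C v - la *: v).
  move=> ncl; have [b0|b0] := ltP 0 (complex.Im w0).
    move: ncl; rewrite closure_spiral_upper// => ncl.
    apply: invertible_off_spiral => //; first by apply/eqP => l0; apply: ncl; right.
    by move=> t t0; apply/eqP => lE; apply: ncl; left; exists t.
  have Iw : complex.Im w0 = 0 by apply/eqP; rewrite eq_le b0.
  move: ncl; rewrite closure_spiral_real//= normc_norm => ncl.
  have [l1|l1|l1] := ltrgtP (normc la) 1.
  - exact: invertible_lt1.
  - exact: invertible_gt1.
  - by case: ncl; rewrite l1.
have nfr la : closure spiral la -> ~ fredholm (fun v => C v - la *: v).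
  have [b0|b0] := ltP 0 (complex.Im w0).
    rewrite closure_spiral_upper// => -[[t /= t0 <-]|->].
      exact: not_fredholm_spiral.
    exact: not_fredholm0.
  have Iw : complex.Im w0 = 0 by apply/eqP; rewrite eq_le b0.
  rewrite closure_spiral_real//= normc_norm => -[l1].
  have [t /= t0 <-] := circle_spiral w0_neq0 Iw l1.
  exact: not_fredholm_spiral.
have spE : spectrum C = closure spiral.
  apply/seteqP; split=> la /= h.
    by apply: contrapT => /inv.
  by move=> /invertible_fredholm fr; apply: (nfr la h); apply: fr.
exists C; split; first split.
- have [K K0 KP] := trans_bound k; exact: bounded_continuous (KP w0).
- move=> F w; rewrite -(uhp_extE (C F)) -(uhp_extE F) tauE.
  by rewrite transE//; exact: uvalP.
split=> //.
- exact: closure_spiral_real.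
- exact: closure_spiral_upper.
apply/seteqP; split=> la /=; last by rewrite spE => /nfr.
move=> nf inv'; apply: nf; apply: invertible_fredholm => //.
Qed.
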